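(* Let $(M,g)$ be a Riemannian manifold. Then $$V(TM\otimes\mathbb{C},g\otimes\mathbb{C})_{NS}=\bigotimes_{n>0}\Lambda\big(t^{-n+\frac12}TM\otimes\mathbb{C}\big)\otimes\bigotimes_{n>0}S\big(t^{-n}TM\otimes\mathbb{C}\big),$$ with the fiberwise structure described in the context, is an $N=1$ superconformal vertex algebra bundle over $M$. Hence the space of sections $\Gamma(M,V(TM\otimes\mathbb{C},g\otimes\mathbb{C})_{NS})$ is an $N=1$ superconformal vertex algebra.
   Context: **Vertex algebras.** A field acting on a vector space $V$ is a formal series $a(z)=\sum_{n\in\mathbb{Z}}a_{(n)}z^{-n-1}\in\mathrm{End}(V)[[z,z^{-1}]]$ such that for any $v\in V$, $a_{(n)}v=0$ for $n\gg0$. A vertex algebra consists of a $\mathbb{Z}$-graded vector space $V$, a vacuum vector $|0\rangle\in V_0$, and a degree zero linear map $Y:V\to\mathrm{End}V[[z,z^{-1}]]$ with image in the space of fields, $Y(a,z)=\sum_{n}a_{(n)}z^{-n-1}$, such that: (1) $[T,Y(a,z)]=\partial_zY(a,z)$, where $T(a)=a_{(-2)}|0\rangle$; (2) $Y(|0\rangle,z)=\mathrm{id}_V$ and $Y(a,z)|0\rangle|_{z=0}=a$; (3) for any $a,b\in V$, $Y(a,z)$ and $Y(b,w)$ are mutually local, i.e. $(z-w)^N[Y(a,z),Y(b,w)]=0$ for some $N$. Even and odd refer to degree mod 2, and brackets are graded commutators. A conformal vertex algebra of rank (central charge) $c$ is a vertex algebra with a conformal vector $\nu$ of degree $0$ such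 that $Y(\nu,z)=\sum_{n\in\mathbb{Z}}L_nz^{-n-2}$ satisfies $[L_m,L_n]=(m-n)L_{m+n}+\frac{(m^3-m)c}{12}\delta_{m+n,0}$, $L_{-1}=T$, and $L_0$ is diagonalizable. An $N=1$ superconformal vertex algebra (SCVA) is a conformal vertex algebra $V$ of rank $c$ with an odd vector $\tau$ (the $N=1$ superconformal vector) such that $G(z)=Y(\tau,z)=\sum_{m\in\frac12+\mathbb{Z}}G_mz^{-m-\frac32}$ satisfies $[G_m,G_n]=2L_{m+n}+\frac13(m^2-\frac14)\delta_{m+n,0}\,c$ and $[G_m,L_n]=(m-\frac n2)G_{m+n}$. **Bundles.** An $N=1$ SCVA bundle with fiber $V$ over $M$ is a vector bundle with fiber $V$ whose transition functions lie in the automorphism group of the $N=1$ SCVA $V$. The space of its sections carries pointwise operations: for sections $A,B$, the section $A_{(n)}B$ is $x\mapsto A(x)_{(n)}B(x)$, and $Y(A,z)B=\sum_nA_{(n)}B\,z^{-n-1}$; the vacuum and the structure vectors are the sections defined by the fiberwise ones. $\Gamma(M,\cdot)$ denotes the space of sections. **The fiber.** Let $T$ be a finite dimensional complex vector space with an inner product $g:T\otimes T\to\mathbb{C}$ (symmetric, nondegenerate, bilinear). Put $B(T,g)=S(\oplus_{n<0}t^nT)=\bigotimes_{n>0}S(t^{-n}T)$ and $F(T,g)_{NS}=\Lambda(\oplus_{n>0}t^{-n+\frac12}T)=\bigotimes_{n>0}\Lambda(t^{-n+\frac12}T)$. For $a\in T$ write $a_n=t^na$, and let $a(z)=\sum_{n\in\mathbb{Z}}a_{(n)}z^{-n-1}$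 on $B(T,g)$, where $a_{(n)}$ is the symmetric product by $a_n$ for $n<0$ and $n$ times the contraction (via $g$) by $a_{-n}$ for $n\ge0$. For $\phi\in T$ write $\phi_r=t^r\phi$, and let $\phi(z)=\sum_{r\in\frac12+\mathbb{Z}}\phi_{(r)}z^{-r-\frac12}$ on $F(T,g)_{NS}$, where $\phi_{(r)}$ is the exterior product by $\phi_r$ for $r<0$ and the contraction (via $g$) by $\phi_{-r}$ for $r>0$. With $\partial^{(j)}=\partial_z^j/j!$ and $:\ :$ the normally ordered product, the vertex algebra structures are $$Y(a^1_{-j_1-1}\cdots a^m_{-j_m-1},z)=:\partial^{(j_1)}a^1(z)\cdots\partial^{(j_m)}a^m(z):,$$ $$Y(\phi^1_{-j_1-\frac12}\cdots\phi^m_{-j_m-\frac12},z)=:\partial^{(j_1)}\phi^1(z)\cdots\partial^{(j_m)}\phi^m(z):,$$ for $j_1,\dots,j_m\ge0$. The tensor product $V(T,g)_{NS}=B(T,g)\otimes F(T,g)_{NS}$ is an $N=1$ SCVA of central charge $\frac32\dim T$ with $$\tau=\sum_i a^i_{-1}\phi^i_{-\frac12},\qquad \nu=\frac12\sum_i a^i_{-1}a^i_{-1}+\frac12\sum_i\phi^i_{-\frac32}\phi^i_{-\frac12},$$ where $\{e^i\}$ is an orthonormal basis of $T$, written $\{a^i\}$ for the copy of $T$ in $B(T,g)$ and $\{\phi^i\}$ for the copy in $F(T,g)_{NS}$. These vectors do not depend on the basis, and $O(T,g)$ acts by automorphisms. The bundle in the claim is obtained by applying this construction to $(T_xM\otimes\mathbb{C},g_x\otimes\mathbb{C})$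 for $x\in M$, using the principal bundle of orthonormal frames of $(M,g)$, whose structure group acts on the fiber by automorphisms.
   Formalization: The grading is taken mod 2 (no invariant Z-grading makes τ odd with Y of degree 0), and Γ means smooth sections of bounded conformal weight: automatic for compact M, while for noncompact M of positive dimension all sections violate A_(n)B=0 for n≫0. *)

(* Defs.v *)
From HB Require Import structures.
From mathcomp Require Import all_boot all_order all_algebra.
From mathcomp Require Import generic_quotient.
From mathcomp Require Import all_classical all_reals all_analysis.
From mathcomp Require Import complex.

Set Implicit Arguments.
Unset Strict Implicit.
Unset Printing Implicit Defensive.

Import Order.TTheory GRing.Theory Num.Theory numFieldNormedType.Exports.

Local Open Scope classical_set_scope.
Local Open Scope ring_scope.
Local Open Scope quotient_scope.

(* [mode a n b] is a_(n) b, so Y(a,z) b = \sum_n (mode a n b) z^(-n-1).  Only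
   the parity of the grading is recorded (false = even, true = odd): an odd
   vector tau with tau_(2) tau a nonzero multiple of the vacuum cannot be
   homogeneous for an integer grading preserved by Y. *)
Record scva_data (K : fieldType) (V : lmodType K) := ScvaData {
  gr : bool -> set V;
  vac : V;
  mode : V -> int -> V -> V;
  nu : V;
  tau : V }.

Section VertexAlgebra.
Context {K : fieldType} {V : lmodType K}.
Implicit Types (d : scva_data V) (a b c v : V) (m n : int) (p q : bool).

Definition trans d a : V := mode d a (-2) (vac d).

(* [a_(m), b_(n)] for a, b of parities p, q *)
Definition sbracket d p q a m b n c : V :=
  mode d a m (mode d b n c) - (-1) ^+ (p && q) *: mode d b n (mode d a m c).

(* In va_local, the sum is the coefficient of z^(-m-1) w^(-n-1) in
   (z-w)^N [Y(a,z), Y(b,w)] c. *)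
Record is_vertex_algebra d : Prop := {
  va_gr0 : forall p, gr d p 0;
  va_grP : forall p (k : K) a b, gr d p a -> gr d p b -> gr d p (k *: a + b);
  va_gr_sum : forall v, exists a b, [/\ gr d false a, gr d true b & v = a + b];
  va_gr_direct : forall v, gr d false v -> gr d true v -> v = 0;
  va_linl : forall (k : K) a b n c,
    mode d (k *: a + b) n c = k *: mode d a n c + mode d b n c;
  va_linr : forall (k : K) a n b c,
    mode d a n (k *: b + c) = k *: mode d a n b + mode d a n c;
  va_gr_mode : forall p q a n b,
    gr d p a -> gr d q b -> gr d (p (+) q) (mode d a n b);
  va_field : forall a b, exists N, forall n, N <= n -> mode d a n b = 0;
  va_gr_vac : gr d false (vac d);
  va_trans : forall a n b, trans d (mode d a n b) - mode d a n (trans d b) =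
    (- n%:~R) *: mode d a (n - 1) b;
  va_vac : forall n b, mode d (vac d) n b = if n == -1 then b else 0;
  va_creation : forall a, mode d a (-1) (vac d) = a /\
    forall n, 0 <= n -> mode d a n (vac d) = 0;
  va_local : forall p q a b, gr d p a -> gr d q b ->
    exists N : nat, forall m n c,
      \sum_(i < N.+1) ((-1) ^+ i * 'C(N, i)%:R) *:
        sbracket d p q a (m + N%:Z - i%:Z) b (n + i%:Z) c = 0 }.

Definition vir d n v : V := mode d (nu d) (n + 1) v.

Definition diagonalizable_op (f : V -> V) := forall v, exists (k : nat)
  (w : 'I_k -> V) (l : 'I_k -> K),
  (forall i, f (w i) = l i *: w i) /\ v = \sum_i w i.

Record is_conformal d (c : K) : Prop := {
  conf_va : is_vertex_algebra d;
  conf_gr : gr d false (nu d);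
  conf_vir : forall m n v, vir d m (vir d n v) - vir d n (vir d m v) =
    (m - n)%:~R *: vir d (m + n) v +
    (if m + n == 0 then ((m ^+ 3 - m)%:~R * c / 12) *: v else 0);
  conf_trans : forall v, vir d (-1) v = trans d v;
  conf_diag : diagonalizable_op (vir d 0) }.

(* Half-integers are shifted: [smode d r] is G_(r - 1/2). *)
Definition smode d n v : V := mode d (tau d) n v.
Definition half_of n : K := n%:~R - 2^-1.

Record is_N1SCVA d (c : K) : Prop := {
  n1_conf : is_conformal d c;
  n1_gr : gr d true (tau d);
  n1_GG : forall r s v, smode d r (smode d s v) + smode d s (smode d r v) =
    2 *: vir d (r + s - 1) v +
    (if r + s == 1
     then (3^-1 * (half_of r ^+ 2 - 4^-1) * c) *: v else 0);
  n1_GL : forall r n v, smode d r (vir d n v) - vir d n (smode d r v) =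
    (half_of r - n%:~R / 2) *: smode d (r + n) v }.

End VertexAlgebra.

Record scva_iso (K : fieldType) (V W : lmodType K)
    (dV : scva_data V) (dW : scva_data W) (f : V -> W) : Prop := {
  iso_lin : forall (k : K) u v, f (k *: u + v) = k *: f u + f v;
  iso_bij : bijective f;
  iso_gr : forall p v, gr dV p v <-> gr dW p (f v);
  iso_vac : f (vac dV) = vac dW;
  iso_mode : forall a n b, f (mode dV a n b) = mode dW (f a) n (f b);
  iso_nu : f (nu dV) = nu dW;
  iso_tau : f (tau dV) = tau dW }.

Definition scva_aut (K : fieldType) (V : lmodType K) (d : scva_data V)
  (f : V -> V) := scva_iso d d f.

(* A letter (p, k, x) stands for x_{-k-1} in t^(-k-1) T if p is false, and for
   x_{-k-1/2} in t^(-k-1/2) T if p is true. *)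
Notation letter T := (bool * nat * T)%type.
Notation fword T := (seq (letter T)).
Notation fterm K T := (seq (K * fword T)%type).

Section Fock.
Context {K : fieldType} {T : lmodType K}.
Implicit Types (l : letter T) (u w : fword T) (s t : fterm K T).

Definition lodd l : bool := l.1.1.
Definition wodd w : bool := odd (count lodd w).
(* twice the conformal weight *)
Definition wt2 w : nat :=
  (\sum_(l <- w) (if lodd l then (l.1.2).*2.+1 else (l.1.2.+1).*2))%N.

Inductive fock_eq : fterm K T -> fterm K T -> Prop :=
| fock_refl s : fock_eq s s
| fock_sym s t : fock_eq s t -> fock_eq t s
| fock_trans s t r : fock_eq s t -> fock_eq t r -> fock_eq s r
| fock_cat s s' t t' : fock_eq s s' -> fock_eq t t' ->
    fock_eq (s ++ t) (s' ++ t')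
| fock_comm s t : fock_eq (s ++ t) (t ++ s)
| fock_add a b w : fock_eq [:: (a, w); (b, w)] [:: (a + b, w)]
| fock_zero w : fock_eq [:: (0, w)] [::]
| fock_lin c u p k (a : K) (x y : T) w :
    fock_eq [:: (c, u ++ (p, k, a *: x + y) :: w)]
            [:: (c * a, u ++ (p, k, x) :: w); (c, u ++ (p, k, y) :: w)]
| fock_swap c u l l' w :
    fock_eq [:: (c, u ++ l :: l' :: w)]
            [:: ((-1) ^+ (lodd l && lodd l') * c, u ++ l' :: l :: w)].

Definition fock_eqb : rel (fterm K T) := fun s t => `[< fock_eq s t >].

Lemma fock_eqb_refl : reflexive fock_eqb.
Proof. by move=> s; apply/asboolP; exact: fock_refl. Qed.

Lemma fock_eqb_sym : symmetric fock_eqb.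
Proof.
by move=> s t; apply/asboolP/asboolP => h; exact: fock_sym.
Qed.

Lemma fock_eqb_trans : transitive fock_eqb.
Proof.
move=> t s r /asboolP h1 /asboolP h2; apply/asboolP; exact: fock_trans h1 h2.
Qed.

Canonical fock_equiv := EquivRel fock_eqb
  fock_eqb_refl fock_eqb_sym fock_eqb_trans.

Definition tscale (c : K) s : fterm K T := [seq (c * q.1, q.2) | q <- s].

Lemma tscale_eq c s t : fock_eq s t -> fock_eq (tscale c s) (tscale c t).
Proof.
elim=> {s t} [s|s t _|s t r _ h1 _|s s' t t' _ h1 _|s t|a b w|w||].
- exact: fock_refl.
- exact: fock_sym.
- exact: fock_trans h1.
- by move=> h2; rewrite /tscale !map_cat; exact: fock_cat.
- by rewrite /tscale !map_cat; exact: fock_comm.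
- by rewrite /tscale /= mulrDr; exact: fock_add.
- by rewrite /tscale /= mulr0; exact: fock_zero.
- by move=> e u p k a x y w; rewrite /tscale /= mulrA; exact: fock_lin.
- by move=> e u l l' w; rewrite /tscale /= mulrCA; exact: fock_swap.
Qed.

End Fock.

(* Finite linear combinations of words in the letters, modulo multilinearity
   and supercommutation: the symmetric algebra on the span of the even letters
   tensored with the exterior algebra on the span of the odd ones. *)
Definition fock (K : fieldType) (T : lmodType K) : Type :=
  {eq_quot (@fock_equiv K T)}.
HB.instance Definition _ (K : fieldType) (T : lmodType K) :=
  Choice.on (fock T).
HB.instance Definition _ (K : fieldType) (T : lmodType K) :=
  Quotient.on (fock T).

Section FockModule.
Context {K : fieldType} {T : lmodType K}.
Implicit Types (s t : fterm K T) (x y z : fock T).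

Definition fcls s : fock T := \pi_(fock T) s.

Lemma fclsP s t : fcls s = fcls t <-> fock_eq s t.
Proof. by split => [/eqmodP/asboolP|h]; last by apply/eqmodP/asboolP. Qed.

Lemma fcls_repr x : fcls (repr x) = x. Proof. exact: reprK. Qed.

Definition fock0 : fock T := fcls [::].
Definition fockD x y : fock T := fcls (repr x ++ repr y).
Definition fockZ (c : K) x : fock T := fcls (tscale c (repr x)).
Definition fockN x : fock T := fockZ (-1) x.

Lemma fockDE s t : fockD (fcls s) (fcls t) = fcls (s ++ t).
Proof. by apply/fclsP; apply: fock_cat; apply/fclsP/fcls_repr. Qed.

Lemma fockZE c s : fockZ c (fcls s) = fcls (tscale c s).
Proof. by apply/fclsP; apply: tscale_eq; apply/fclsP/fcls_repr. Qed.

Lemma fockE x : {s | x = fcls s}.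
Proof. by exists (repr x); rewrite fcls_repr. Qed.

Lemma fockDA : associative fockD.
Proof.
move=> x y z; have [r ->] := fockE x; have [s ->] := fockE y.
by have [t ->] := fockE z; rewrite !fockDE catA.
Qed.

Lemma fockDC : commutative fockD.
Proof.
move=> x y; have [r ->] := fockE x; have [s ->] := fockE y.
by rewrite !fockDE; apply/fclsP; exact: fock_comm.
Qed.

Lemma fock0D : left_id fock0 fockD.
Proof. by move=> x; have [r ->] := fockE x; rewrite fockDE. Qed.

End FockModule.

HB.instance Definition _ (K : fieldType) (T : lmodType K) :=
  GRing.isNmodule.Build (fock T) fockDA fockDC fock0D.

Section FockLmodule.
Context {K : fieldType} {T : lmodType K}.
Implicit Types (s t : fterm K T) (x y z : fock T).

Lemma fcls_cat s t : fcls (s ++ t) = fcls s + fcls t.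
Proof. by rewrite -fockDE. Qed.

Lemma fcls_cons q s : fcls (q :: s) = fcls [:: q] + fcls s.
Proof. by rewrite -fcls_cat. Qed.

Lemma fockZDl x (a b : K) : fockZ (a + b) x = fockZ a x + fockZ b x.
Proof.
have [r ->] := fockE x; rewrite !fockZE; elim: r => [|[c w] r ih] /=.
  by rewrite [RHS](@add0r (fock T)).
rewrite (fcls_cons _ (tscale (a + b) r)) (fcls_cons _ (tscale a r)).
rewrite (fcls_cons _ (tscale b r)) ih addrACA; congr (_ + _); rewrite -fcls_cat; apply/fclsP.
by apply: fock_sym; rewrite /= mulrDl; apply: fock_add.
Qed.

Lemma fockZDr : right_distributive (@fockZ K T) +%R.
Proof.
move=> a x y; have [r ->] := fockE x; have [s ->] := fockE y.
by rewrite -fcls_cat !fockZE -fcls_cat /tscale map_cat.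
Qed.

Lemma fock0Z x : fockZ 0 x = 0.
Proof.
have [r ->] := fockE x; rewrite !fockZE; elim: r => [//|[c w] r ih] /=.
rewrite fcls_cons ih addr0; apply/fclsP.
by rewrite mul0r; exact: fock_zero.
Qed.

Lemma fock1Z x : fockZ 1 x = x.
Proof.
have [r ->] := fockE x; rewrite !fockZE; congr fcls.
by rewrite /tscale -[RHS]map_id; apply: eq_map => -[c w]; rewrite mul1r.
Qed.

Lemma fockZA (a b : K) x : fockZ a (fockZ b x) = fockZ (a * b) x.
Proof.
have [r ->] := fockE x; rewrite !fockZE; congr fcls.
by rewrite /tscale -map_comp; apply: eq_map => -[c w] /=; rewrite mulrA.
Qed.

Lemma fockND x : fockN x + x = 0.
Proof. by rewrite -[X in _ + X]fock1Z -fockZDl addNr fock0Z. Qed.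

End FockLmodule.

HB.instance Definition _ (K : fieldType) (T : lmodType K) :=
  GRing.Nmodule_isZmodule.Build (fock T) fockND.
HB.instance Definition _ (K : fieldType) (T : lmodType K) :=
  GRing.Zmodule_isLmodule.Build K (fock T) fockZA fock1Z fockZDr
    (fun x a b => fockZDl x a b).

Section FockOperators.
Context {K : fieldType} {T : lmodType K}.
Implicit Types (l : letter T) (u w : fword T) (s t : fterm K T).

Definition fmono w : fock T := fcls [:: (1, w)].

Lemma fcls_sum s : fcls s = \sum_(q <- s) q.1 *: fmono q.2.
Proof.
elim: s => [|[c w] s ih]; first by rewrite big_nil.
rewrite big_cons -ih fcls_cons; congr (_ + _) => /=.
by rewrite [RHS]fockZE /tscale /= mulr1.
Qed.

(* f factors through the relations defining [fock T] *)
Definition super_multilinear (W : lmodType K) (f : fword T -> W) : Prop :=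
  (forall u p k (a : K) (x y : T) w, f (u ++ (p, k, a *: x + y) :: w) =
     a *: f (u ++ (p, k, x) :: w) + f (u ++ (p, k, y) :: w)) /\
  (forall u l l' w, f (u ++ l :: l' :: w) =
     (-1) ^+ (lodd l && lodd l') *: f (u ++ l' :: l :: w)).

(* The linear map taking the value f w on the class of each word w; by
   [fock_extE] it does not depend on [repr] when f is super_multilinear. *)
Definition fock_ext (W : lmodType K) (f : fword T -> W) (x : fock T) : W :=
  \sum_(q <- repr x) q.1 *: f q.2.

Lemma fock_extE (W : lmodType K) (f : fword T -> W) s :
  super_multilinear f -> fock_ext f (fcls s) = \sum_(q <- s) q.1 *: f q.2.
Proof.
move=> [flin fswap]; rewrite /fock_ext.
have: fock_eq (repr (fcls s)) s by apply/fclsP; rewrite fcls_repr.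
move: (repr _) => s'; elim=> {s' s} [//|s t _ -> //|s t r _ -> _ -> //
  |s s' t t' _ h1 _ h2|s t|a b w|w|c u p k a x y w|c u l l' w].
- by rewrite !big_cat /= h1 h2.
- by rewrite !big_cat /= addrC.
- by rewrite !big_cons !big_nil /= !addr0 scalerDl.
- by rewrite !big_cons !big_nil /= scale0r addr0.
- by rewrite !big_cons !big_nil /= !addr0 flin scalerDr scalerA.
- by rewrite !big_cons !big_nil /= !addr0 fswap scalerA mulrC.
Qed.

Lemma fock_ext_linear (W : lmodType K) (f : fword T -> W) :
  super_multilinear f -> linear (fock_ext f).
Proof.
move=> hf a x y; have [r ->] := fockE x; have [s ->] := fockE y.
rewrite -[a *: _](_ : fcls (tscale a r) = _); last by rewrite -fockZE.
rewrite -fcls_cat !fock_extE // big_cat /=; congr (_ + _).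
by rewrite big_map scaler_sumr; apply: eq_bigr => q _; rewrite scalerA.
Qed.

Lemma fmono_super_multilinear : super_multilinear fmono.
Proof.
split=> [u p k a x y w|u l l' w].
  rewrite [a *: fmono _]fockZE /tscale /= mulr1 -fcls_cat; apply/fclsP => /=.
  by have := fock_lin 1 u p k a x y w; rewrite mul1r.
rewrite [_ *: fmono _]fockZE /tscale /=; apply/fclsP; exact: fock_swap.
Qed.

Variable g : T -> T -> K.

Definition fcreate l : fock T -> fock T :=
  fock_ext (fun w => fmono (l :: w)).

Definition lpair l l' : K := if l.1 == l'.1 then g l.2 l'.2 else 0.

(* (super)derivation on words pairing l with the letters of its own mode *)
Fixpoint wcontract l w : fterm K T :=
  if w is l' :: w' then (lpair l l', w') ::
    [seq ((-1) ^+ (lodd l && lodd l') * q.1, l' :: q.2) | q <- wcontract l w']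
  else [::].

Definition fcontract l : fock T -> fock T :=
  fock_ext (fun w => fcls (wcontract l w)).

(* Modes, in the convention \sum_n A_(n) z^(-n-1), of a(z) and phi(z); phi_(r)
   in the convention of \sum_r phi_(r) z^(-r-1/2) has index n = r - 1/2. *)
Definition bfield (x : T) (n : int) (v : fock T) : fock T :=
  match n with
  | Negz k => fcreate (false, k, x) v
  | Posz 0 => 0
  | Posz k.+1 => k.+1%:R *: fcontract (false, k, x) v
  end.

Definition ffield (x : T) (n : int) (v : fock T) : fock T :=
  match n with
  | Negz k => fcreate (true, k, x) v
  | Posz k => fcontract (true, k, x) v
  end.

End FockOperators.

Section Fields.
Context {K : fieldType} {V : lmodType K}.
Implicit Types (A B : int -> V -> V).

Definition fder A : int -> V -> V := fun n v => - n%:~R *: A (n - 1) v.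
Definition fderdiv (j : nat) A : int -> V -> V :=
  fun n v => (j`!%:R)^-1 *: iter j fder A n v.

(* :AB:_(n) = \sum_(j<0) A_(j) B_(n-j-1) + (+/-) \sum_(j>=0) B_(n-j-1) A_(j),
   with sign (-1)^odd; both sums are finite on any vector. *)
Definition nprod (odd : bool) A B : int -> V -> V := fun n v =>
  \sum_(i \in [set: nat]) A (- i%:Z - 1) (B (n + i%:Z) v) +
  (-1) ^+ odd *: \sum_(i \in [set: nat]) B (n - i%:Z - 1) (A i%:Z v).

End Fields.

Section NS.
Context {K : fieldType} {T : lmodType K}.
Variable g : T -> T -> K.

Definition lfield (l : letter T) : int -> fock T -> fock T :=
  let: (p, k, x) := l in
  fderdiv k (if p then ffield g x else bfield g x).

(* Nested normally ordered product of the fields of the letters.  Fields of even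
   and odd letters commute, so on a product of even letters with odd letters
   this is the field Y (x) Y of the tensor product of vertex algebras. *)
Fixpoint wfield (w : fword T) : int -> fock T -> fock T :=
  if w is l :: w' then nprod (lodd l && wodd w') (lfield l) (wfield w')
  else fun n v => if n == -1 then v else 0.

Definition fock_mode (a : fock T) (n : int) (v : fock T) : fock T :=
  fock_ext (fun w => wfield w n v) a.

Definition fock_gr (p : bool) : set (fock T) :=
  [set x | exists s, x = fcls s /\ all (fun q => wodd q.2 == p) s].

(* vectors of conformal weight at most N/2 *)
Definition fock_le (N : nat) : set (fock T) :=
  [set x | exists s, x = fcls s /\ all (fun q => (wt2 q.2 <= N)%N) s].

Lemma fock_le_lin N N' (c : K) (x y : fock T) :
  fock_le N x -> fock_le N' y -> fock_le (maxn N N') (c *: x + y).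
Proof.
move=> [s [-> hs]] [t [-> ht]]; exists (tscale c s ++ t).
split; first by rewrite fcls_cat; congr (_ + _); exact: fockZE.
rewrite all_cat all_map; apply/andP; split.
  by apply: sub_all hs => q /= h; rewrite leq_max h.
by apply: sub_all ht => q /= h; rewrite leq_max h orbT.
Qed.

Variables (n : nat) (e : 'I_n -> T).

Definition fock_tau : fock T :=
  \sum_i fmono [:: (false, 0%N, e i); (true, 0%N, e i)].

Definition fock_nu : fock T :=
  2^-1 *: (\sum_i fmono [:: (false, 0%N, e i); (false, 0%N, e i)]) +
  2^-1 *: (\sum_i fmono [:: (true, 1%N, e i); (true, 0%N, e i)]).

(* V(T,g)_NS, where e is an orthonormal basis of (T,g) *)
Definition NS_data : scva_data (fock T) :=
  ScvaData fock_gr (fmono [::]) fock_mode fock_nu fock_tau.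

End NS.

Section FockMap.
Context {K : fieldType} {T T' : lmodType K}.

Definition fock_map (h : T -> T') : fock T -> fock T' :=
  fock_ext (fun w => fmono [seq (l.1, h l.2) | l <- w]).

Lemma fock_map_linear (h : {linear T -> T'}) : linear (fock_map h).
Proof.
have [ml sw] := @fmono_super_multilinear K T'.
apply: fock_ext_linear; split=> [u p k a x y w|u l l' w];
  rewrite !map_cat /=; last exact: sw.
by rewrite linearP; exact: ml.
Qed.

HB.instance Definition _ (h : {linear T -> T'}) :=
  GRing.isLinear.Build K (fock T) (fock T') *:%R (fock_map h)
    (fock_map_linear h).

End FockMap.

Section Smooth.
Context {R : realType} {n : nat} {W : normedModType R}.

Fixpoint smooth_upto (k : nat) (U : set 'rV[R]_n) (f : 'rV[R]_n -> W) : Prop :=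
  if k is k'.+1 then
    (forall x, U x -> differentiable f x) /\
    (forall v, smooth_upto k' U (fun x => 'D_v f x))
  else forall x, U x -> {for x, continuous f}.

(* C^oo on the open set U *)
Definition smooth_on (U : set 'rV[R]_n) (f : 'rV[R]_n -> W) : Prop :=
  forall k, smooth_upto k U f.

Lemma smooth_onS U U' f : U' `<=` U -> smooth_on U f -> smooth_on U' f.
Proof.
move=> sU h k; have {h} := h k; elim: k f => [|k ih] f /=.
  by move=> h x /sU; exact: h.
by move=> [h1 h2]; split=> [x /sU|v]; [exact: h1|exact: ih].
Qed.

End Smooth.

(* An n-dimensional smooth manifold: cmap i is a homeomorphism from cdom i onto
   the open set ccod i, with inverse cinv i; both are junk elsewhere. *)
Record manifold (R : realType) (n : nat) := Manifold {
  mspace :> topologicalType;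
  chart : Type;
  cdom : chart -> set mspace;
  ccod : chart -> set 'rV[R]_n;
  cmap : chart -> mspace -> 'rV[R]_n;
  cinv : chart -> 'rV[R]_n -> mspace;
  m_hausdorff : hausdorff_space mspace;
  m_countable : @second_countable mspace;
  cdom_open : forall i, open (cdom i);
  ccod_open : forall i, open (ccod i);
  cdom_cover : forall x, exists i, cdom i x;
  cmapK : forall i x, cdom i x -> ccod i (cmap i x) /\ cinv i (cmap i x) = x;
  cinvK : forall i y, ccod i y -> cdom i (cinv i y) /\ cmap i (cinv i y) = y;
  cmap_cont : forall i x, cdom i x -> {for x, continuous (cmap i)};
  cinv_cont : forall i y, ccod i y -> {for y, continuous (cinv i)};
  ctrans_smooth : forall i j,
    smooth_on (cmap i @` (cdom i `&` cdom j)) (cmap j \o cinv i) }.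

Section Manifold.
Context {R : realType} {n : nat} {M : manifold R n}.

Definition msmooth (U : set M) (f : M -> R) : Prop :=
  forall i : chart M,
    smooth_on (cmap i @` (U `&` cdom i)) (f \o cinv i : 'rV[R]_n -> R^o).

Definition mcsmooth (U : set M) (f : M -> R[i]) : Prop :=
  msmooth U (fun x => complex.Re (f x)) /\
  msmooth U (fun x => complex.Im (f x)).

Lemma mcsmoothS U U' f : U' `<=` U -> mcsmooth U f -> mcsmooth U' f.
Proof.
by move=> sU [h1 h2]; split=> i; (apply: smooth_onS;
  [apply: image_subset; exact: setSI sU|by [exact: h1|exact: h2]]).
Qed.

(* Smooth maps to a vector space with no topology, the union of its finite
   dimensional subspaces. *)
Definition vsmooth (V : lmodType R[i]) (U : set M) (h : M -> V) : Prop :=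
  forall x0, U x0 -> exists O : set M, [/\ open O, O x0 &
    exists (m : nat) (f : 'I_m -> M -> R[i]) (v : 'I_m -> V),
      (forall i, mcsmooth (O `&` U) (f i)) /\
      (forall x, O x -> U x -> h x = \sum_i f i x *: v i)].

Lemma vsmooth_lin (V : lmodType R[i]) (U : set M) (c : R[i]) (h h' : M -> V) :
  vsmooth U h -> vsmooth U h' -> vsmooth U (fun x => c *: h x + h' x).
Proof.
move=> H H' x0 Ux0; have [S [oO Ox0 [m [f [v [hf hE]]]]]] := H _ Ux0.
have [S' [oO' Ox0' [m' [f' [v' [hf' hE']]]]]] := H' _ Ux0.
exists (S `&` S'); split; [exact: openI|by []|].
exists (m + m')%N, (fun i => match fintype.split i with inl j => f j | inr j => f' j end),
  (fun i => match fintype.split i with inl j => c *: v j | inr j => v' j end).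
split=> [i|x [Ox O'x] Ux].
  case: (fintype.split i) => j; [apply: mcsmoothS (hf j)|apply: mcsmoothS (hf' j)];
    by apply: setSI => x [].
rewrite big_split_ord hE // hE' // scaler_sumr; congr (_ + _);
  apply: eq_bigr => i _.
  by rewrite (unsplitK (inl _ i)) !scalerA mulrC.
by rewrite (unsplitK (inr _ i)).
Qed.

(* T_x M is R^n, read in the chart [pchart x] chosen at x; [tmove i j x] takes
   the coordinates in chart i of a tangent vector at x to those in chart j. *)
Definition pchart (x : M) : chart M := projT1 (cid (cdom_cover x)).

Definition tspace (x : M) : lmodType R := 'rV[R]_n.
Definition ctspace (x : M) : lmodType R[i] := 'rV[R[i]]_n.

Definition tmove (i j : chart M) (x : M) (v : 'rV[R]_n) : 'rV[R]_n :=
  'D_v (cmap j \o cinv i) (cmap i x).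

Definition tcoord (i : chart M) (x : M) (v : tspace x) : 'rV[R]_n :=
  tmove (pchart x) i x v.
Definition tpartial (i : chart M) (x : M) (a : 'I_n) : tspace x :=
  tmove i (pchart x) x (delta_mx 0 a).

End Manifold.

(* gram x is the Gram matrix of g_x on T_x M = R^n. *)
Record riemannian_metric (R : realType) (n : nat) (M : manifold R n) :=
  RiemannianMetric {
    gram : M -> 'M[R]_n;
    gram_sym : forall x, (gram x)^T = gram x;
    gram_pos : forall x (v : 'rV[R]_n), v != 0 ->
      0 < (v *m gram x *m v^T) 0 0;
    gram_smooth : forall (i : chart M) a b, msmooth (cdom i) (fun x =>
      (tpartial i x a *m gram x *m (tpartial i x b)^T) 0 0) }.

Section Bundle.
Context {R : realType} {n : nat} {M : manifold R n}.

(* The fibers of a bundle over M together with local trivializations; triv j x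
   is meaningful for x in tdom j. *)
Record bundle_data (V : lmodType R[i]) := BundleData {
  fiber : M -> lmodType R[i];
  tindex : Type;
  tdom : tindex -> set M;
  triv : tindex -> forall x, {linear V -> fiber x} }.

(* The total space is glued from the products tdom j x V by the transition
   functions, which are required to be smooth. *)
Record is_bundle V (E : bundle_data V) : Prop := {
  tdom_open : forall j : tindex E, open (tdom j);
  tdom_cover : forall x, exists j : tindex E, tdom j x;
  triv_bij : forall (j : tindex E) x, tdom j x -> bijective (triv j x);
  transition_smooth : forall (j k : tindex E) (v : V), exists h : M -> V,
    vsmooth (tdom j `&` tdom k) h /\
    forall x, tdom j x -> tdom k x -> triv j x v = triv k x (h x) }.

(* [dE] is the fiberwise structure. *)
Record is_N1SCVA_bundle V (dV : scva_data V) (c : R[i]) (E : bundle_data V)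
    (dE : forall x, scva_data (fiber E x)) : Prop := {
  bundle_bundle : is_bundle E;
  bundle_model : is_N1SCVA dV c;
  bundle_fiber : forall x, is_N1SCVA (dE x) c;
  bundle_triv : forall (j : tindex E) x, tdom j x ->
    scva_iso dV (dE x) (triv j x);
  bundle_transition : forall (j k : tindex E) x, tdom j x -> tdom k x ->
    exists2 h : V -> V, scva_aut dV h & triv j x =1 triv k x \o h }.

End Bundle.
Arguments bundle_data {R n} M V.

(* sections, not necessarily smooth *)
Definition fibers_prod (K : fieldType) (I : Type) (F : I -> lmodType K) :=
  forall x, F x.

Section FibersProd.
Context {K : fieldType} {I : Type} (F : I -> lmodType K).
Implicit Types (A B C : fibers_prod F).

Definition fprod0 : fibers_prod F := fun=> 0.
Definition fprodN A : fibers_prod F := fun x => - A x.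
Definition fprodD A B : fibers_prod F := fun x => A x + B x.
Definition fprodZ (k : K) A : fibers_prod F := fun x => k *: A x.

Local Lemma fprodDA : associative fprodD.
Proof. by move=> A B C; apply: functional_extensionality_dep => x; exact: addrA. Qed.
Local Lemma fprodDC : commutative fprodD.
Proof. by move=> A B; apply: functional_extensionality_dep => x; exact: addrC. Qed.
Local Lemma fprod0D : left_id fprod0 fprodD.
Proof. by move=> A; apply: functional_extensionality_dep => x; exact: add0r. Qed.
Local Lemma fprodND : left_inverse fprod0 fprodN fprodD.
Proof. by move=> A; apply: functional_extensionality_dep => x; exact: addNr. Qed.

HB.instance Definition _ := gen_eqMixin (fibers_prod F).
HB.instance Definition _ := gen_choiceMixin (fibers_prod F).
HB.instance Definition _ :=
  GRing.isZmodule.Build (fibers_prod F) fprodDA fprodDC fprod0D fprodND.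

Local Lemma fprodZA a b A : fprodZ a (fprodZ b A) = fprodZ (a * b) A.
Proof. by apply: functional_extensionality_dep => x; exact: scalerA. Qed.
Local Lemma fprod1Z : left_id 1 fprodZ.
Proof. by move=> A; apply: functional_extensionality_dep => x; exact: scale1r. Qed.
Local Lemma fprodZDr : right_distributive fprodZ +%R.
Proof. by move=> a A B; apply: functional_extensionality_dep => x; exact: scalerDr. Qed.
Local Lemma fprodZDl A : {morph fprodZ^~ A : a b / a + b}.
Proof. by move=> a b; apply: functional_extensionality_dep => x; exact: scalerDl. Qed.

HB.instance Definition _ := GRing.Zmodule_isLmodule.Build K (fibers_prod F)
  fprodZA fprod1Z fprodZDr fprodZDl.
End FibersProd.

Definition smooth_section (R : realType) (n : nat) (M : manifold R n)
    (V : lmodType R[i]) (E : bundle_data M V)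
    (A : fibers_prod (fiber E)) : Prop :=
  forall j : tindex E, exists h : M -> V,
    vsmooth (tdom j) h /\ forall x, tdom j x -> A x = triv j x (h x).

Section NSBundle.
Context {R : realType} {n : nat} {M : manifold R n} (g : riemannian_metric M).
Local Notation C := R[i].

Definition complexify (A : 'M[R]_n) : 'M[C]_n := map_mx (real_complex R) A.

(* the bilinear extension g_x (x) C *)
Definition cmetric (x : M) (u v : ctspace x) : C :=
  (u *m complexify (gram g x) *m v^T) 0 0.

(* The rows of A form an orthonormal basis of T_x M. *)
Definition orthonormal_frame (x : M) (A : 'M[R]_n) : Prop :=
  A *m gram g x *m A^T = 1%:M.

Record local_frame := LocalFrame {
  ldom : set M;
  lframe : M -> 'M[R]_n;
  ldom_open : open ldom;
  lframe_orth : forall x, ldom x -> orthonormal_frame x (lframe x);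
  lframe_smooth : forall (i : chart M) a b, msmooth (ldom `&` cdom i)
    (fun x => (tcoord i (row a (lframe x) : tspace x)) 0 b) }.

(* an orthonormal basis of T_x M (x) C; nu and tau do not depend on it *)
Definition some_frame (x : M) : 'M[R]_n := xget 1%:M (orthonormal_frame x).
Definition cframe (x : M) (a : 'I_n) : ctspace x :=
  row a (complexify (some_frame x)).

Definition NS_fiber (x : M) : lmodType C := fock (ctspace x).
Definition NS_fiber_data (x : M) : scva_data (NS_fiber x) :=
  NS_data (@cmetric x) (@cframe x).

(* the model fiber: C^n with its standard form and standard basis *)
Definition NS_model : lmodType C := fock 'rV[C]_n.
Definition std_form (u v : 'rV[C]_n) : C := (u *m v^T) 0 0.
Definition NS_model_data : scva_data NS_model :=
  NS_data std_form (fun a : 'I_n => delta_mx 0 a).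

(* A local orthonormal frame identifies C^n with T_x M (x) C, hence the model
   with V(T_x M (x) C, g_x (x) C)_NS. *)
Definition NS_bundle : bundle_data M NS_model := BundleData
  (fun e : local_frame => ldom e)
  (fun (e : local_frame) x =>
     fock_map (mulmxr (complexify (lframe e x)) : {linear 'rV[C]_n -> ctspace x})
     : {linear NS_model -> NS_fiber x}).

(* The bundle is the direct sum of its finite rank subbundles of given
   conformal weight, and Gamma of it is the direct sum of the spaces of smooth
   sections of these, so the weights of a section are bounded over M (as is
   automatic when M is compact). *)
Definition NS_section (A : fibers_prod NS_fiber) : Prop :=
  @smooth_section R n M NS_model NS_bundle A /\
  exists N, forall x, fock_le N (A x).

Definition NS_section_pred : {pred fibers_prod NS_fiber} :=
  fun A => `[< NS_section A >].

Lemma NS_section_closed : submod_closed NS_section_pred.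
Proof.
split=> [|c A B /asboolP[sA [N hA]] /asboolP[sB [N' hB]]]; apply/asboolP; split.
- move=> j; exists (fun=> 0); split=> [x0 _|x _]; last by rewrite linear0.
  exists setT; split=> //; first exact: openT.
  exists 0%N, (fun _ _ => 0), (fun=> 0).
  by split=> [[]//|x _ _]; rewrite big_ord0.
- by exists 0%N => x; exists [::].
- move=> j; have [h [sh hE]] := sA j; have [h' [sh' hE']] := sB j.
  exists (fun x => c *: h x + h' x); split; first exact: vsmooth_lin.
  move=> x hx; rewrite linearP -(hE x hx) -(hE' x hx); exact: erefl.
- by exists (maxn N N') => x; exact: fock_le_lin.
Qed.

HB.instance Definition _ := GRing.isSubmodClosed.Build C
  (fibers_prod NS_fiber) NS_section_pred NS_section_closed.

(* Gamma(M, V(TM (x) C, g (x) C)_NS) *)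
Record NS_gamma := NSGamma {
  gamma_val : fibers_prod NS_fiber;
  _ : gamma_val \in NS_section_pred }.

HB.instance Definition _ := [isSub for gamma_val].
HB.instance Definition _ := [Choice of NS_gamma by <:].
HB.instance Definition _ := [SubChoice_isSubLmodule of NS_gamma by <:].

End NSBundle.
Arguments NS_model_data : clear implicits.

(* The operations of d are those of the fibers, applied pointwise. *)
Record pointwise_data (R : realType) (n : nat) (M : manifold R n)
    (g : riemannian_metric M) (d : scva_data (NS_gamma g)) : Prop := {
  pw_gr : forall p (A : NS_gamma g),
    gr d p A <-> forall x, gr (NS_fiber_data g x) p (gamma_val A x);
  pw_vac : forall x, gamma_val (vac d) x = vac (NS_fiber_data g x);
  pw_mode : forall (A B : NS_gamma g) k x,
    gamma_val (mode d A k B) x = mode (NS_fiber_data g x) 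
        (gamma_val A x) k (gamma_val B x);
  pw_nu : forall x, gamma_val (nu d) x = nu (NS_fiber_data g x);
  pw_tau : forall x, gamma_val (tau d) x = tau (NS_fiber_data g x) }.

(* Main.v *)
Require Import Defs.
From mathcomp Require Import all_boot all_order all_algebra.
From mathcomp Require Import all_classical all_reals all_analysis.
From mathcomp Require Import complex zify ring.

Set Implicit Arguments.
Unset Strict Implicit.
Unset Printing Implicit Defensive.

Import Order.TTheory GRing.Theory Num.Theory numFieldNormedType.Exports.

Local Open Scope classical_set_scope.
Local Open Scope ring_scope.

(** The fiber.  Let T be a vector space with a symmetric bilinear form g and an
orthonormal basis.  The modes of the fields a(z) and phi(z) of the letters
satisfy the canonical (anti)commutation relations ([rmode_bracket]), and
contracting one generator with a normally ordered product gives Wick's formula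
([rmode_wfield]).  Locality of the fields of two words is proved from it by
induction on the second word ([wfield_local]), with an order bounded by the sum
of the doubled weights.  L_(-1) acts on the generators as d/dz, hence on all
fields, and with the creation property this gives the vertex algebra axioms
([fock_vertex_algebra]).  For the superconformal relations, Wick's formula gives
the brackets of the modes of nu and tau with the generators.  It follows that
[G_m,G_n] - 2 L_(m+n) and the analogous expression for [G_m,L_n] supercommute
with all generators.  These act irreducibly on Fock space, with the vacuum as the
only vector killed by the annihilation operators, so by a Schur lemma both
expressions are scalars, and zero unless their conformal weight is 0.  The
remaining scalar is determined by the bracket with L_(-1) and its value on the
lowest modes ([GG_central]), and the Virasoro relations follow from the relations
with G by the Jacobi identity ([nu_nu]).

The bundle.  An isometry T -> T' induces an isomorphism of the two
superconformal vertex algebras ([fock_map_iso]); the structure vectors match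
because sums over orthonormal bases do not depend on the basis.  Orthonormalizing
the coordinate vector fields of a chart by the Gram-Schmidt process gives local
orthonormal frames around every point ([exists_local_frame]).  Each of them
identifies the fibers with the model on C^n.  Two frames e, e' differ by the
orthogonal matrix e g e'^T, which is smooth because e, e' and g are smooth in
coordinates; on each vector of Fock space it acts through polynomials in its
entries, so the transition functions are smooth and are automorphisms.

Sections.  In a trivialization the operations are those of the model, which are
bilinear and fixed, so pointwise operations preserve smoothness of sections.
Identities between sections hold because they hold in the fibers.  The axioms
which assert that some bound exists (truncation, order of locality, number of
eigenvectors) hold because the bounds obtained in the fibers depend only on the
conformal weights of the vectors, and these are bounded over M for a section. *)

(** * Linear operators and modes on Fock space *)

Definition lin (K : fieldType) (V W : lmodType K) (f : V -> W) : Prop :=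
  forall (k : K) u v, f (k *: u + v) = k *: f u + f v.

Section Lin.
Context {K : fieldType} {V W : lmodType K}.
Variable f : V -> W.
Hypothesis hf : lin f.

Lemma lin0 : f 0 = 0.
Proof. by have := hf (-1) 0 0; rewrite scaleN1r addNr scaleN1r addNr. Qed.
Lemma linD u v : f (u + v) = f u + f v.
Proof. by have := hf 1 u v; rewrite !scale1r. Qed.
Lemma linZ k u : f (k *: u) = k *: f u.
Proof. by have := hf k u 0; rewrite !addr0 lin0 addr0. Qed.
Lemma linN u : f (- u) = - f u.
Proof. by rewrite -scaleN1r linZ scaleN1r. Qed.
Lemma linB u v : f (u - v) = f u - f v.
Proof. by rewrite linD linN. Qed.
Lemma lin_sum (I : Type) (r : seq I) (P : pred I) (F : I -> V) :
  f (\sum_(i <- r | P i) F i) = \sum_(i <- r | P i) f (F i).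
Proof. by elim/big_ind2: _ => [|x1 x2 y1 y2 <- <-|//]; [exact: lin0|exact: linD]. Qed.
End Lin.

Section LinCombine.
Context {K : fieldType} {V W : lmodType K}.
Implicit Types f h : V -> W.

Lemma lin_comb f h (a : K) : lin f -> lin h -> lin (fun v => a *: f v + h v).
Proof.
move=> hf hh k u v; rewrite hf hh scalerDr !scalerA addrACA; congr (_ + _).
by rewrite scalerDr !scalerA [k * a]mulrC.
Qed.
Lemma lin_zero : lin (fun _ : V => 0 : W).
Proof. by move=> k u v; rewrite scaler0 addr0. Qed.
Lemma lin_scale f (a : K) : lin f -> lin (fun v => a *: f v).
Proof. by move=> hf k u v; rewrite hf scalerDr !scalerA mulrC. Qed.
Lemma lin_add f h : lin f -> lin h -> lin (fun v => f v + h v).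
Proof. by move=> hf hh k u v; rewrite hf hh scalerDr addrACA. Qed.
Lemma lin_sub f h : lin f -> lin h -> lin (fun v => f v - h v).
Proof. by move=> hf hh k u v; rewrite hf hh scalerBr opprD addrACA. Qed.
Lemma lin_bigsum (I : Type) (r : seq I) (F : I -> V -> W) :
  (forall i, lin (F i)) -> lin (fun v => \sum_(i <- r) F i v).
Proof.
move=> hF; elim: r => [|i r ih] k u v; first by rewrite !big_nil scaler0 addr0.
by rewrite !big_cons ih hF scalerDr addrACA.
Qed.
Lemma lin_id : lin (@id V). Proof. by []. Qed.
End LinCombine.

Lemma lin_comp (K : fieldType) (V W U : lmodType K) (f : W -> U) (h : V -> W) :
  lin f -> lin h -> lin (fun v => f (h v)).
Proof. by move=> hf hh k u v; rewrite hh hf. Qed.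

Section FockBasics.
Context {K : fieldType} {T : lmodType K}.
Implicit Types (l : letter T) (u w : fword T) (x y : fock T).

(** Words span Fock space, so linear operators are compared on words. *)
Lemma fmono_ext_eq (W : lmodType K) (f h : fock T -> W) :
  lin f -> lin h -> (forall w, f (fmono w) = h (fmono w)) -> f =1 h.
Proof.
move=> hf hh H x; have [s ->] := fockE x; rewrite fcls_sum !(lin_sum hf, lin_sum hh).
by apply: eq_bigr => q _; rewrite !(linZ hf, linZ hh) H.
Qed.

Lemma fock_extM (W : lmodType K) (f : fword T -> W) w :
  super_multilinear f -> fock_ext f (fmono w) = f w.
Proof. by move=> hf; rewrite fock_extE // big_seq1 scale1r. Qed.

Lemma lin_fock_ext (W : lmodType K) (f : fword T -> W) :
  super_multilinear f -> lin (fock_ext f).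
Proof. by move=> hf k u v; exact: fock_ext_linear. Qed.

Lemma fcreate_sml l : super_multilinear (fun w => fmono (l :: w)).
Proof.
have [h1 h2] := @fmono_super_multilinear K T.
by split=> [u p k a x y w|u l1 l2 w]; [exact: (h1 (l :: u))|exact: (h2 (l :: u))].
Qed.

Lemma fcreateM l w : fcreate l (fmono w) = fmono (l :: w).
Proof. exact: (fock_extM _ (fcreate_sml l)). Qed.

Lemma lin_create l : lin (fcreate l).
Proof. exact: lin_fock_ext (fcreate_sml l). Qed.

Lemma fcreate_vec p k (a : K) (x y : T) v :
  fcreate (p, k, a *: x + y) v = a *: fcreate (p, k, x) v + fcreate (p, k, y) v.
Proof.
move: v; apply: fmono_ext_eq => [||w]; first exact: lin_create.
  by apply: lin_comb; exact: lin_create.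
by rewrite !fcreateM; have [h1 _] := @fmono_super_multilinear K T; exact: (h1 [::]).
Qed.

Lemma fcreate_swap l l' v :
  fcreate l (fcreate l' v) =
  (-1) ^+ (lodd l && lodd l') *: fcreate l' (fcreate l v).
Proof.
move: v; apply: fmono_ext_eq => [||w].
- by apply: lin_comp; exact: lin_create.
- by apply: lin_scale; apply: lin_comp; exact: lin_create.
by rewrite !fcreateM; have [_ h2] := @fmono_super_multilinear K T; exact: (h2 [::]).
Qed.

End FockBasics.

Section Contraction.
Context {K : fieldType} {T : lmodType K}.
Variable g : T -> T -> K.
Hypothesis g_linl : forall (a : K) x y z, g (a *: x + y) z = a * g x z + g y z.
Hypothesis g_sym : forall x y, g x y = g y x.
Implicit Types (l : letter T) (u w : fword T) (v : fock T) (x y : T).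

Lemma g_linr (a : K) x y z : g z (a *: x + y) = a * g z x + g z y.
Proof. by rewrite !(g_sym z) g_linl. Qed.

Lemma lpair_lin l p k (a : K) x y :
  lpair g l (p, k, a *: x + y) = a * lpair g l (p, k, x) + lpair g l (p, k, y).
Proof. by rewrite /lpair /=; case: ifP => _; rewrite ?g_linr ?mulr0 ?addr0. Qed.

Lemma lpair_neq l l' : lodd l != lodd l' -> lpair g l l' = 0.
Proof.
rewrite /lpair /lodd; case: l l' => [[p k] x] [[q j] y] /= h; case: eqP => // -[e _].
by rewrite e eqxx in h.
Qed.

Lemma dcon_cons l l' w : fcls (wcontract g l (l' :: w)) =
  lpair g l l' *: fmono w +
  (-1) ^+ (lodd l && lodd l') *: fcreate l' (fcls (wcontract g l w)).
Proof.
rewrite /= fcls_cons; congr (_ + _).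
  by rewrite fcls_sum big_seq1.
rewrite [in RHS]fcls_sum (lin_sum (@lin_create _ _ l')) fcls_sum big_map scaler_sumr.
apply: eq_bigr => q _ /=; rewrite (linZ (@lin_create _ _ l')) fcreateM.
by rewrite scalerA.
Qed.

(** Contracting commutes with swapping adjacent letters up to sign because a
letter pairs only with letters of its own parity. *)
Lemma contract_sml l : super_multilinear (fun w => fcls (wcontract g l w)).
Proof.
have [f1 f2] := @fmono_super_multilinear K T.
split=> [u p k a x y w|u l1 l2 w].
  elim: u => [|l1 u ih]; rewrite ?cat0s ?cat_cons !dcon_cons.
    rewrite lpair_lin fcreate_vec !scalerDr scalerDl !scalerA.
    by rewrite addrACA [_ ^+ _ * a]mulrC.
  rewrite ih (@lin_create _ _ l1) f1 !scalerDr !scalerA [lpair _ _ _ * a]mulrC.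
  by rewrite addrACA [_ ^+ _ * a]mulrC.
elim: u => [|l3 u ih]; rewrite ?cat0s ?cat_cons !dcon_cons.
  rewrite !(linD (@lin_create _ _ _)) !(linZ (@lin_create _ _ _)) !fcreateM.
  rewrite (fcreate_swap l2 l1) !scalerDr !scalerA.
  rewrite addrCA; congr (_ + (_ + _)).
  - case: (eqVneq (lodd l) (lodd l2)) => [->|/lpair_neq->].
      by rewrite [lodd l1 && _]andbC.
    by rewrite !mulr0.
  - case: (eqVneq (lodd l) (lodd l1)) => [->|/lpair_neq->].
      by rewrite -expr2 sqrr_sign mul1r.
    by rewrite !(mulr0, scale0r).
  - by congr (_ *: _); case: (lodd l) (lodd l1) (lodd l2) => [] [] [] /=; ring.
rewrite ih (linZ (@lin_create _ _ l3)) f2 scalerDr !scalerA [_ * lpair _ _ _]mulrC.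
by congr (_ + _ *: _); rewrite mulrC.
Qed.

Lemma lin_contract l : lin (fcontract g l).
Proof. exact: lin_fock_ext (contract_sml l). Qed.

Lemma contractM l w : fcontract g l (fmono w) = fcls (wcontract g l w).
Proof. exact: (fock_extM _ (contract_sml l)). Qed.

Lemma contract_vac l : fcontract g l (fmono [::]) = 0.
Proof. by rewrite contractM. Qed.

Lemma contract_create l l' v : fcontract g l (fcreate l' v) =
  lpair g l l' *: v + (-1) ^+ (lodd l && lodd l') *: fcreate l' (fcontract g l v).
Proof.
move: v; apply: fmono_ext_eq => [||w].
- by apply: lin_comp; [exact: lin_contract|exact: lin_create].
- apply: lin_comb; first exact: lin_id.
  by apply/lin_scale/lin_comp; [exact: lin_create|exact: lin_contract].
by rewrite fcreateM !contractM dcon_cons.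
Qed.

Lemma contract_swap l l' v : fcontract g l (fcontract g l' v) =
  (-1) ^+ (lodd l && lodd l') *: fcontract g l' (fcontract g l v).
Proof.
move: v; apply: fmono_ext_eq => [||w].
- by apply: lin_comp; exact: lin_contract.
- by apply/lin_scale/lin_comp; exact: lin_contract.
elim: w => [|l3 w ih]; first by rewrite !contract_vac !(lin0 (@lin_contract _)) scaler0.
rewrite -fcreateM !contract_create !(linD (@lin_contract _)) !(linZ (@lin_contract _)).
rewrite !contract_create ih (linZ (@lin_create _ _ _)) !scalerDr !scalerA.
rewrite addrCA; congr (_ + (_ + _)).
- case: (eqVneq (lodd l) (lodd l3)) => [->|/lpair_neq->].
    by rewrite [lodd l3 && _]andbC.
  by rewrite !mulr0.
- case: (eqVneq (lodd l') (lodd l3)) => [->|/lpair_neq->].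
    by rewrite -expr2 sqrr_sign mul1r.
  by rewrite !(mulr0, scale0r).
- congr (_ *: _); rewrite -!signr_addb; congr ((-1) ^+ nat_of_bool _).
  by case: (lodd l) (lodd l') (lodd l3) => [] [] [].
Qed.

Lemma contract_vec p k (a : K) x y v : fcontract g (p, k, a *: x + y) v =
  a *: fcontract g (p, k, x) v + fcontract g (p, k, y) v.
Proof.
move: v; apply: fmono_ext_eq => [||w]; first exact: lin_contract.
  by apply: lin_comb; exact: lin_contract.
rewrite !contractM; elim: w => [|l3 w ih].
  by rewrite -[fcls _]/(0 : fock T) scaler0 addr0.
rewrite !dcon_cons ih (@lin_create _ _ l3) /lodd /= !scalerDr addrACA.
congr (_ + _); last by rewrite !scalerA mulrC.
rewrite /lpair /=; case: ifP => _; last by rewrite !scale0r scaler0 addr0.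
by rewrite g_linl scalerDl scalerA.
Qed.

End Contraction.

(** * Linear identities in a module *)

Section LinearExpressions.
Context {K : fieldType} {V : lmodType K}.

(** Formal linear combinations, by which identities between vectors are reduced
to identities between coefficients. *)
Inductive lexp :=
  LVar of nat | LZero | LScale of K & lexp | LAdd of lexp & lexp | LOpp of lexp.

Fixpoint leval (env : seq V) (t : lexp) : V :=
  match t with
  | LVar i => nth 0 env i
  | LZero => 0
  | LScale c t => c *: leval env t
  | LAdd s t => leval env s + leval env t
  | LOpp t => - leval env t
  end.

Fixpoint lcoef (t : lexp) (i : nat) : K :=
  match t with
  | LVar j => if eqn i j then 1 else 0
  | LZero => 0
  | LScale c t => c * lcoef t i
  | LAdd s t => lcoef s i + lcoef t i
  | LOpp t => - lcoef t i
  end.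

Lemma levalE env t : leval env t = \sum_(i < size env) lcoef t i *: nth 0 env i.
Proof.
elim: t => [j||c t ih|s ihs t iht|t ih] /=.
- have [js|js] := ltnP j (size env); last first.
    rewrite nth_default // big1 // => i _.
    by case: eqnP => [e|_]; [have := ltn_ord i; rewrite e ltnNge js|rewrite scale0r].
  rewrite (bigD1 (Ordinal js)) //= (introT eqnP (erefl j)) scale1r big1 ?addr0 // => i.
  by rewrite -val_eqE /= eqnE => /negPf ->; rewrite scale0r.
- by rewrite big1 // => i _; rewrite scale0r.
- by rewrite ih scaler_sumr; apply: eq_bigr => i _; rewrite scalerA.
- by rewrite ihs iht -big_split; apply: eq_bigr => i _; rewrite scalerDl.
- by rewrite ih -sumrN; apply: eq_bigr => i _; rewrite scaleNr.
Qed.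

Fixpoint lcoef_eq (n : nat) (s t : lexp) : Prop :=
  if n is n'.+1 then lcoef_eq n' s t /\ lcoef s n' = lcoef t n' else True.

Lemma leval_eq env s t : lcoef_eq (size env) s t -> leval env s = leval env t.
Proof.
move=> h; rewrite !levalE; apply: eq_bigr => i _; congr (_ *: _).
elim: (size env) (i : nat) (ltn_ord i) h => // n ih j; rewrite ltnS leq_eqVlt /=.
by move=> /orP[/eqP ->|jn] [h e] //; exact: ih.
Qed.

End LinearExpressions.

Ltac lmod_index env x i :=
  match env with
  | ?y :: ?env' =>
    match constr:(Set) with
    | _ => let _ := match constr:(Set) with _ => constr_eq x y end in i
    | _ => lmod_index env' x (S i)
    end
  end.

Ltac lmod_atoms env t :=
  match t with
  | (?a + ?b)%R => let env' := lmod_atoms env a in lmod_atoms env' b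
  | (- ?a)%R => lmod_atoms env a
  | (?c *: ?a)%R => lmod_atoms env a
  | 0%R => env
  | _ => match constr:(Set) with
    | _ => let _ := lmod_index env t O in env
    | _ => constr:(t :: env)
    end
  end.

Ltac lmod_quote K env t :=
  match t with
  | (?a + ?b)%R =>
      let a' := lmod_quote K env a in let b' := lmod_quote K env b in
      constr:(@LAdd K a' b')
  | (- ?a)%R => let a' := lmod_quote K env a in constr:(@LOpp K a')
  | (?c *: ?a)%R => let a' := lmod_quote K env a in constr:(@LScale K c a')
  | 0%R => constr:(@LZero K)
  | _ => let i := lmod_index env t O in constr:(@LVar K i)
  end.

(** Reduces an equality of linear combinations of vectors of V to the equalities
of the coefficients of the vectors that occur in it. *)
Ltac lmod K V :=
  match goal with
  | |- ?s = ?t =>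
    let env := lmod_atoms (@nil V) s in let env := lmod_atoms env t in
    let s' := lmod_quote K env s in let t' := lmod_quote K env t in
    change (@leval K V env s' = @leval K V env t');
    apply: leval_eq; cbn [lcoef_eq lcoef size eqn]; repeat split
  end.

(** * The generating fields and their brackets *)

(** The common name of the modes of the fields a(z) and phi(z), of which the
letters' fields are divided derivatives. *)
Definition rmode (K : fieldType) (T : lmodType K) (g : T -> T -> K) (p : bool)
  (x : T) (n : int) (v : fock T) : fock T :=
  if p then ffield g x n v else bfield g x n v.

(** The coefficient of g(x,y) in the bracket of the modes of index m and n. *)
Definition cbr (K : fieldType) (p q : bool) (m n : int) : K :=
  if (p == q) && (m + n + p%:Z == 0) then (if p then 1 else m%:~R) else 0.

Section Modes.
Context {K : fieldType} {T : lmodType K}.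
Variable g : T -> T -> K.
Hypothesis g_linl : forall (a : K) x y z, g (a *: x + y) z = a * g x z + g y z.
Hypothesis g_sym : forall x y, g x y = g y x.
Implicit Types (l : letter T) (u w : fword T) (v : fock T) (x y : T) (p q : bool).

Local Notation linC := (lin_contract g_linl g_sym).

Lemma rmode_neg p x k v : rmode g p x (Negz k) v = fcreate (p, k, x) v.
Proof. by rewrite /rmode; case: p. Qed.

Lemma lin_rmode p x n : lin (rmode g p x n).
Proof.
case: n => n; last by move=> k u v; rewrite !rmode_neg; exact: lin_create.
case: p; first exact: linC.
by case: n => [|n]; [exact: lin_zero|apply/lin_scale/linC].
Qed.

Lemma rmode_vac p x n : 0 <= n -> rmode g p x n (fmono [::]) = 0.
Proof.
case: n => // n _; rewrite /rmode /bfield /ffield.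
by case: p; [|case: n => [|n]]; rewrite ?contract_vac ?scaler0.
Qed.

Lemma rmode_vec p n (a : K) x y v :
  rmode g p (a *: x + y) n v = a *: rmode g p x n v + rmode g p y n v.
Proof.
case: n => n; last by rewrite !rmode_neg fcreate_vec.
case: p; first exact: contract_vec.
case: n => [|n]; first by rewrite /rmode /= scaler0 addr0.
by rewrite /rmode /= contract_vec // scalerDr !scalerA mulrC.
Qed.

Lemma lpair_idx p q k k' x y :
  lpair g (p, k, x) (q, k', y) = if (p == q) && (k == k') then g x y else 0.
Proof. by rewrite /lpair /= xpair_eqE. Qed.

(** The canonical (anti)commutation relations, on which Wick's formula rests. *)
Lemma rmode_bracket p x m q y n v : rmode g p x m (rmode g q y n v) =
  (cbr K p q m n * g x y) *: v + (-1) ^+ (p && q) *: rmode g q y n (rmode g p x m v).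
Proof.
have cc := contract_create g_linl g_sym; have cs := contract_swap g_linl g_sym.
have create_contract l l' (u : fock T) : fcreate l (fcontract g l' u) =
    - ((-1) ^+ (lodd l && lodd l') * lpair g l' l) *: u +
    (-1) ^+ (lodd l && lodd l') *: fcontract g l' (fcreate l u).
  rewrite cc scalerDr !scalerA scaleNr addrA addNr add0r.
  by rewrite [lodd l && _]andbC -expr2 sqrr_sign scale1r.
case: m n => [m|m] [n|n].
- have E : cbr K p q m n = 0.
    rewrite /cbr; case: eqP => //= ->; case: eqP => // h; case: q h => [|h]; first lia.
    by have -> : m = 0%N by lia.
  rewrite E mul0r scale0r add0r {E} /rmode.
  case: p; case: q; rewrite ?andbT ?andbF /ffield /bfield ?scale1r.
  + exact: cs.
  + case: n => [|n]; first by rewrite (lin0 (linC _)) ?scaler0.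
    by rewrite (linZ (linC _)) cs ?scalerA; congr (_ *: _); rewrite /lodd /=; ring.
  + case: m => [|m]; first by rewrite (lin0 (linC _)) ?scaler0.
    by rewrite (linZ (linC _)) cs ?scalerA; congr (_ *: _); rewrite /lodd /=; ring.
  + case: m n => [|m] [|n]; rewrite ?(linZ (linC _)) ?(lin0 (linC _)) ?scaler0 //.
    by rewrite cs ?scalerA; congr (_ *: _); rewrite /lodd /=; ring.
- rewrite !rmode_neg /rmode /cbr.
  have -> : (m%:Z + Negz n + p%:Z == 0) = (m + p == n.+1)%N by lia.
  case: p => /=.
    rewrite cc lpair_idx addn1 eqSS /lodd /=.
    by rewrite [true == q]eq_sym; case: (q == true); case: (m == n); rewrite ?mul1r ?mul0r.
  rewrite addn0; case: m => [|m] /=.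
    by rewrite andbF mul0r scale0r (lin0 (@lin_create _ _ _)) scaler0 addr0.
  rewrite cc lpair_idx eqSS (linZ (@lin_create _ _ _)) scalerDr !scalerA /lodd /= mul1r mulr1.
  by case: (false == q); case: (m == n); rewrite ?mul0r ?mulr0.
- rewrite !rmode_neg /rmode /cbr.
  have -> : (Negz m + n%:Z + p%:Z == 0) = (n + p == m.+1)%N by lia.
  case: q => /=.
    rewrite create_contract lpair_idx /lodd /= andbT eq_sym [n == m]eq_sym g_sym.
    case: p => /=; rewrite ?addn1 ?eqSS ?scale1r.
      by rewrite [m == n]eq_sym; case: (n == m); rewrite ?mul1r ?mul0r ?mulr0 ?oppr0 ?mulN1r ?opprK.
    by rewrite mulr0 oppr0 mul0r.
  rewrite andbF; case: n => [|n] /=.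
    rewrite (lin0 (@lin_create _ _ _)) scaler0 addr0.
    by case: p => /=; rewrite ?mul0r ?scale0r.
  rewrite (linZ (@lin_create _ _ _)) create_contract lpair_idx /lodd /= andbF g_sym.
  rewrite scalerDr !scalerA mulrC; congr (_ *: _ + _); last by rewrite mulrC.
  case: p => /=; first by rewrite mulr0 oppr0 !mul0r.
  rewrite addn0 eqSS; case: eqP => [->|]; last by rewrite mulr0 oppr0 !mul0r.
  by rewrite mul1r mulNr mulrC NegzE mulrNz mulNr.
- rewrite !rmode_neg fcreate_swap /cbr /lodd /=.
  have -> : (Negz m + Negz n + p%:Z == 0) = false by case: p; lia.
  by rewrite andbF mul0r scale0r add0r.
Qed.

(** The generalized binomial (-1)^k C(n,k), by which the divided derivative
multiplies a mode. *)
Fixpoint bprod (k : nat) (n : int) : K :=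
  if k is k'.+1 then - n%:~R * bprod k' (n - 1) else 1.
Definition beta (k : nat) (n : int) : K := (k`!%:R)^-1 * bprod k n.

Lemma beta0 n : beta 0 n = 1.
Proof. by rewrite /beta /= invr1 mulr1. Qed.
Lemma beta1 n : beta 1 n = - n%:~R.
Proof. by rewrite /beta /= invr1 mul1r mulr1. Qed.

Lemma bprod_eq0 k (n : nat) : (n < k)%N -> bprod k n = 0.
Proof.
elim: k n => // k ih [|n] h /=; first by rewrite oppr0 mul0r.
by rewrite -addn1 PoszD addrK ih ?mulr0.
Qed.

Lemma iter_fder k (A : int -> fock T -> fock T) n v :
  iter k (@fder _ _) A n v = bprod k n *: A (n - k%:Z) v.
Proof.
elim: k n => [|k ih] n; first by rewrite subr0 scale1r.
rewrite iterS {1}/fder ih scalerA; congr (_ *: A _ v); lia.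
Qed.

Lemma lfieldE p k x n v : lfield g (p, k, x) n v = beta k n *: rmode g p x (n - k%:Z) v.
Proof. by rewrite /lfield /fderdiv iter_fder scalerA /rmode; case: p. Qed.

Lemma lin_lfield l n : lin (lfield g l n).
Proof. by case: l => [[p k] x] a u v; rewrite !lfieldE; apply/lin_scale/lin_rmode. Qed.

Lemma lfield_vec p k (a : K) x y n v :
  lfield g (p, k, a *: x + y) n v = a *: lfield g (p, k, x) n v + lfield g (p, k, y) n v.
Proof. by rewrite !lfieldE rmode_vec scalerDr !scalerA mulrC. Qed.

Lemma lfield_bracket p k x m q k' y n v :
  lfield g (p, k, x) m (lfield g (q, k', y) n v) =
  (beta k m * beta k' n * cbr K p q (m - k%:Z) (n - k'%:Z) * g x y) *: v +
  (-1) ^+ (p && q) *: lfield g (q, k', y) n (lfield g (p, k, x) m v).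
Proof.
rewrite !lfieldE !(linZ (@lin_rmode _ _ _)) rmode_bracket !scalerDr !scalerA.
by congr (_ *: _ + _ *: _); ring.
Qed.

(** Both letters' modes create, or both annihilate: no contraction occurs. *)
Lemma lfield_bracket0 l l' m n v : (0 <= m) = (0 <= n) ->
  lfield g l m (lfield g l' n v) =
  (-1) ^+ (lodd l && lodd l') *: lfield g l' n (lfield g l m v).
Proof.
case: l l' => [[p k] x] [[q k'] y] h; rewrite lfield_bracket.
rewrite (_ : beta k m * beta k' n * _ = 0) ?mul0r ?scale0r ?add0r // /cbr.
case: (p =P q) => [_|_] /=; last by rewrite mulr0.
case: eqP => [e|_]; last by rewrite mulr0.
have z (j : int) i : 0 <= j -> j < i%:Z -> beta i j = 0.
  by case: j => // j _ ji; rewrite /beta bprod_eq0 ?mulr0.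
have [h0|h0] := leP 0 m.
  have h1 : 0 <= n by rewrite -h.
  have [mk|mk] := ltP m k%:Z; first by rewrite z ?mul0r.
  have [nk|nk] := ltP n k'%:Z; first by rewrite [beta k' n]z // mulr0 mul0r.
  case: p e => /= e; first by lia.
  by rewrite (_ : m - k%:Z = 0) ?mulr0 //; lia.
have h1 : n < 0 by rewrite ltNge -h -ltNge.
by case: p e => /= e; exfalso; lia.
Qed.

End Modes.

(** * Conformal weights and normally ordered products *)

Definition spanned (K : fieldType) (T : lmodType K) (P : pred (fword T)) :
    set (fock T) :=
  [set x | exists s, x = fcls s /\ all (fun q => P q.2) s].

(** Vectors whose components have (doubled) conformal weights in S.  Letting S
vary covers homogeneous vectors, parities and weight bounds at once. *)
Definition spanw (K : fieldType) (T : lmodType K) (S : pred int) : set (fock T) :=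
  spanned (fun w => S (wt2 w)%:Z).

(** The doubled weight is compared with an integer, possibly negative: a vector
below 0 vanishes, and the finiteness statements come down to this. *)
Definition wle (K : fieldType) (T : lmodType K) (z : int) : set (fock T) :=
  spanw (fun t => t <= z).

(** A sequence of operators which shifts weights as the modes of a homogeneous
vector of weight [al] do. *)
Definition wfld (K : fieldType) (T : lmodType K) (al : nat)
    (A : int -> fock T -> fock T) : Prop :=
  (forall n, lin (A n)) /\
  (forall S n v, spanw S v -> spanw (fun z => S (z + 2 * (n + 1) - al%:Z)) (A n v)).

Definition lwt (K : fieldType) (T : lmodType K) (l : letter T) : nat :=
  if lodd l then (l.1.2).*2.+1 else (l.1.2.+1).*2.

Section Spanned.
Context {K : fieldType} {T : lmodType K}.
Implicit Types (P Q : pred (fword T)) (S : pred int) (x y v : fock T) (w : fword T).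

Lemma wt2_cons (l : letter T) w : wt2 (l :: w) = (lwt l + wt2 w)%N.
Proof. by rewrite /wt2 big_cons. Qed.

Lemma wodd_wt2 w : wodd w = odd (wt2 w).
Proof.
elim: w => [|l w ih]; first by rewrite /wt2 big_nil.
rewrite wt2_cons oddD -ih /wodd /= oddD /lwt; congr (_ (+) _).
by case: (lodd l); rewrite /= odd_double.
Qed.

Lemma spanned0 P : spanned P (0 : fock T).
Proof. by exists [::]. Qed.

Lemma spanned_lin P (c : K) x y : spanned P x -> spanned P y -> spanned P (c *: x + y).
Proof.
move=> [s [-> hs]] [t [-> ht]]; exists (tscale c s ++ t).
split; first by rewrite fcls_cat; congr (_ + _); exact: fockZE.
by rewrite all_cat all_map ht andbT; apply: sub_all hs.
Qed.

Lemma spannedD P x y : spanned P x -> spanned P y -> spanned P (x + y).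
Proof. by move=> hx hy; have := spanned_lin 1 hx hy; rewrite scale1r. Qed.

Lemma spannedZ P (c : K) x : spanned P x -> spanned P (c *: x).
Proof. by move=> hx; have := spanned_lin c hx (spanned0 P); rewrite addr0. Qed.

Lemma spanned_sum P (I : Type) (r : seq I) (F : I -> fock T) :
  (forall i, spanned P (F i)) -> spanned P (\sum_(i <- r) F i).
Proof. by move=> h; apply: big_ind => // *; [exact: spanned0|exact: spannedD]. Qed.

Lemma spanned_mono P w : P w -> spanned P (fmono w : fock T).
Proof. by move=> h; exists [:: (1, w)]; rewrite /= h. Qed.

Lemma spannedS P Q x : (forall w, P w -> Q w) -> spanned P x -> spanned Q x.
Proof. by move=> h [s [-> hs]]; exists s; split=> //; apply: sub_all hs => q; exact: h. Qed.

Lemma spanned_map P Q (f : fock T -> fock T) x : lin f ->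
  (forall w, P w -> spanned Q (f (fmono w))) -> spanned P x -> spanned Q (f x).
Proof.
move=> hf h [s [-> hs]]; rewrite fcls_sum (lin_sum hf) big_seq.
apply: big_ind => [||q qs]; [exact: spanned0|by move=> *; exact: spannedD|].
by rewrite (linZ hf); apply/spannedZ/h; exact: (allP hs).
Qed.

Lemma spanw_map S S' (f : fock T -> fock T) x : lin f ->
  (forall w, S (wt2 w)%:Z -> spanw S' (f (fmono w))) -> spanw S x -> spanw S' (f x).
Proof. exact: spanned_map. Qed.
Lemma spanwD S x y : spanw S x -> spanw S y -> spanw S (x + y).
Proof. exact: spannedD. Qed.
Lemma spanwZ S (c : K) x : spanw S x -> spanw S (c *: x).
Proof. exact: spannedZ. Qed.

Lemma spanw_ext S S' x : (forall z, S z = S' z) -> spanw S x -> spanw S' x.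
Proof. by move=> h; apply: spannedS => w; rewrite h. Qed.

Lemma wleS z z' x : z <= z' -> wle z x -> wle z' x.
Proof. by move=> h; apply: spannedS => w hw; exact: le_trans h. Qed.

Lemma wle_lt0 z x : z < 0 -> wle z x -> x = 0.
Proof. by move=> z0 [[|q s] [-> //=]] /andP[h _]; lia. Qed.

Lemma wle_ex x : exists m : nat, wle m%:Z x.
Proof.
have [s ->] := fockE x; exists (\max_(q <- s) wt2 q.2)%N; exists s; split=> //.
apply/allP => q qs; rewrite lez_nat.
by elim: s qs => // r s ih; rewrite inE big_cons leq_max => /orP[/eqP->|/ih->];
  rewrite ?leqnn ?orbT.
Qed.

Lemma wfld_wle al (A : int -> fock T -> fock T) z n v : wfld al A -> wle z v ->
  wle (z - 2 * (n + 1) + al%:Z) (A n v).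
Proof. by move=> [_ h] hv; apply: spanw_ext (h (fun t => t <= z) n v hv) => t; apply/idP/idP; lia. Qed.

Lemma wfld_eq0 al (A : int -> fock T -> fock T) z n v : wfld al A -> wle z v ->
  z + al%:Z < 2 * (n + 1) -> A n v = 0.
Proof. by move=> hA hv h; apply: wle_lt0 (wfld_wle n hA hv); lia. Qed.

End Spanned.

Section Fsum.
Context {V : zmodType}.

Lemma fsum_trunc (F : nat -> V) (M : nat) : (forall i, (M <= i)%N -> F i = 0) ->
  \sum_(i \in [set: nat]) F i = \sum_(i < M) F i.
Proof.
move=> h; rewrite (fsbig_ord _ M F); symmetry; apply: fsbig_widen => // i [_ /= /negP].
by rewrite -leqNgt; exact: h.
Qed.

End Fsum.

Section NormalOrder.
Context {K : fieldType} {T : lmodType K}.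
Implicit Types (A B C : int -> fock T -> fock T) (v : fock T).

(** On vectors of bounded weight both sums of a normally ordered product are
finite.  Any M beyond the two bounds will do, so that products of several
fields can be compared term by term over the same range. *)
Lemma nprodE al be o A B z n v (M : nat) : wfld al A -> wfld be B -> wle z v ->
  z + be%:Z < 2 * (n + M%:Z + 1) -> z + al%:Z < 2 * (M%:Z + 1) ->
  nprod o A B n v = \sum_(i < M)
    (A (- i%:Z - 1) (B (n + i%:Z) v) + (-1) ^+ o *: B (n - i%:Z - 1) (A i%:Z v)).
Proof.
move=> hA hB hv h1 h2; rewrite /nprod !(@fsum_trunc _ _ M) => [||i iM].
- by rewrite big_split /= scaler_sumr.
- by move=> i iM; rewrite (wfld_eq0 hA hv) ?(lin0 (hB.1 _)) //; lia.
- by rewrite (wfld_eq0 hB hv) ?(lin0 (hA.1 _)) //; lia.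
Qed.

Lemma lin_nprod al be o A B n : wfld al A -> wfld be B -> lin (nprod o A B n).
Proof.
move=> hA hB k u v.
have [mu hu] := wle_ex u; have [mv hv] := wle_ex v.
have hu' : wle (mu + mv)%N%:Z u by apply: wleS hu; lia.
have hv' : wle (mu + mv)%N%:Z v by apply: wleS hv; lia.
have huv : wle (mu + mv)%N%:Z (k *: u + v) by exact: spanned_lin.
pose M := (mu + mv + al + be + absz n)%N.
rewrite !(@nprodE al be _ _ _ (mu + mv)%N%:Z _ _ M) //; try by rewrite /M; lia.
rewrite scaler_sumr -big_split /=; apply: eq_bigr => i _.
rewrite !((hB.1 _) k) !((hA.1 _) k) !((hB.1 _) k) !scalerDr !scalerA [k * _]mulrC.
by rewrite addrACA.
Qed.

Lemma nprod_spanw al be o A B S n v : wfld al A -> wfld be B -> spanw S v ->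
  spanw (fun z => S (z + 2 * (n + 1) - (al + be)%N%:Z)) (nprod o A B n v).
Proof.
move=> hA hB hv; set S' := (X in spanw X).
have h1 (i : nat) : spanw S' (A (- i%:Z - 1) (B (n + i%:Z) v)).
  by apply: spanw_ext (hA.2 _ _ _ (hB.2 _ _ _ hv)) => z; congr S; lia.
have h2 (i : nat) : spanw S' (B (n - i%:Z - 1) (A i%:Z v)).
  by apply: spanw_ext (hB.2 _ _ _ (hA.2 _ _ _ hv)) => z; congr S; lia.
apply: spannedD; last apply: spannedZ;
  apply: big_ind => [||i _]; try exact: spanned0; try exact: spannedD.
- exact: h1.
- exact: h2.
Qed.

Lemma wfld_nprod al be o A B : wfld al A -> wfld be B -> wfld (al + be) (nprod o A B).
Proof.
move=> hA hB; split=> [n|S n v]; first exact: lin_nprod hA hB.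
exact: nprod_spanw.
Qed.

Lemma nprod_linr al be o A B B' B'' (a : K) n v : wfld al A -> wfld be B ->
  wfld be B' -> wfld be B'' -> (forall m u, B m u = a *: B' m u + B'' m u) ->
  nprod o A B n v = a *: nprod o A B' n v + nprod o A B'' n v.
Proof.
move=> hA hB hB' hB'' h; have [m hv] := wle_ex v.
pose M := (m + al + be + absz n)%N.
rewrite !(@nprodE al be _ _ _ m%:Z _ _ M) //; try by rewrite /M; lia.
rewrite scaler_sumr -big_split; apply: eq_bigr => i _ /=.
rewrite !h (hA.1 _) !scalerDr !scalerA [a * _]mulrC.
by rewrite addrACA.
Qed.

Lemma nprod_linl al be o A A' A'' B (a : K) n v : wfld al A -> wfld al A' ->
  wfld al A'' -> wfld be B -> (forall m u, A m u = a *: A' m u + A'' m u) ->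
  nprod o A B n v = a *: nprod o A' B n v + nprod o A'' B n v.
Proof.
move=> hA hA' hA'' hB h; have [m hv] := wle_ex v.
pose M := (m + al + be + absz n)%N.
rewrite !(@nprodE al be _ _ _ m%:Z _ _ M) //; try by rewrite /M; lia.
rewrite scaler_sumr -big_split; apply: eq_bigr => i _ /=.
rewrite !h (hB.1 _) !scalerDr !scalerA [a * _]mulrC.
by rewrite addrACA.
Qed.

(** Nested normally ordered products may be reordered: the creation parts of A
and B commute with each other, and so do their annihilation parts. *)
Lemma nprod_swap al be ga a b c A B C n v : wfld al A -> wfld be B -> wfld ga C ->
  (forall i j u, (0 <= i) = (0 <= j) ->
     A i (B j u) = (-1) ^+ (a && b) *: B j (A i u)) ->
  nprod (a && (b (+) c)) A (nprod (b && c) B C) n v =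
  (-1) ^+ (a && b) *: nprod (b && (a (+) c)) B (nprod (a && c) A C) n v.
Proof.
move=> hA hB hC hAB; have [m hv] := wle_ex v.
have hBC o := wfld_nprod o hB hC; have hAC o := wfld_nprod o hA hC.
pose M := (m + al + be + ga + absz n)%N.
rewrite (@nprodE al (be + ga) _ _ _ m%:Z _ _ M) //; try by rewrite /M; lia.
rewrite (@nprodE be (al + ga) _ _ _ m%:Z _ _ M) //; try by rewrite /M; lia.
pose s (e : bool) : K := (-1) ^+ e.
transitivity (\sum_(i < M) \sum_(j < M) (
   A (- i%:Z - 1) (B (- j%:Z - 1) (C (n + i%:Z + j%:Z) v)) +
   s (b && c) *: A (- i%:Z - 1) (C (n + i%:Z - j%:Z - 1) (B j%:Z v)) +
   s (a && (b (+) c)) *: B (- j%:Z - 1) (C (n - i%:Z - 1 + j%:Z) (A i%:Z v)) +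
   (s (a && (b (+) c)) * s (b && c)) *:
     C (n - i%:Z - 1 - j%:Z - 1) (B j%:Z (A i%:Z v)))).
  apply: eq_bigr => i _.
  rewrite (@nprodE be ga _ _ _ m%:Z _ _ M) //; try by rewrite /M; lia.
  rewrite (@nprodE be ga _ _ _ _ _ _ M hB hC (wfld_wle i%:Z hA hv));
    try by rewrite /M; have := ltn_ord i; lia.
  rewrite (lin_sum (hA.1 _)) scaler_sumr -big_split /=; apply: eq_bigr => j _.
  by rewrite (linD (hA.1 _)) (linZ (hA.1 _)) !scalerDr !scalerA !addrA.
rewrite exchange_big /= scaler_sumr; apply: eq_bigr => j _.
rewrite (@nprodE al ga _ _ _ m%:Z _ _ M) //; try by rewrite /M; lia.
rewrite (@nprodE al ga _ _ _ _ _ _ M hA hC (wfld_wle j%:Z hB hv));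
  try by rewrite /M; have := ltn_ord j; lia.
rewrite (lin_sum (hB.1 _)) scaler_sumr -big_split /= scaler_sumr; apply: eq_bigr => i _.
rewrite (_ : n + j%:Z + i%:Z = n + i%:Z + j%:Z); last lia.
rewrite (_ : n - j%:Z - 1 + i%:Z = n + i%:Z - j%:Z - 1); last lia.
rewrite (_ : n + j%:Z - i%:Z - 1 = n - i%:Z - 1 + j%:Z); last lia.
rewrite (_ : n - j%:Z - 1 - i%:Z - 1 = n - i%:Z - 1 - j%:Z - 1); last lia.
rewrite (linD (hB.1 _)) (linZ (hB.1 _)) !scalerDr !scalerA.
rewrite hAB; last by apply/idP/idP; lia.
rewrite [A i%:Z (B j%:Z v)]hAB // (linZ (hC.1 _)) !scalerA.
rewrite [RHS]addrACA -[LHS]addrA [RHS]addrA.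
rewrite -[RHS]addrA /s; congr (_ + _ *: _ + (_ *: _ + _ *: _)).
all: by case: (a) (b) (c) => [] [] [] /=; ring.
Qed.

End NormalOrder.

Section WordFields.
Context {K : fieldType} {T : lmodType K}.
Variable g : T -> T -> K.
Hypothesis g_linl : forall (a : K) x y z, g (a *: x + y) z = a * g x z + g y z.
Hypothesis g_sym : forall x y, g x y = g y x.
Implicit Types (l : letter T) (u w : fword T) (v : fock T) (x y : T) (S : pred int) (p q : bool).

Lemma create_spanw l S v : spanw S v ->
  spanw (fun z => S (z - (lwt l)%:Z)) (fcreate l v).
Proof.
apply: spanw_map => [|w]; first exact: lin_create.
by rewrite fcreateM => h; apply: spanned_mono; rewrite wt2_cons PoszD addrAC addrN add0r.
Qed.

Lemma contract_spanw l S v : spanw S v ->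
  spanw (fun z => S (z + (lwt l)%:Z)) (fcontract g l v).
Proof.
apply: spanw_map => [|w]; first exact: lin_contract.
rewrite contractM //; elim: w S => [|l' w ih] S h; first by exists [::].
rewrite dcon_cons; apply: spanwD; last first.
  apply: spanwZ.
  have {}h : (fun z => S (z + (lwt l')%:Z)) (wt2 w)%:Z.
    by move: h; rewrite wt2_cons PoszD addrC.
  have h1 := create_spanw l' (ih (fun z => S (z + (lwt l')%:Z)) h).
  by apply: (spanw_ext _ h1) => z /=; congr S; lia.
rewrite /lpair; case: eqP => [e|_]; last by rewrite scale0r; exact: spanned0.
apply/spannedZ/spanned_mono.
move: h; rewrite wt2_cons PoszD addrC [lwt l'](_ : _ = lwt l) //.
by rewrite /lwt /lodd e.
Qed.

Lemma rmode_spanw p x n S v : spanw S v ->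
  spanw (fun z => S (z + 2 * n + p%:Z)) (rmode g p x n v).
Proof.
case: n => n h; last first.
  rewrite rmode_neg; apply: spanw_ext (create_spanw (p, n, x) h) => z.
  by congr S; rewrite /lwt /lodd /=; case: (p); lia.
rewrite /rmode; case: p => /=.
  apply: spanw_ext (contract_spanw (true, n, x) h) => z.
  by congr S; rewrite /lwt /lodd /=; lia.
case: n => [|n]; first exact: spanned0.
apply: spanwZ.
apply: spanw_ext (contract_spanw (false, n, x) h) => z.
by congr S; rewrite /lwt /lodd /=; lia.
Qed.

Lemma wfld_lfield l : wfld (lwt l) (lfield g l).
Proof.
split=> [n|S n v h]; first exact: lin_lfield.
case: l => [[p k] x]; rewrite lfieldE; apply: spanwZ.
apply: spanw_ext (rmode_spanw p x (n - k%:Z) h) => z.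
by congr S; rewrite /lwt /lodd /=; case: (p); lia.
Qed.

Lemma wfld_id : wfld 0 (fun n (v : fock T) => if n == -1 then v else 0).
Proof.
split=> [n|S n v h]; case: eqP => e; [exact: lin_id|exact: lin_zero| |exact: spanned0].
by apply: spanw_ext h => z; congr S; rewrite e; lia.
Qed.

Lemma wfld_wfield w : wfld (wt2 w) (wfield g w).
Proof.
elim: w => [|l w ih] /=; first by rewrite /wt2 big_nil; exact: wfld_id.
by rewrite wt2_cons; apply: wfld_nprod => //; exact: wfld_lfield.
Qed.

Lemma lin_wfield w n : lin (wfield g w n).
Proof. exact: (wfld_wfield w).1. Qed.

Lemma wt2_vec u p k x y w : wt2 (u ++ (p, k, x) :: w) = wt2 (u ++ (p, k, y) :: w).
Proof. by rewrite /wt2 !big_cat !big_cons. Qed.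

Lemma wfield_cons l w :
  wfield g (l :: w) = nprod (lodd l && wodd w) (lfield g l) (wfield g w).
Proof. by []. Qed.

(** The field of a word depends only on the vector the word represents: it is
linear in each letter because normally ordered products are, and swapping two
letters is [nprod_swap]. *)
Lemma wfield_sml n v : super_multilinear (fun w => wfield g w n v).
Proof.
split=> [u p k a x y w|u l l' w].
  elim: u n v => [|l u ih] n v; rewrite ?cat0s ?cat_cons !wfield_cons.
    apply: (nprod_linl _ _ _ (wfld_lfield (p, k, a *: x + y)) (wfld_lfield (p, k, x))
      (wfld_lfield (p, k, y)) (wfld_wfield w)).
    by move=> m v'; exact: lfield_vec.
  have wo z : wodd (u ++ (p, k, z) :: w) = wodd (u ++ (p, k, x) :: w).
    by rewrite !wodd_wt2; congr odd; exact: wt2_vec.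
  rewrite (wo (a *: x + y)) (wo y); apply: nprod_linr; last exact: ih.
  - exact: wfld_lfield.
  - exact: wfld_wfield.
  - rewrite (@wt2_vec _ _ _ _ x); exact: wfld_wfield.
  - rewrite (@wt2_vec _ _ _ _ y); exact: wfld_wfield.
elim: u n v => [|l1 u ih] n v; rewrite ?cat0s ?cat_cons !wfield_cons.
  have woc l1 w1 : wodd (l1 :: w1) = lodd l1 (+) wodd w1.
    by rewrite /wodd /= oddD; case: (lodd l1).
  rewrite !woc; apply: nprod_swap; [exact: wfld_lfield..|exact: wfld_wfield|].
  by move=> i j v' h; exact: lfield_bracket0.
have wt : wt2 (u ++ l :: l' :: w) = wt2 (u ++ l' :: l :: w).
  by rewrite /wt2 !big_cat !big_cons /=; congr addn; exact: addnCA.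
have wo : wodd (u ++ l :: l' :: w) = wodd (u ++ l' :: l :: w) by rewrite !wodd_wt2 wt.
rewrite wo -[RHS]addr0 -(scaler0 _ 0).
have [f1 _] := wfld_lfield l1; set o := lodd l1 && _.
rewrite (@nprod_linr _ _ (lwt l1) (wt2 (u ++ l' :: l :: w)) o _ _
  (wfield g (u ++ l' :: l :: w)) (fun _ _ => 0) ((-1) ^+ (lodd l && lodd l'))).
- congr (_ + _).
  rewrite /nprod !fsbig1 ?scaler0 ?addr0 ?scale0r // => i _; exact: lin0 (f1 _).
- exact: wfld_lfield.
- by rewrite -wt; exact: wfld_wfield.
- exact: wfld_wfield.
- by split=> [m|S m v' _]; [exact: lin_zero|exact: spanned0].
- by move=> m v'; rewrite addr0; exact: ih.
Qed.

Lemma fock_mode_mono w n v : fock_mode g (fmono w) n v = wfield g w n v.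
Proof. exact: fock_extM (wfield_sml n v). Qed.

Lemma lin_model n v : lin (fun a => fock_mode g a n v).
Proof. exact: lin_fock_ext (wfield_sml n v). Qed.

Lemma lin_moder a n : lin (fock_mode g a n).
Proof.
move=> k u v; rewrite /fock_mode /fock_ext scaler_sumr -big_split.
apply: eq_bigr => q _ /=; rewrite (lin_wfield q.2 n) scalerDr !scalerA.
by rewrite [k * _]mulrC.
Qed.

Lemma mode_spanw S S' n a v : spanw S a -> spanw S' v ->
  spanw (fun z => `[< exists s s', [/\ S s, S' s' & z = s + s' - 2 * (n + 1)] >])
    (fock_mode g a n v).
Proof.
move=> ha hv.
apply: (@spanw_map _ _ S _ (fun a => fock_mode g a n v) a (lin_model n v) _ ha).
move=> w hw; rewrite fock_mode_mono; apply: spannedS ((wfld_wfield w).2 _ n _ hv) => w' h.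
by apply/asboolP; do 2! eexists; split; [exact: hw|exact: h|lia].
Qed.

End WordFields.

(** * Brackets of the generators with the fields of words *)

(** The contractions of u with one operator of parity p: the sign is that of the
operator moving past the letters that precede the removed one. *)
Fixpoint wdel (K : fieldType) (T : lmodType K) (p : bool) (u : fword T) :
    seq (K * letter T * fword T) :=
  if u is l :: u' then (1, l, u') ::
    [seq ((-1) ^+ (p && lodd l) * q.1.1, q.1.2, l :: q.2) | q <- wdel p u']
  else [::].

(** The bracket of the mode j with the field of the letter l is this number
times a power of the formal variable. *)
Definition gam (K : fieldType) (T : lmodType K) (g : T -> T -> K) (p : bool)
    (x : T) (j : int) (l : letter T) : K :=
  beta l.1.2 (l.1.2%:Z - j - p%:Z) * cbr K p l.1.1 j (- j - p%:Z) * g x l.2.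

Section Brackets.
Context {K : fieldType} {T : lmodType K}.
Variable g : T -> T -> K.
Hypothesis g_linl : forall (a : K) x y z, g (a *: x + y) z = a * g x z + g y z.
Hypothesis g_sym : forall x y, g x y = g y x.
Implicit Types (l : letter T) (u w : fword T) (v : fock T) (x y : T) (p : bool).

Local Notation linW := (lin_wfield g_linl g_sym).
Local Notation linL := (lin_lfield g_linl g_sym).
Local Notation linR := (lin_rmode g_linl g_sym).

Lemma wodd_cons l w : wodd (l :: w) = lodd l (+) wodd w.
Proof. by rewrite /wodd /= oddD; case: (lodd l). Qed.

Lemma wdel_wt2 p u q : q \in wdel p u -> (wt2 q.2 + lwt q.1.2 = wt2 u)%N.
Proof.
elim: u q => [|l u ih] q //=; rewrite inE => /orP[/eqP->|/mapP[q' /ih h ->]] /=.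
  by rewrite wt2_cons addnC.
by rewrite !wt2_cons -addnA h.
Qed.

Lemma wdel_odd p u q : q \in wdel p u -> wodd q.2 = wodd u (+) lodd q.1.2.
Proof.
move=> /wdel_wt2 h; rewrite !wodd_wt2 -h oddD -addbA.
have -> : odd (lwt q.1.2) = lodd q.1.2.
  by rewrite /lwt; case: (lodd _); rewrite /= odd_double.
by rewrite addbb addbF.
Qed.

Lemma gam_neq p x j l : p != lodd l -> gam g p x j l = 0.
Proof. by rewrite /gam /cbr /lodd => /negPf ->; rewrite mulr0 mul0r. Qed.

Lemma rmode_lfield p x j l n v : rmode g p x j (lfield g l n v) =
  (if n == l.1.2%:Z - j - p%:Z then gam g p x j l else 0) *: v +
  (-1) ^+ (p && lodd l) *: lfield g l n (rmode g p x j v).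
Proof.
case: l => [[q k] y]; rewrite !lfieldE (linZ (linR _ _ _)) rmode_bracket //.
rewrite scalerDr !scalerA mulrC /lodd /= [beta _ _ * _]mulrC; congr (_ *: _ + _).
case: eqP => [->|h].
  by rewrite /gam /= (_ : k%:Z - j - p%:Z - k%:Z = - j - p%:Z); [ring|lia].
rewrite /cbr; case: eqP => [e|_]; last by rewrite !mul0r.
by case: eqP => [h'|_]; [exfalso; apply: h; lia|rewrite !mul0r].
Qed.

(** The two halves of a normally ordered product together run over all
integers. *)
Lemma sum_pick (V : zmodType) (H : int -> V) (n0 : int) (M : nat) :
  (absz n0 < M)%N ->
  \sum_(i < M) ((if - i%:Z - 1 == n0 then H (- i%:Z - 1) else 0) +
                (if i%:Z == n0 then H i%:Z else 0)) = H n0.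
Proof.
case: n0 => n h.
  rewrite (bigD1 (Ordinal h)) //= big1 ?addr0 => [|i].
    by rewrite ifF ?eqxx ?add0r //; apply/eqP; lia.
  rewrite -val_eqE /= => ni.
  by rewrite ifF ?ifF ?addr0 //; apply/eqP; lia.
have h' : (n < M)%N by lia.
rewrite (bigD1 (Ordinal h')) //= big1 ?addr0 => [|i].
  have -> : - n%:Z - 1 = Negz n by lia.
  by rewrite eqxx ?addr0.
rewrite -val_eqE /= => ni.
by rewrite ifF ?ifF ?addr0 //; apply/eqP; lia.
Qed.

Lemma bracket_nprod al be (A B B' : int -> fock T -> fock T) (C : fock T -> fock T)
    (a : int -> K) (sA sB : K) (o : bool) z n v (M : nat) :
  wfld al A -> wfld be B -> lin C -> wle z v -> wle z (C v) ->
  z + be%:Z < 2 * (n + M%:Z + 1) -> z + al%:Z < 2 * (M%:Z + 1) ->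
  (forall i (u : fock T), C (A i u) = a i *: u + sA *: A i (C u)) ->
  (forall i (u : fock T), C (B i u) = B' i u + sB *: B i (C u)) ->
  C (nprod o A B n v) =
    \sum_(i < M) (a (- i%:Z - 1) *: B (n + i%:Z) v +
                  ((-1) ^+ o * sB * a i%:Z) *: B (n - i%:Z - 1) v) +
    sA *: \sum_(i < M) (A (- i%:Z - 1) (B' (n + i%:Z) v)) +
    (-1) ^+ o *: \sum_(i < M) (B' (n - i%:Z - 1) (A i%:Z v)) +
    (sA * sB) *: nprod o A B n (C v).
Proof.
move=> hA hB hC hv hCv h1 h2 hCA hCB.
rewrite (nprodE _ hA hB hv h1 h2) (nprodE _ hA hB hCv h1 h2) (lin_sum hC) !scaler_sumr.
rewrite -!big_split; apply: eq_bigr => i _ /=.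
rewrite (linD hC) (linZ hC) hCA !hCB hCA (linD (hA.1 _)) (linZ (hA.1 _)).
rewrite (linD (hB.1 _)) !(linZ (hB.1 _)) !scalerDr !scalerA.
have -> : (-1) ^+ o * sB * sA = sA * sB * (-1) ^+ o by ring.
have perm6 (t1 t2 t3 t4 t5 t6 : fock T) :
  t1 + (t2 + t3) + (t4 + (t5 + t6)) = t1 + t5 + t2 + t4 + (t3 + t6).
  rewrite -!addrA; congr (_ + _); rewrite [RHS]addrCA; congr (_ + _).
  by rewrite [RHS]addrCA [LHS]addrCA; congr (_ + _); exact: addrCA.
exact: perm6.
Qed.

(** Wick's formula with one generator: its bracket with a normally ordered
product is the sum of the products in which one factor is contracted. *)
Lemma rmode_wfield p x j u m v : rmode g p x j (wfield g u m v) =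
  \sum_(q <- wdel p u) (q.1.1 * gam g p x j q.1.2) *:
     wfield g q.2 (m + j + p%:Z - (q.1.2.1.2)%:Z - 1) v +
  (-1) ^+ (p && wodd u) *: wfield g u m (rmode g p x j v).
Proof.
elim: u m v => [|l u ih] m v.
  rewrite big_nil add0r andbF expr0 scale1r /=.
  by case: eqP => // _; exact: lin0 (linR _ _ _).
have hA := wfld_lfield g_linl g_sym l; have hB := wfld_wfield g_linl g_sym u.
have [z hv] := wle_ex v; have [z' hv'] := wle_ex (rmode g p x j v).
have {}hv : wle (z + z')%N%:Z v by apply: wleS hv; lia.
have {}hv' : wle (z + z')%N%:Z (rmode g p x j v) by apply: wleS hv'; lia.
have lkq (q : letter T) : (q.1.2 <= lwt q)%N by rewrite /lwt; case: (lodd q); lia.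
pose M := (z + z' + lwt l + wt2 u + absz m + absz j + l.1.2 + wt2 u + 5)%N.
rewrite wfield_cons.
rewrite (@bracket_nprod _ _ _ _ _ _ _ _ _ _ _ _ _ M hA hB (linR p x j) hv hv' _ _
  (rmode_lfield p x j l) ih) /=; try by rewrite /M; lia.
rewrite big_cons big_map wodd_cons; congr (_ + _); last first.
  by congr (_ *: _); case: (p) (lodd l) (wodd u) => [] [] [] /=; ring.
rewrite -[LHS]addrA; congr (_ + _); last first.
  rewrite [X in _ *: X](eq_bigr (fun i : 'I_M => \sum_(q <- wdel p u)
    (q.1.1 * gam g p x j q.1.2) *: lfield g l (- i%:Z - 1)
       (wfield g q.2 (m + j + p%:Z - q.1.2.1.2%:Z - 1 + i%:Z) v))); last first.
    move=> i _; rewrite (lin_sum (linL _ _)); apply: eq_bigr => q _.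
    by rewrite (linZ (linL _ _)); congr (_ *: lfield _ _ _ (wfield _ _ _ _)); lia.
  rewrite exchange_big [X in _ + _ *: X]exchange_big !scaler_sumr -big_split.
  apply: eq_big_seq => -[[c l'] w] qin /=.
  have /= lw := wdel_wt2 qin; have /= ow := wdel_odd qin; have lk := lkq l'.
  rewrite -!scaler_sumr.
  rewrite (@nprodE _ _ (lwt l) (wt2 w) _ _ _ _ _ _ M hA (wfld_wfield g_linl g_sym w) hv);
    try by rewrite /M; case: (p); lia.
  rewrite big_split /= -!scaler_sumr scalerDr !scalerA; congr (_ + _); first by rewrite mulrA.
  rewrite (eq_bigr (fun i : 'I_M => wfield g w
      (m + j + p%:Z - l'.1.2%:Z - 1 - i%:Z - 1) (lfield g l i%:Z v))); last first.
    by move=> i _; congr (wfield _ _ _ _); ring.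
  congr (_ *: _).
  case: (eqVneq p (lodd l')) => [e|/gam_neq->]; last by rewrite !(mulr0, mul0r).
  rewrite ow -e; move: (gam _ _ _ _ _) => c'.
  by case: (p) (lodd l) (wodd u) => [] [] [] /=; ring.
pose n0 : int := l.1.2%:Z - j - p%:Z.
pose H t := (1 * gam g p x j l) *: wfield g u (m - t - 1) v.
transitivity (H n0); last by rewrite /H /n0 /=; congr (_ *: wfield _ _ _ _); lia.
rewrite -(@sum_pick _ H n0 M).
  apply: eq_bigr => i _; congr (_ + _).
    rewrite /H; case: ifP => _; rewrite ?scale0r // mul1r.
    by congr (_ *: wfield _ _ _ _); ring.
  case: ifP => _; last by rewrite !mulr0 scale0r.
  rewrite /H mul1r; congr (_ *: _); case: (eqVneq p (lodd l)) => [<-|/gam_neq->].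
    by rewrite -expr2 sqrr_sign mul1r.
  by rewrite !mulr0.
by rewrite /n0 /M; have := lkq l; case: (p); lia.
Qed.

End Brackets.

(** * Locality *)

(** Multiplication by (z - w) of a formal distribution in z and w, given by its
coefficients of z^(-m-1) w^(-n-1). *)
Definition zw (V : zmodType) (F : int -> int -> V) : int -> int -> V :=
  fun m n => F (m + 1) n - F m (n + 1).

Definition killed (V : zmodType) (N : nat) (F : int -> int -> V) : Prop :=
  forall m n, iter N (@zw V) F m n = 0.

Section Killed.
Context {K : fieldType} {V : lmodType K}.
Implicit Types (F G H : int -> int -> V) (N : nat).

Lemma iter_zwS (W : zmodType) N (F : int -> int -> W) m n :
  iter N.+1 (@zw W) F m n = iter N (@zw W) F (m + 1) n - iter N (@zw W) F m (n + 1).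
Proof. by []. Qed.

Lemma iter_zw_ext N F G : (forall m n, F m n = G m n) ->
  forall m n, iter N (@zw V) F m n = iter N (@zw V) G m n.
Proof. by elim: N => // N ih h m n; rewrite !iter_zwS !(ih h). Qed.

Lemma killed_ext N F G : (forall m n, F m n = G m n) -> killed N F -> killed N G.
Proof. by move=> h k m n; rewrite -(iter_zw_ext N h). Qed.

Lemma iter_zw_comb N (a : K) F G m n :
  iter N (@zw V) (fun m n => a *: F m n + G m n) m n =
  a *: iter N (@zw V) F m n + iter N (@zw V) G m n.
Proof.
elim: N m n => // N ih m n; rewrite !iter_zwS !ih scalerBr opprD.
by rewrite addrACA.
Qed.

Lemma iter_zw_shift N i j F m n :
  iter N (@zw V) (fun m n => F (m + i) (n + j)) m n = iter N (@zw V) F (m + i) (n + j).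
Proof.
elim: N m n => // N ih m n; rewrite !iter_zwS !ih.
by rewrite [m + 1 + i]addrAC [n + 1 + j]addrAC.
Qed.

Lemma iter_zw0 N m n : iter N (@zw V) (fun _ _ => 0) m n = 0.
Proof. by elim: N m n => // N ih m n; rewrite iter_zwS !ih subr0. Qed.

Lemma killed_comb N (a : K) F G : killed N F -> killed N G ->
  killed N (fun m n => a *: F m n + G m n).
Proof. by move=> hF hG m n; rewrite iter_zw_comb hF hG scaler0 addr0. Qed.

Lemma killed0 N : killed N (fun _ _ => 0 : V).
Proof. by move=> m n; exact: iter_zw0. Qed.

Lemma killedZ N (a : K) F : killed N F -> killed N (fun m n => a *: F m n).
Proof.
by move=> h; apply: killed_ext (killed_comb a h (killed0 N)) => m n; rewrite addr0.
Qed.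

Lemma killedD N F G : killed N F -> killed N G -> killed N (fun m n => F m n + G m n).
Proof.
by move=> h h'; apply: killed_ext (killed_comb 1 h h') => m n; rewrite scale1r.
Qed.

Lemma killed_sum N (I : eqType) (r : seq I) (F : I -> int -> int -> V) :
  (forall i, i \in r -> killed N (F i)) -> killed N (fun m n => \sum_(i <- r) F i m n).
Proof.
elim: r => [|i r ih] h.
  by apply: killed_ext (killed0 N) => m n; rewrite big_nil.
have h1 : killed N (fun m n => F i m n + \sum_(i <- r) F i m n).
  by apply: killedD; [apply: h; rewrite mem_head|apply: ih => j jr; apply: h; rewrite inE jr orbT].
by apply: killed_ext h1 => m n; rewrite big_cons.
Qed.

Lemma killedS N N' F : (N <= N')%N -> killed N F -> killed N' F.
Proof.
move=> /subnK <-; move: (N' - N)%N => k h m n; rewrite iterD.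
rewrite (iter_zw_ext _ (G := fun _ _ => 0)); first exact: iter_zw0.
exact: h.
Qed.

Lemma killed_shift N i j F : killed N F -> killed N (fun m n => F (m + i) (n + j)).
Proof. by move=> h m n; rewrite iter_zw_shift h. Qed.

Lemma iter_zw_lin (W : lmodType K) (f : V -> W) N F m n : lin f ->
  iter N (@zw W) (fun m n => f (F m n)) m n = f (iter N (@zw V) F m n).
Proof. by move=> hf; elim: N m n => // N ih m n; rewrite !iter_zwS !ih (linB hf). Qed.

Lemma killed_lin (f : V -> V) N F : lin f -> killed N F -> killed N (fun m n => f (F m n)).
Proof. by move=> hf h m n; rewrite (iter_zw_lin _ _ _ _ hf) h lin0. Qed.

(** A coefficient of (z - w)^N F involves finitely many coefficients of F, hence
only finitely many terms of the sum. *)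
Lemma killed_esum N F (f : nat -> int -> int -> V) :
  (forall m n, exists M0, forall M, (M0 <= M)%N -> F m n = \sum_(i < M) f i m n) ->
  (forall i, killed N (f i)) -> killed N F.
Proof.
move=> hF hf m n.
have [M /(_ _ (leqnn M)) ->] : exists M0, forall M, (M0 <= M)%N ->
    iter N (@zw V) F m n = \sum_(i < M) iter N (@zw V) (f i) m n.
  elim: N {hf} m n => // N ih m n.
  have [M1 h1] := ih (m + 1) n; have [M2 h2] := ih m (n + 1).
  exists (maxn M1 M2) => M; rewrite geq_max => /andP[l1 l2].
  rewrite iter_zwS (h1 _ l1) (h2 _ l2) -sumrN -big_split.
  by apply: eq_bigr => i _; rewrite iter_zwS.
by rewrite big1 // => i _; exact: hf.
Qed.

Lemma iter_zwE N F m n : iter N (@zw V) F m n =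
  \sum_(i < N.+1) ((-1) ^+ i * 'C(N, i)%:R) *: F (m + N%:Z - i%:Z) (n + i%:Z).
Proof.
elim: N m n => [|N ih] m n.
  by rewrite big_ord1 /= mul1r scale1r subr0 !addr0.
rewrite iter_zwS !ih [RHS]big_ord_recl /= bin0.
rewrite [X in X - _]big_ord_recl [X in _ - X]big_ord_recr /= !bin0 binn -addrA; congr (_ + _).
  by congr (_ *: F _ _); lia.
rewrite big_ord_recr /= /bump /= add1n binn opprD addrA; congr (_ + _); last first.
  rewrite -scaleNr !mulr1 exprS mulN1r; congr (_ *: F _ _); lia.
rewrite -sumrN -big_split; apply: eq_bigr => i _ /=.
rewrite (_ : m + N.+1%:Z - (1 + i)%N%:Z = m + N%:Z - i%:Z); last lia.
rewrite (_ : m + 1 + N%:Z - (1 + i)%N%:Z = m + N%:Z - i%:Z); last lia.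
rewrite (_ : n + 1 + i%:Z = n + (1 + i)%N%:Z); last lia.
rewrite -scalerBl; congr (_ *: _).
have -> : 'C(N.+1, 1 + i) = ('C(N, 1 + i) + 'C(N, i))%N by rewrite add1n binS.
by rewrite natrD mulrDr exprS mulN1r !mulNr.
Qed.

End Killed.

(** Polynomiality of degree less than d, in the form of the vanishing of the d-th
difference: multiplying by (z - w) produces differences of coefficients. *)
Fixpoint degle (K : fieldType) (d : nat) (f : int -> K) : Prop :=
  if d is d'.+1 then degle d' (fun j => f j - f (j - 1)) else forall j, f j = 0.

Section Degree.
Context {K : fieldType}.
Implicit Types (f h : int -> K) (d : nat).

Lemma degle_ext d f h : (forall j, f j = h j) -> degle d f -> degle d h.
Proof.
elim: d f h => [|d ih] f h e /=; first by move=> hf j; rewrite -e.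
by apply: ih => j; rewrite !e.
Qed.

Lemma degle_add d f h : degle d f -> degle d h -> degle d (fun j => f j + h j).
Proof.
elim: d f h => [|d ih] f h /=; first by move=> hf hh j; rewrite hf hh addr0.
by move=> hf hh; apply: degle_ext (ih _ _ hf hh) => j; ring.
Qed.

Lemma degle_scale d (a : K) f : degle d f -> degle d (fun j => a * f j).
Proof.
elim: d f => [|d ih] f /=; first by move=> hf j; rewrite hf mulr0.
by move=> hf; apply: degle_ext (ih _ hf) => j; ring.
Qed.

Lemma degle_shift d (i : int) f : degle d f -> degle d (fun j => f (j + i)).
Proof.
elim: d f => [|d ih] f /=; first by move=> hf j; rewrite hf.
by move=> hf; apply: degle_ext (ih _ hf) => j /=; congr (_ - f _); lia.
Qed.

Lemma degleS d d' f : (d <= d')%N -> degle d f -> degle d' f.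
Proof.
elim: d d' f => [|d ih] [|d'] f //= le hf; last exact: ih hf.
by elim: d' {le} f hf => [|d' ih] f hf /=; [move=> j|apply: ih => j]; rewrite !hf subrr.
Qed.

Lemma degle_lin d (a b : K) f : degle d f -> degle d.+1 (fun j => (a * j%:~R + b) * f j).
Proof.
elim: d f b => [|d ih] f b hf.
  by move=> j; rewrite !hf !mulr0 subrr.
have hf1 : degle d (fun j => f j - f (j - 1)) by [].
have h1 : degle d.+1 (fun j => a * f (j - 1)) by apply: degle_scale; exact: degle_shift.
apply: degle_ext (degle_add (ih _ b hf1) h1) => j.
by rewrite rmorphB /=; ring.
Qed.

Lemma degle_bprod d k (e : bool) (c : int) f :
  degle d f -> degle (d + k) (fun j => bprod k ((if e then j else - j) + c) * f j).
Proof.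
elim: k c => [|k ih] c hf.
  by rewrite addn0; apply: degle_ext hf => j /=; rewrite mul1r.
rewrite addnS.
apply: degle_ext (degle_lin (if e then -1 else 1) (- c%:~R) (ih (c - 1) hf)) => j /=.
by rewrite mulrA addrA; congr (_ * _ * _); case: (e); rewrite rmorphD ?rmorphN /=; ring.
Qed.

Lemma degle_beta d k (e : bool) (c : int) f :
  degle d f -> degle (d + k) (fun j => beta k ((if e then j else - j) + c) * f j).
Proof.
move=> /(degle_bprod k e c)/(degle_scale (k`!%:R)^-1); apply: degle_ext => j.
by rewrite /beta mulrA.
Qed.

Lemma degle_cst (a : K) : degle 1 (fun=> a).
Proof. by move=> j; rewrite subrr. Qed.

End Degree.

Section SplitSum.
Context {K : fieldType} {V : lmodType K}.
Implicit Types (F G : int -> int -> V) (c : int -> K).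

(** The product of the formal distribution with coefficients c, expanded in two
ways, with F and with G; b bounds the support of F and G. *)
Definition split_sum (b : nat) c F G : int -> int -> V := fun m n =>
  \sum_(i < absz m + absz n + b)
    (c (- i%:Z - 1) *: F (m - i%:Z - 1) (n + i%:Z + 1) + c i%:Z *: G (m + i%:Z) (n - i%:Z)).

Variables (b : nat) (F G : int -> int -> V).
Hypothesis F0 : forall m n, b%:Z <= n -> F m n = 0.
Hypothesis G0 : forall m n, b%:Z <= m -> G m n = 0.

Lemma split_sumE c m n (M : nat) : (absz m + absz n + b <= M)%N ->
  split_sum b c F G m n = \sum_(i < M)
    (c (- i%:Z - 1) *: F (m - i%:Z - 1) (n + i%:Z + 1) + c i%:Z *: G (m + i%:Z) (n - i%:Z)).
Proof.
move=> h; rewrite /split_sum (big_ord_widen_cond _ xpredT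
  (fun i : nat => c (- i%:Z - 1) *: F (m - i%:Z - 1) (n + i%:Z + 1) +
    c i%:Z *: G (m + i%:Z) (n - i%:Z)) h) big_mkcond /=.
apply: eq_bigr => i _; case: ltnP => // hi.
by rewrite F0 ?G0 ?scaler0 ?addr0 //; lia.
Qed.

Lemma zw_split_sum c m n : zw (split_sum b c F G) m n =
  - split_sum b (fun j => c j - c (j - 1)) F G m (n + 1) +
  c (-1) *: (F m (n + 1) - G m (n + 1)).
Proof.
pose M := (absz m + absz n + b).+2.
have hF : \sum_(i < M.+1) c (- i%:Z - 1) *: F (m + 1 - i%:Z - 1) (n + i%:Z + 1) =
    c (-1) *: F m (n + 1) +
    \sum_(i < M.+1) c (- i%:Z - 1 - 1) *: F (m - i%:Z - 1) (n + 1 + i%:Z + 1).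
  rewrite big_ord_recl /= [in RHS]big_ord_recr /= [X in _ + (_ + X)](_ : _ = 0).
    congr (c _ *: F _ _ + _); try lia.
    rewrite [RHS]addr0; apply: eq_bigr => i _; rewrite /bump /=; congr (c _ *: F _ _); lia.
  by rewrite F0 ?scaler0 // /M; lia.
have hG : \sum_(i < M.+1) c (i%:Z - 1) *: G (m + i%:Z) (n + 1 - i%:Z) =
    c (-1) *: G m (n + 1) +
    \sum_(i < M.+1) c i%:Z *: G (m + 1 + i%:Z) (n - i%:Z).
  rewrite big_ord_recl /= [in RHS]big_ord_recr /= [X in _ + (_ + X)](_ : _ = 0).
    congr (c _ *: G _ _ + _); try lia.
    rewrite [RHS]addr0; apply: eq_bigr => i _; rewrite /bump /=; congr (c _ *: G _ _); lia.
  by rewrite G0 ?scaler0 // /M; lia.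
rewrite /zw !(@split_sumE _ _ _ M.+1); try by rewrite /M; lia.
rewrite !big_split /= hF.
under [X in - (X + _) + _]eq_bigr do rewrite scalerBl.
under [X in - (_ + X) + _]eq_bigr do rewrite scalerBl.
rewrite !sumrB hG scalerBr.
have perm (cF cG s1 s2 s3 s4 : V) :
  cF + s1 + s2 - (s3 + s4) = - (s3 - s1 + (s4 - (cG + s2))) + (cF - cG).
  have -> : s4 - (cG + s2) = (s4 - s2) - cG by rewrite opprD [- cG - s2]addrC addrA.
  by rewrite [s3 - s1 + _]addrA opprB [RHS]addrC subrKA addrACA -opprD opprB !addrA.
exact: perm.
Qed.

(** Multiplication by (z - w) replaces c by its difference, up to a multiple of
F - G coming from the place where the two expansions meet.  After d steps only
these boundary terms remain, and (z - w)^N kills them. *)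
Lemma killed_split_sum d N c : degle d c -> killed N (fun m n => F m n - G m n) ->
  killed (d + N) (split_sum b c F G).
Proof.
move=> hc hN; elim: d c hc => [|d ih] c hc.
  apply: killed_ext (killed0 _) => m n; rewrite /split_sum big1 // => i _.
  by rewrite !hc !scale0r addr0.
have h1 := killed_shift 0 1 (ih _ hc).
have h2 := killed_shift 0 1 (killedS (leq_addl d N) hN).
move=> m n; rewrite addSn iterSr.
apply: (killed_ext _ (killed_comb (-1) h1 (killedZ (c (-1)) h2))) => m' n'.
by rewrite zw_split_sum addr0 scaleN1r.
Qed.

End SplitSum.

Section WordLocality.
Context {K : fieldType} {T : lmodType K}.
Variable g : T -> T -> K.
Hypothesis g_linl : forall (a : K) x y z, g (a *: x + y) z = a * g x z + g y z.
Hypothesis g_sym : forall x y, g x y = g y x.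
Implicit Types (l : letter T) (u w : fword T) (v : fock T) (x y : T) (p : bool).

Local Notation linW := (lin_wfield g_linl g_sym).
Local Notation linL := (lin_lfield g_linl g_sym).

(** A contraction between letters of doubled weights a and b is a polynomial of
degree less than a + b in the index of the mode, as the two-point function of
their fields has a pole of that order at most. *)
Lemma degle_gam l' l (c : K) : degle (lwt l' + lwt l)
  (fun j => beta l'.1.2 j * (c * gam g (lodd l') l'.2 (j - l'.1.2%:Z) l)).
Proof.
case: l' => [[p k] x]; rewrite [lodd _]/= [_.1.2]/= [_.2]/=; case: l => [[q k'] y].
case: (eqVneq p q) => [<-|pq]; last first.
  apply: (@degleS _ 0) => // j.
  by rewrite gam_neq ?mulr0.
have h1 : degle (1 + ~~ p) (fun j => cbr K p p (j - k%:Z) (- (j - k%:Z) - p%:Z)).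
  have e j : cbr K p p j (- j - p%:Z) = if p then 1 else j%:~R.
    by rewrite /cbr eqxx addrA addrN add0r addNr eqxx.
  case: p e => e; first by apply: degle_ext (degle_cst 1) => j; rewrite e.
  apply: degle_ext (degle_lin 1 (- k%:~R) (degle_cst 1)) => j.
  by rewrite e rmorphB mul1r mulr1.
have h2 := degle_beta k true 0 (degle_beta k' false (k'%:Z + k%:Z - p%:Z) h1).
apply: degleS (degle_ext _ (degle_scale (c * g x y) h2)).
  by rewrite /lwt /lodd /=; case: (p); lia.
move=> j /=; rewrite /gam /= addr0.
rewrite (_ : - j + (k'%:Z + k%:Z - p%:Z) = k'%:Z - (j - k%:Z) - p%:Z); last lia.
by ring.
Qed.

Lemma lfield_wfield l j u m v :
  lfield g l j (wfield g u m v) =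
  \sum_(q <- wdel (lodd l) u)
     (beta l.1.2 j * (q.1.1 * gam g (lodd l) l.2 (j - l.1.2%:Z) q.1.2)) *:
     wfield g q.2 (m + j - l.1.2%:Z + (lodd l)%:Z - (q.1.2.1.2)%:Z - 1) v +
  (-1) ^+ (lodd l && wodd u) *: wfield g u m (lfield g l j v).
Proof.
case: l => [[p k] x]; rewrite !lfieldE rmode_wfield // scalerDr scaler_sumr (linZ (linW _ _)) !scalerA.
rewrite [beta k j * _]mulrC; congr (_ + _); apply: eq_bigr => q _.
by rewrite scalerA addrA.
Qed.

(** Induction on the second word, l :: w.  Moving Y(u,z) past the two halves of
the field of l in the normally ordered product with Y(w) leaves two kinds of
terms: brackets of Y(u) with Y(w), which are local by induction, and
contractions of l with a letter of u.  The latter are products of Y(w) with the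
field of u without that letter, in one order or the other according to the half
of the field of l; by induction the two orders agree after multiplication by a
power of (z - w), so that [killed_split_sum] applies.  The order of locality
depends on the weights only, hence is the same for all vectors of bounded
weight. *)
Lemma wfield_local u w c : killed (wt2 u + wt2 w) (fun m n =>
  wfield g u m (wfield g w n c) -
  (-1) ^+ (wodd u && wodd w) *: wfield g w n (wfield g u m c)).
Proof.
elim: w u c => [|l w ih] u c.
  apply: killed_ext (killed0 _) => m n /=; rewrite andbF expr0 scale1r.
  by case: eqP => _; rewrite ?(lin0 (linW _ _)) subrr.
set p := lodd l; set k := l.1.2; set x := l.2.
have hA := wfld_lfield g_linl g_sym l; have hB := wfld_wfield g_linl g_sym w.
have hu := wfld_wfield g_linl g_sym u.
have [z hv] := wle_ex c.
pose s b : K := (-1) ^+ b; pose sA := s (p && wodd u); pose sB := s (wodd u && wodd w).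
pose so := s (p && wodd w).
have sAA : sA * sA = 1 by rewrite -expr2 sqrr_sign.
pose br a b v := wfield g u a (wfield g w b v) - sB *: wfield g w b (wfield g u a v).
pose f i m n := sA *: lfield g l (- i%:Z - 1) (br m (n + i%:Z) c) +
  so *: br m (n - i%:Z - 1) (lfield g l i%:Z c).
pose e (q : K * letter T * fword T) : int := - k%:Z + p%:Z - (q.1.2.1.2)%:Z - 1.
pose co (q : K * letter T * fword T) j := beta k j * (q.1.1 * gam g p x (j - k%:Z) q.1.2).
pose F q a b := wfield g q.2 (a + e q) (wfield g w (b - 1) c).
pose G q a b := (sB * so) *: wfield g w (b - 1) (wfield g q.2 (a + e q) c).
pose b0 := (z + (wt2 u).*2 + wt2 w + lwt l + 5)%N.
have kl (q : K * letter T * fword T) : q \in wdel p u -> (q.1.2.1.2 <= wt2 u)%N.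
  move=> /wdel_wt2; case: q => [[c' l'] w'] /= <-.
  by rewrite /lwt; case: (lodd l'); lia.
have F0 q m n : q \in wdel p u -> b0%:Z <= n -> F q m n = 0.
  move=> _ h; rewrite /F (wfld_eq0 hB hv) ?(lin0 (linW _ _)) //.
  by move: h; rewrite /b0; lia.
have G0 q m n : q \in wdel p u -> b0%:Z <= m -> G q m n = 0.
  move=> qin h; have := kl _ qin; have := wdel_wt2 qin.
  case: q qin h => [[c' [[b' k'] y']] w'] /= qin h lw lk.
  rewrite /G (wfld_eq0 (wfld_wfield g_linl g_sym w') hv) ?(lin0 (linW _ _)) ?scaler0 //.
  move: h lw lk; rewrite /b0 /e /=; set W := wt2 w'; set W' := wt2 u.
  have kk : (k <= lwt l)%N by rewrite /k /lwt; case: (lodd _); lia.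
  by move: kk; case: (p); lia.
(* the contractions of l with the letters of u *)
pose S m n := \sum_(q <- wdel p u) split_sum b0 (co q) (F q) (G q) m n.
pose D m n := wfield g u m (wfield g (l :: w) n c) -
  (-1) ^+ (wodd u && wodd (l :: w)) *: wfield g (l :: w) n (wfield g u m c).
have kS : killed (wt2 u + wt2 (l :: w)) S.
  apply: killed_sum => q qin.
  have lw := wdel_wt2 qin; have ow := wdel_odd qin.
  case: (eqVneq p (lodd q.1.2)) => [ep|np]; last first.
    apply: killed_ext (killed0 _) => m n; rewrite /split_sum big1 // => i _.
    by rewrite /co !gam_neq // !mulr0 !scale0r addr0.
  apply: (@killedS _ _ ((lwt l + lwt q.1.2) + (wt2 q.2 + wt2 w))).
    by rewrite wt2_cons -lw; lia.
  apply: killed_split_sum; [by move=> *; exact: F0|by move=> *; exact: G0|exact: degle_gam|].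
  have := killed_shift (e q) (-1) (ih q.2 c).
  apply: killed_ext => m n; rewrite /F /G; congr (_ - _ *: _).
  by rewrite ow -ep /sB /so /s; case: (p) (wodd u) (wodd w) => [] [] [] /=; ring.
(* what is left of the bracket D when they are taken out *)
have kD : killed (wt2 u + wt2 (l :: w)) (fun m n => D m n + sA *: S m n).
  apply: (@killed_esum _ _ _ _ f) => [m n|i]; last first.
    rewrite wt2_cons; apply: (@killedS _ _ (wt2 u + wt2 w)); first by lia.
    apply: killedD; apply: killedZ.
      apply: killed_lin; first exact: linL.
      apply: killed_ext (killed_shift 0 i%:Z (ih u c)) => a b.
      by rewrite /br addr0.
    apply: killed_ext (killed_shift 0 (- i%:Z - 1) (ih u (lfield g l i%:Z c))) => a b.
    by rewrite /br addr0 addrA.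
  have [z' hv'] := wle_ex (wfield g u m c).
  exists (z + z' + lwt l + wt2 w + absz m + absz n + b0)%N => M hM.
  have bc : (0 < (lwt l + wt2 w))%N by rewrite /lwt; case: (lodd l).
  have E0 : (-1) ^+ (wodd u && wodd (l :: w)) = sA * sB.
    by rewrite wodd_cons /sA /sB /s -/p; case: (p) (wodd u) (wodd w) => [] [] [] /=; ring.
  rewrite /D E0 wfield_cons.
  rewrite (@nprodE _ _ (lwt l) (wt2 w) _ _ _ z%:Z _ _ M) //; try lia.
  rewrite (@nprodE _ _ (lwt l) (wt2 w) _ _ _ z'%:Z _ _ M) //; try lia.
  have -> : S m n = \sum_(i < M) \sum_(q <- wdel p u)
      (co q (- i%:Z - 1) *: F q (m - i%:Z - 1) (n + i%:Z + 1) +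
       co q i%:Z *: G q (m + i%:Z) (n - i%:Z)).
    rewrite exchange_big /=; apply: eq_big_seq => q qin.
    by apply: split_sumE; [move=> *; exact: F0|move=> *; exact: G0|lia].
  rewrite (lin_sum (linW _ _)) !scaler_sumr -sumrN -!big_split.
  apply: eq_bigr => i _; rewrite big_split.
  have swap j v : wfield g u m (lfield g l j v) = sA *: lfield g l j (wfield g u m v) -
      sA *: \sum_(q <- wdel p u) co q j *: wfield g q.2 (m + j + e q) v.
    rewrite lfield_wfield scalerDr scalerA sAA scale1r addrAC.
    rewrite (eq_bigr (fun q => co q j *: wfield g q.2 (m + j + e q) v)) ?subrr ?add0r //.
    by move=> q _; congr (_ *: wfield _ _ _ _); rewrite /e; ring.
  have EF : \sum_(q <- wdel p u) co q (- i%:Z - 1) *: F q (m - i%:Z - 1) (n + i%:Z + 1) =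
      \sum_(q <- wdel p u) co q (- i%:Z - 1) *:
        wfield g q.2 (m + (- i%:Z - 1) + e q) (wfield g w (n + i%:Z) c).
    apply: eq_bigr => q _; rewrite /F addrK; congr (_ *: wfield _ _ _ _); ring.
  have EG : \sum_(q <- wdel p u) co q i%:Z *: G q (m + i%:Z) (n - i%:Z) =
      (sB * so) *: wfield g w (n - i%:Z - 1)
         (\sum_(q <- wdel p u) co q i%:Z *: wfield g q.2 (m + i%:Z + e q) c).
    rewrite (lin_sum (linW _ _)) scaler_sumr; apply: eq_bigr => q _.
    by rewrite /G (linZ (linW _ _)) !scalerA mulrC.
  rewrite EF EG /= (linD (linW _ _)) (linZ (linW _ _)) swap.
  have -> : lfield g l i%:Z (wfield g u m c) =
      sA *: wfield g u m (lfield g l i%:Z c) +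
      \sum_(q <- wdel p u) co q i%:Z *: wfield g q.2 (m + i%:Z + e q) c.
    by rewrite swap scalerBr !scalerA sAA !scale1r subrK.
  rewrite (linD (linW _ _)) !(linZ (linW _ _)) /f /br.
  rewrite (linB (linL _ _)) !(linZ (linL _ _)) !scalerBr !scalerDr !scalerA.
  rewrite (_ : sA * sB * (-1) ^+ (lodd l && wodd w) * sA = so * sB); last first.
    by rewrite -[LHS]mulrA -[LHS]mulrA [_ * sA]mulrC [sB * _]mulrC !mulrA sAA mul1r.
  rewrite (_ : sA * sB * (-1) ^+ (lodd l && wodd w) = sA * (sB * so)); last by rewrite mulrA.
  rewrite -/so.
  have perm (t1 t2 t3 t4 t5 t6 : fock T) :
    t1 - t2 + t3 - (t4 + (t5 + t6)) + (t2 + t6) = t1 - t4 + (t3 - t5).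
    rewrite [t1 - t2 + t3]addrAC [LHS]addrAC subrKA [t4 + _]addrA opprD [LHS]addrA.
    by rewrite [LHS]addrAC addrK opprD addrACA.
  exact: perm.
apply: killed_ext (killed_comb (-1) (killedZ sA kS) kD) => m n.
by rewrite scaleN1r addrC addrK.
Qed.

End WordLocality.

(** * The vertex algebra structure *)

(** The functions of L_0, which cut out the parities and the components of given
weight. *)
Definition wmul (K : fieldType) (T : lmodType K) (c : nat -> K) : fock T -> fock T :=
  fock_ext (fun w => c (wt2 w) *: fmono w).

Section Grading.
Context {K : fieldType} {T : lmodType K}.
Implicit Types (w : fword T) (x v : fock T) (c : nat -> K) (P Q : pred (fword T)).

Lemma wt2_sml (c : nat -> K) : super_multilinear (fun w : fword T => c (wt2 w) *: fmono w).
Proof.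
have [f1 f2] := @fmono_super_multilinear K T.
split=> [u p k a x y w|u l l' w].
  rewrite f1 scalerDr !scalerA [a * _]mulrC.
  by congr (c _ * a *: _ + c _ *: _); exact: wt2_vec.
rewrite f2 !scalerA mulrC; congr (_ * c _ *: _).
by rewrite /wt2 !big_cat !big_cons /=; congr addn; exact: addnCA.
Qed.

Lemma wmulM c w : wmul c (fmono w) = c (wt2 w) *: fmono w.
Proof. exact: fock_extM (wt2_sml c). Qed.

Lemma lin_wmul c : lin (@wmul K T c).
Proof. exact: lin_fock_ext (wt2_sml c). Qed.

Lemma spanned_ind P (f h : fock T -> fock T) x : lin f -> lin h ->
  (forall w, P w -> f (fmono w) = h (fmono w)) -> spanned P x -> f x = h x.
Proof.
move=> hf hh H [s [-> hs]]; rewrite fcls_sum (lin_sum hf) (lin_sum hh).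
apply: eq_big_seq => q qs; rewrite (linZ hf) (linZ hh) H //.
exact: (allP hs).
Qed.

Lemma wmul_id c x : spanned (fun w => c (wt2 w) == 1) x -> wmul c x = x.
Proof.
apply: (spanned_ind (h := id)); [exact: lin_wmul|exact: lin_id|].
by move=> w /eqP e; rewrite wmulM e scale1r.
Qed.

Lemma wmul_0 c x : spanned (fun w => c (wt2 w) == 0) x -> wmul c x = 0.
Proof.
apply: (spanned_ind (h := fun=> 0)); [exact: lin_wmul|exact: lin_zero|].
by move=> w /eqP e; rewrite wmulM e scale0r.
Qed.

Definition pproj (p : bool) : fock T -> fock T := wmul (fun k => (odd k == p)%:R).

Lemma pproj_id p x : fock_gr p x -> pproj p x = x.
Proof.
move=> h; apply: wmul_id; apply: (spannedS (P := fun w => wodd w == p)) => // w.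
by rewrite wodd_wt2 => ->.
Qed.

Lemma pproj_gr p x : fock_gr p (pproj p x).
Proof.
have h : spanned predT x by have [s ->] := fockE x; exists s; rewrite all_predT.
apply: (spanned_map (P := predT) (Q := fun w => wodd w == p)) h; first exact: lin_wmul.
move=> w _; rewrite /pproj wmulM -wodd_wt2.
by case: eqP => [e|_]; rewrite ?scale1r ?scale0r;
   [apply: spanned_mono; apply/eqP|exact: spanned0].
Qed.

Lemma pproj_sum x : x = pproj false x + pproj true x.
Proof.
move: x; apply: fmono_ext_eq => [||w]; first exact: lin_id.
  by apply: lin_add; exact: lin_wmul.
by rewrite /pproj !wmulM; case: (odd _); rewrite ?scale1r ?scale0r ?addr0 ?add0r.
Qed.

Lemma fock_gr_direct x : fock_gr false x -> fock_gr true x -> x = 0.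
Proof.
move=> h0 h1; rewrite -(pproj_id h0); apply: wmul_0.
apply: (spannedS (P := fun w => wodd w == true)) => // w; rewrite wodd_wt2 => /eqP ->.
by [].
Qed.

(** Splitting off the parity of a vector does not raise its weight. *)
Lemma spanned_gr_le p N x : fock_gr p x -> fock_le N x ->
  spanned (fun w => (wodd w == p) && (wt2 w <= N)%N) x.
Proof.
move=> hp hx; rewrite -(pproj_id hp).
apply: (spanned_map (P := fun w => (wt2 w <= N)%N)) hx; first exact: lin_wmul.
move=> w hw; rewrite /pproj wmulM -wodd_wt2.
by case: eqP => [e|_]; rewrite ?scale1r ?scale0r;
   [apply: spanned_mono; rewrite e eqxx|exact: spanned0].
Qed.

Lemma wle_le N x : wle N%:Z x <-> fock_le N x.
Proof. by []. Qed.

Lemma wt2_eq0 w : (wt2 w == 0%N) = (w == [::]).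
Proof.
case: w => [|l w]; first by rewrite /wt2 big_nil.
by rewrite wt2_cons /lwt; case: (lodd l).
Qed.

(** The coefficient of the empty word is compatible with the relations of Fock
space. *)
Lemma vac_neq0 : fmono [::] != 0 :> fock T.
Proof.
apply/eqP => h.
have E := fcls_sum ([::] : fterm K T).
pose f w : K^o := if w == [::] :> fword T then 1 else 0.
have sf : super_multilinear f.
  split=> [u p k a x y w|u l l' w]; rewrite /f; case: u => [|? ?] //=;
    by rewrite ?scaler0 ?addr0.
have := fock_extM [::] sf; rewrite h (lin0 (lin_fock_ext sf)) /f eqxx => /eqP.
by rewrite eq_sym oner_eq0.
Qed.

End Grading.

Section VertexAlg.
Context {K : numFieldType} {T : lmodType K}.
Variable g : T -> T -> K.
Hypothesis g_linl : forall (a : K) x y z, g (a *: x + y) z = a * g x z + g y z.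
Hypothesis g_sym : forall x y, g x y = g y x.
Implicit Types (l : letter T) (u w : fword T) (v : fock T) (x y : T) (p : bool).

Local Notation linW := (lin_wfield g_linl g_sym).
Local Notation linL := (lin_lfield g_linl g_sym).
Local Notation linR := (lin_rmode g_linl g_sym).
Local Notation linM := (lin_moder g_linl g_sym).
Local Notation vac0 := (fmono [::] : fock T).

Lemma wfield1 l n v : wfield g [:: l] n v = lfield g l n v.
Proof.
have [z hv] := wle_ex v.
have hA := wfld_lfield g_linl g_sym l.
rewrite wfield_cons andbF.
rewrite (@nprodE _ _ _ _ _ _ _ _ _ _ (z + lwt l + absz n).+1 hA (wfld_id (T := T)) hv);
  try lia.
rewrite -[RHS](@sum_pick _ (fun t => lfield g l t v) n (z + lwt l + absz n).+1); last lia.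
apply: eq_bigr => i _; rewrite expr0 scale1r; congr (_ + _).
  rewrite (_ : (n + i%:Z == -1) = (- i%:Z - 1 == n)); last by apply/idP/idP; lia.
  by case: ifP => // _; exact: lin0 (linL _ _).
by rewrite /= (_ : (n - i%:Z - 1 == -1) = (i%:Z == n)) //; apply/idP/idP; lia.
Qed.

Lemma bprod_fact k c : @bprod K k (Negz c) * c`!%:R = (c + k)`!%:R.
Proof.
elim: k c => [|k ih] c /=; first by rewrite mul1r addn0.
have -> : Negz c - 1 = Negz c.+1 by lia.
by rewrite addnS -addSn -ih factS natrM NegzE rmorphN opprK /=; ring.
Qed.

Lemma lfield_pos_vac l (n : int) v : 0 <= n ->
  (forall p x j, 0 <= j -> rmode g p x j v = 0) -> lfield g l n v = 0.
Proof.
case: l n => [[p k] x] [] // n _ h; rewrite lfieldE.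
have [nk|kn] := ltnP n k; first by rewrite /beta bprod_eq0 // mulr0 scale0r.
by rewrite h ?scaler0 //; lia.
Qed.

Lemma vac_pos p x j : 0 <= j -> rmode g p x j vac0 = 0.
Proof. exact: rmode_vac. Qed.

Lemma lfield_create l v : lfield g l (-1) v = fcreate l v.
Proof.
case: l => [[p k] x]; rewrite lfieldE /beta -(rmode_neg g).
have := bprod_fact k 0; rewrite mulr1 add0n => ->.
rewrite mulVf ?scale1r; last by rewrite pnatr_eq0 -lt0n fact_gt0.
congr rmode; lia.
Qed.

Lemma wfield_vac w : wfield g w (-1) vac0 = fmono w /\
  forall n, 0 <= n -> wfield g w n vac0 = 0.
Proof.
elim: w => [|l w [ih1 ih2]]; first by split=> // -[].
have hA := wfld_lfield g_linl g_sym l; have hB := wfld_wfield g_linl g_sym w.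
have hv : wle 0 vac0 by apply: spanned_mono; rewrite /wt2 big_nil.
have bc : (0 < lwt l)%N by rewrite /lwt; case: (lodd l).
split=> [|n n0]; rewrite wfield_cons.
  rewrite (@nprodE _ _ _ _ _ _ _ _ _ _ (lwt l + wt2 w).+1 hA hB hv); try lia.
  rewrite big_ord_recl big1 ?addr0 => [|i _].
    by rewrite /= ih1 lfield_create fcreateM (lfield_pos_vac _ _ vac_pos) // 
       (lin0 (linW _ _)) scaler0 addr0.
  rewrite (lfield_pos_vac _ _ vac_pos) // (lin0 (linW _ _)) scaler0 addr0.
  by rewrite ih2 ?(lin0 (linL _ _)) //= /bump; lia.
rewrite (@nprodE _ _ _ _ _ _ _ _ _ _ (lwt l + wt2 w).+1 hA hB hv); try lia.
rewrite big1 // => i _; rewrite (lfield_pos_vac _ _ vac_pos) // (lin0 (linW _ _)) scaler0 addr0.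
by rewrite ih2 ?(lin0 (linL _ _)) //; lia.
Qed.

Lemma mode_creation a : fock_mode g a (-1) vac0 = a /\
  forall n, 0 <= n -> fock_mode g a n vac0 = 0.
Proof.
split.
  move: a; apply: (fmono_ext_eq (h := id)) => [||w]; [exact: lin_model|exact: lin_id|].
  by rewrite fock_mode_mono // (wfield_vac w).1.
move=> n n0; move: a; apply: (fmono_ext_eq (h := fun=> 0)) => [||w].
- exact: lin_model.
- exact: lin_zero.
by rewrite fock_mode_mono // (wfield_vac w).2.
Qed.

Lemma mode_wle z z' n a v : wle z a -> wle z' v ->
  wle (z + z' - 2 * (n + 1)) (fock_mode g a n v).
Proof.
move=> ha hv; apply: spannedS (mode_spanw g_linl g_sym (S := fun t => t <= z)
  (S' := fun t => t <= z') n ha hv) => w.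
by move=> /asboolP[s [s' [h1 h2 e]]]; rewrite e lerD2r; exact: (lerD h1 h2).
Qed.

Lemma fock_gr_mode p q a n b : fock_gr p a -> fock_gr q b ->
  fock_gr (p (+) q) (fock_mode g a n b).
Proof.
pose S p (z : int) := odd (absz z) == p.
have E r (x : fock T) : fock_gr r x <-> spanw (S r) x.
  have H w : (wodd w == r) = S r (wt2 w)%:Z by rewrite wodd_wt2.
  by split=> h; [apply: (@spannedS K T (fun w => wodd w == r) (fun w => S r (wt2 w)%:Z)) h|
    apply: (@spannedS K T (fun w => S r (wt2 w)%:Z) (fun w => wodd w == r)) h] => w;
    rewrite H.
move=> /E ha /E hb; apply/E; apply: spannedS (mode_spanw g_linl g_sym (S := S p)
  (S' := S q) n ha hb) => w.
move=> /asboolP[s [s' [/eqP <- /eqP <- e]]]; rewrite /S.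
have [t ht] : exists t : int, (absz s)%:Z + (absz s')%:Z = (wt2 w)%:Z + 2 * t.
  exists ((if s < 0 then - s else 0) + (if s' < 0 then - s' else 0) + (n + 1)).
  by rewrite e; case: s s' {e} => s [s'|s'] /=; lia.
apply/eqP; rewrite -oddD /=; case: t ht => t ht.
  have -> : (absz s + absz s' = wt2 w + t.*2)%N by lia.
  by rewrite oddD odd_double addbF.
have -> : (wt2 w = absz s + absz s' + t.+1.*2)%N by lia.
by rewrite oddD odd_double addbF.
Qed.

(** The order of locality is bounded by the weights of a and b alone, whereas an
order chosen for each pair of vectors separately would not pass to sections. *)
Lemma mode_local N N' M p q a b :
  spanned (fun w => (wodd w == p) && (wt2 w <= N)%N) a ->
  spanned (fun w => (wodd w == q) && (wt2 w <= N')%N) b ->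
  (N + N' <= M)%N -> forall m n c,
  \sum_(i < M.+1) ((-1) ^+ i * 'C(M, i)%:R) *:
    (fock_mode g a (m + M%:Z - i%:Z) (fock_mode g b (n + i%:Z) c) -
     (-1) ^+ (p && q) *: fock_mode g b (n + i%:Z) (fock_mode g a (m + M%:Z - i%:Z) c)) = 0.
Proof.
move=> ha hb hM m n c.
pose F a b m n := fock_mode g a m (fock_mode g b n c) -
     (-1) ^+ (p && q) *: fock_mode g b n (fock_mode g a m c).
suff: iter M (@zw _) (F a b) m n = 0 by rewrite iter_zwE.
have linF1 b' m' n' : lin (fun a' => F a' b' m' n').
  apply: lin_sub; first exact: lin_model.
  apply: lin_scale; apply: (lin_comp (f := fock_mode g b' n')); first exact: linM.
  exact: lin_model.
have linF2 a' m' n' : lin (fun b' => F a' b' m' n').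
  apply: lin_sub; last exact/lin_scale/lin_model.
  apply: (lin_comp (f := fock_mode g a' m')); first exact: linM.
  exact: lin_model.
have iterlin (H : fock T -> int -> int -> fock T) : (forall m' n', lin (fun a => H a m' n')) ->
    forall k m' n', lin (fun a => iter k (@zw _) (H a) m' n').
  move=> hH; elim=> [|k ih] m' n'; first exact: hH.
  by apply: (@lin_sub _ _ _ (fun a => iter k (@zw _) (H a) (m' + 1) n')
    (fun a => iter k (@zw _) (H a) m' (n' + 1))); exact: ih.
apply: (spanned_ind (f := fun a => iter M (@zw _) (F a b) m n) (h := fun=> 0) _ _ _ ha).
- exact: iterlin.
- exact: lin_zero.
move=> w /andP[/eqP wp wN].
apply: (spanned_ind (f := fun b => iter M (@zw _) (F (fmono w) b) m n) (h := fun=> 0) _ _ _ hb).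
- exact: iterlin.
- exact: lin_zero.
move=> w' /andP[/eqP wq wN'].
rewrite (iter_zw_ext _ (G := fun m n => wfield g w m (wfield g w' n c) -
  (-1) ^+ (p && q) *: wfield g w' n (wfield g w m c))); last first.
  by move=> m' n'; rewrite /F !fock_mode_mono.
rewrite -wp -wq; apply: (killedS _ (wfield_local g_linl g_sym w w' c)).
by apply: leq_trans hM; exact: leq_add.
Qed.

Section Derivation.
Variable D : fock T -> fock T.
Hypothesis linD' : lin D.
Hypothesis D_rmode : forall p x j v,
  D (rmode g p x j v) - rmode g p x j (D v) = (- j%:~R) *: rmode g p x (j - 1) v.
Hypothesis D_vac : D vac0 = 0.

Lemma bprod_recr k n : @bprod K k.+1 n = - (n - k%:Z)%:~R * @bprod K k n.
Proof.
elim: k n => [|k ih] n; first by rewrite /= subr0.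
rewrite [LHS]/= -/(@bprod K k.+1 (n - 1)) ih [in RHS]/= mulrCA; congr (- _%:~R * _).
lia.
Qed.

Lemma D_lfield l j v :
  D (lfield g l j v) - lfield g l j (D v) = (- j%:~R) *: lfield g l (j - 1) v.
Proof.
case: l => [[p k] x]; rewrite !lfieldE (linZ linD') -scalerBr D_rmode !scalerA.
have E : beta k j * - (j - k%:Z)%:~R = - j%:~R * beta k (j - 1) :> K.
  by rewrite /beta [RHS]mulrCA -[- _ * @bprod K _ _]/(@bprod K k.+1 j) bprod_recr; ring.
by rewrite E addrAC.
Qed.

(** The bracket with D shifts the indices of the factors; the terms that cross
from one half of the normally ordered product to the other have coefficient
zero. *)
Lemma D_nprod al be (o : bool) (A B : int -> fock T -> fock T) n v : wfld al A -> wfld be B ->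
  (forall j (u : fock T), D (A j u) - A j (D u) = (- j%:~R) *: A (j - 1) u) ->
  (forall j (u : fock T), D (B j u) - B j (D u) = (- j%:~R) *: B (j - 1) u) ->
  D (nprod o A B n v) - nprod o A B n (D v) = (- n%:~R) *: nprod o A B (n - 1) v.
Proof.
move=> hA hB dA dB.
have [z hv] := wle_ex v; have [z' hv'] := wle_ex (D v).
pose M := (z + z' + al + be + absz n).+2.
have DA j (u : fock T) : D (A j u) = A j (D u) + (- j%:~R) *: A (j - 1) u.
  by rewrite -dA addrC subrK.
have DB j (u : fock T) : D (B j u) = B j (D u) + (- j%:~R) *: B (j - 1) u.
  by rewrite -dB addrC subrK.
rewrite (@nprodE _ _ _ _ _ _ _ _ _ _ M.+1 hA hB hv); try by rewrite /M; lia.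
rewrite (@nprodE _ _ _ _ _ _ _ _ _ _ M.+1 hA hB hv'); try by rewrite /M; lia.
rewrite (@nprodE _ _ _ _ _ _ _ _ _ _ M.+1 hA hB hv); try by rewrite /M; lia.
rewrite (lin_sum linD') -sumrB.
rewrite (eq_bigr (fun i : 'I_M.+1 =>
  ((i%:Z + 1)%:~R *: A (- i%:Z - 1 - 1) (B (n + i%:Z) v) +
   (- (n + i%:Z)%:~R) *: A (- i%:Z - 1) (B (n - 1 + i%:Z) v)) +
  (-1) ^+ o *: ((- (n - i%:Z - 1)%:~R) *: B (n - 1 - i%:Z - 1) (A i%:Z v) +
   (- i%:~R) *: B (n - i%:Z - 1) (A (i%:Z - 1) v)))); last first.
  move=> i _; rewrite (linD linD') (linZ linD') DA DB (linD (hA.1 _)) (linZ (hA.1 _)).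
  rewrite DB DA (linD (hB.1 _)) (linZ (hB.1 _)) !scalerDr.
  rewrite (_ : n + i%:Z - 1 = n - 1 + i%:Z); last by ring.
  rewrite (_ : n - i%:Z - 1 - 1 = n - 1 - i%:Z - 1); last by ring.
  rewrite (_ : - (- i%:Z - 1)%:~R = (i%:Z + 1)%:~R); last by rewrite -rmorphN /=; congr _%:~R; ring.
  have perm (t1 t2 t3 s1 s2 s3 : fock T) :
    t1 + t2 + t3 + (s1 + s2 + s3) - (t1 + s1) = t3 + t2 + (s3 + s2).
    rewrite -(addrA t1) -(addrA s1) [t2 + t3]addrC [s2 + s3]addrC.
    by rewrite [X in X - _]addrACA [LHS]addrC addKr.
  by rewrite perm.
have e1 : \sum_(i < M.+1) (i%:Z + 1)%:~R *: A (- i%:Z - 1 - 1) (B (n + i%:Z) v) =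
    \sum_(i < M.+1) i%:~R *: A (- i%:Z - 1) (B (n - 1 + i%:Z) v).
  rewrite [in RHS]big_ord_recl scale0r add0r big_ord_recr /=.
  rewrite (wfld_eq0 hB hv) ?(lin0 (hA.1 _)) ?scaler0 ?addr0; last by rewrite /M; lia.
  apply: eq_bigr => i _; rewrite /bump /=.
  congr (_%:~R *: A _ (B _ _)); lia.
have e2 : \sum_(i < M.+1) (- i%:~R) *: B (n - i%:Z - 1) (A (i%:Z - 1) v) =
    \sum_(i < M.+1) (- (i%:Z + 1)%:~R) *: B (n - 1 - i%:Z - 1) (A i%:Z v).
  rewrite big_ord_recl oppr0 scale0r add0r [in RHS]big_ord_recr /=.
  rewrite (wfld_eq0 hA hv) ?(lin0 (hB.1 _)) ?scaler0 ?addr0; last by rewrite /M; lia.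
  apply: eq_bigr => i _; rewrite /bump /=.
  congr (- _%:~R *: B _ (A _ _)); lia.
rewrite big_split /= big_split /= e1 -scaler_sumr big_split /= e2 -!big_split /=.
rewrite scaler_sumr -big_split scaler_sumr; apply: eq_bigr => i _ /=.
rewrite -!scalerDl scalerDr !scalerA [X in _ = _ + X *: _]mulrC.
by congr (_ *: _ + (_ * _) *: _); rewrite ?rmorphD ?rmorphB ?rmorphN /=; ring.
Qed.

Lemma D_wfield w n v :
  D (wfield g w n v) - wfield g w n (D v) = (- n%:~R) *: wfield g w (n - 1) v.
Proof.
elim: w n v => [|l w ih] n v.
  rewrite /=; have [->|n1] := eqVneq n (-1); first by rewrite subrr scaler0.
  rewrite (lin0 linD') subrr; case: eqP => [e|_]; last by rewrite scaler0.
  by rewrite (_ : n = 0) ?oppr0 ?scale0r //; lia.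
by rewrite wfield_cons; apply: (D_nprod _ _ _ (wfld_lfield g_linl g_sym l)
  (wfld_wfield g_linl g_sym w)) => // j u; exact: D_lfield.
Qed.

(** D acts as d/dz on all fields because they are normally ordered products of
derivatives of the generating ones. *)
Lemma D_mode a n v : D (fock_mode g a n v) - fock_mode g a n (D v) =
  (- n%:~R) *: fock_mode g a (n - 1) v.
Proof.
move: a; apply: fmono_ext_eq => [||w].
- apply: lin_sub; last exact: lin_model.
  by apply: lin_comp => //; exact: lin_model.
- by apply: lin_scale; exact: lin_model.
by rewrite !fock_mode_mono // D_wfield.
Qed.

Lemma D_trans a : fock_mode g a (-2) vac0 = D a.
Proof.
have := D_mode a (-1) vac0; rewrite (mode_creation a).1 D_vac (lin0 (linM _ _)) subr0.
by rewrite opprK scale1r => ->.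
Qed.

Lemma fock_vertex_algebra n (e : 'I_n -> T) : is_vertex_algebra (NS_data g e).
Proof.
split.
- by move=> p; exists [::].
- by move=> p k a b; exact: (@spanned_lin K T (fun w => wodd w == p)).
- by move=> v; exists (pproj false v), (pproj true v); split;
    [exact: pproj_gr|exact: pproj_gr|exact: pproj_sum].
- exact: fock_gr_direct.
- by move=> k a b m c; exact: (lin_model g_linl g_sym m c).
- by move=> k a m b c; exact: (linM a m).
- exact: fock_gr_mode.
- move=> a b; have [z ha] := wle_ex a; have [z' hb] := wle_ex b.
  exists (z + z')%N%:Z => m hm; apply: (wle_lt0 _ (mode_wle m ha hb)); lia.
- exact: (@spanned_mono K T (fun w => wodd w == false) [::]).
- by move=> a m b; rewrite /trans /= !D_trans D_mode.
- by move=> m b; rewrite /= fock_mode_mono.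
- exact: mode_creation.
move=> p q a b ha hb; have [z /wle_le za] := wle_ex a; have [z' /wle_le zb] := wle_ex b.
exists (z + z')%N => m k c.
exact: (mode_local (spanned_gr_le ha za) (spanned_gr_le hb zb) (leqnn _)).
Qed.

End Derivation.
End VertexAlg.

(** * The superconformal structure *)

Section Superconformal.
Context {K : numFieldType} {T : lmodType K}.
Variable g : T -> T -> K.
Hypothesis g_linl : forall (a : K) x y z, g (a *: x + y) z = a * g x z + g y z.
Hypothesis g_sym : forall x y, g x y = g y x.
Variables (n : nat) (e : 'I_n -> T).
Hypothesis e_orth : forall i j, g (e i) (e j) = (i == j)%:R.
Hypothesis e_span : forall x, x = \sum_i g x (e i) *: e i.
Implicit Types (l : letter T) (w : fword T) (u v : fock T) (x y : T) (p : bool).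

Local Notation linW := (lin_wfield g_linl g_sym).
Local Notation linL := (lin_lfield g_linl g_sym).
Local Notation linR := (lin_rmode g_linl g_sym).
Local Notation linM := (lin_moder g_linl g_sym).
Local Notation vac0 := (fmono [::] : fock T).
Local Notation L := (fock_mode g (fock_nu e)).
Local Notation G := (fock_mode g (fock_tau e)).

Lemma lmode_sum (I : Type) (r : seq I) (F : I -> fword T) m v :
  fock_mode g (\sum_(i <- r) fmono (F i)) m v = \sum_(i <- r) wfield g (F i) m v.
Proof.
rewrite (lin_sum (lin_model g_linl g_sym m v)).
by apply: eq_bigr => i _; rewrite fock_mode_mono.
Qed.

Lemma nuE m v : L m v =
  2^-1 *: \sum_i (wfield g [:: (false, 0%N, e i); (false, 0%N, e i)] m v) +
  2^-1 *: \sum_i (wfield g [:: (true, 1%N, e i); (true, 0%N, e i)] m v).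
Proof.
have lm := lin_model g_linl g_sym m v.
by rewrite /fock_nu (linD lm) !(linZ lm) !lmode_sum.
Qed.

Lemma tauE m v : G m v =
  \sum_i (wfield g [:: (false, 0%N, e i); (true, 0%N, e i)] m v).
Proof. by rewrite lmode_sum. Qed.

Lemma rmode_span p x m v : \sum_i g x (e i) *: rmode g p (e i) m v = rmode g p x m v.
Proof.
have lv : lin (fun x => rmode g p x m v) by move=> *; exact: rmode_vec.
by rewrite [in RHS](e_span x) (lin_sum lv); apply: eq_bigr => i _; rewrite (linZ lv).
Qed.

Lemma rmode_wfield2 p x j l l' m v : rmode g p x j (wfield g [:: l; l'] m v) =
  gam g p x j l *: lfield g l' (m + j + p%:Z - l.1.2%:Z - 1) v +
  ((-1) ^+ (p && lodd l) * gam g p x j l') *: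
    lfield g l (m + j + p%:Z - l'.1.2%:Z - 1) v +
  (-1) ^+ (p && (lodd l (+) lodd l')) *: wfield g [:: l; l'] m (rmode g p x j v).
Proof.
rewrite rmode_wfield // !big_cons big_nil addr0 !mul1r mulr1 !wfield1 // !wodd_cons.
by rewrite /= addbF.
Qed.

Lemma gam0 p q x y j :
  gam g p x j (q, 0%N, y) = if p == q then (if p then 1 else j%:~R) * g x y else 0.
Proof.
rewrite /gam beta0 mul1r /cbr /=; case: eqP => [_|_] /=; last by rewrite mul0r.
by rewrite addrA addrN add0r addNr eqxx.
Qed.

Lemma gam1 x y j : gam g true x j (true, 1%N, y) = j%:~R * g x y.
Proof.
rewrite /gam /cbr beta1 /= addrA addrN add0r addNr eqxx mulr1; congr (_ * _).
by rewrite -rmorphN /=; congr _%:~R; lia.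
Qed.

Lemma lfield0 q y k v : lfield g (q, 0%N, y) k v = rmode g q y k v.
Proof. by rewrite lfieldE beta0 scale1r subr0. Qed.

Lemma lfield1 q y k v : lfield g (q, 1%N, y) k v = (- k%:~R) *: rmode g q y (k - 1) v.
Proof. by rewrite lfieldE beta1. Qed.

(** The generators are primary, of weights 1 and 1/2. *)
Lemma rmode_nu p x j m v : rmode g p x j (L m v) =
  (j%:~R + p%:R * m%:~R / 2) *: rmode g p x (m + j - 1) v + L m (rmode g p x j v).
Proof.
rewrite !nuE (linD (linR _ _ _)) !(linZ (linR _ _ _)) !(lin_sum (linR _ _ _)).
rewrite -(rmode_span p x (m + j - 1)).
have two : (2 : K) != 0 by rewrite pnatr_eq0.
have E1 i : rmode g p x j (wfield g [:: (false, 0%N, e i); (false, 0%N, e i)] m v) =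
    ((if p then 0 else 2 * j%:~R) * g x (e i)) *: rmode g p (e i) (m + j - 1) v +
    wfield g [:: (false, 0%N, e i); (false, 0%N, e i)] m (rmode g p x j v).
  rewrite rmode_wfield2 !gam0 !lfield0 /lodd /= andbF scale1r.
  case: p => /=; first by rewrite !(mulr0, mul0r, scale0r, add0r).
  rewrite (_ : m + j + 0 - 0%Z - 1 = m + j - 1); last lia.
  by rewrite -scalerDl; congr (_ *: _ + _); ring.
have E2 i : rmode g p x j (wfield g [:: (true, 1%N, e i); (true, 0%N, e i)] m v) =
    ((if p then 2 * j%:~R + m%:~R else 0) * g x (e i)) *: rmode g p (e i) (m + j - 1) v +
    wfield g [:: (true, 1%N, e i); (true, 0%N, e i)] m (rmode g p x j v).
  rewrite rmode_wfield2 lfield0 lfield1 /lodd /= andbF scale1r.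
  case: (p) => /=; last by rewrite !gam_neq // !(mulr0, mul0r, scale0r, add0r).
  rewrite gam1 gam0 /= expr1 mul1r.
  rewrite (_ : m + j + 1 - 1 - 1 = m + j - 1); last lia.
  rewrite (_ : m + j + 1 - 0%Z - 1 - 1 = m + j - 1); last lia.
  rewrite (_ : m + j + 1 - 0%Z - 1 = m + j); last lia.
  by rewrite !scalerA -scalerDl rmorphD /=; congr (_ *: _ + _); ring.
under eq_bigr do rewrite E1.
under [X in _ + _ *: X = _]eq_bigr do rewrite E2.
rewrite !big_split /= !scalerDr addrACA; congr (_ + _).
rewrite !scaler_sumr -big_split; apply: eq_bigr => i _ /=.
rewrite !scalerA -scalerDl; congr (_ *: _).
by case: (p) => /=; field.
Qed.

Lemma rmode_tau p x j m v : rmode g p x j (G m v) =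
  (if p then 1 else j%:~R) *: rmode g (~~ p) x (m + j + p%:Z - 1) v +
  (-1) ^+ p *: G m (rmode g p x j v).
Proof.
rewrite !tauE (lin_sum (linR _ _ _)) -rmode_span !scaler_sumr -big_split.
apply: eq_bigr => i _; rewrite rmode_wfield2 !gam0 !lfield0 /lodd /=.
have E q : m + j + q - 0%Z - 1 = m + j + q - 1 by lia.
case: p; rewrite /= E !(scale0r, mulr0, mul0r, addr0, add0r, expr0, mul1r, scale1r, scalerA) //.
Qed.

(** * Operators commuting with the generators *)

(** The generators act irreducibly, so an operator commuting with them is
determined by its value on the vacuum. *)
Lemma commuting_eq0 (X : fock T -> fock T) (b : bool) : lin X -> X vac0 = 0 ->
  (forall p x j v, rmode g p x j (X v) = (-1) ^+ (p && b) *: X (rmode g p x j v)) ->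
  forall v, X v = 0.
Proof.
move=> hX X0 h; apply: fmono_ext_eq => [//||w]; first exact: lin_zero.
elim: w => [//|[[p k] x] w ih].
rewrite -fcreateM -(rmode_neg g); have := h p x (Negz k) (fmono w).
rewrite ih (lin0 (linR _ _ _)) => /esym/eqP; rewrite scaler_eq0 signr_eq0 /=.
by move/eqP.
Qed.

Lemma nu_rmode p x j m v : L m (rmode g p x j v) = rmode g p x j (L m v) -
  (j%:~R + p%:R * m%:~R / 2) *: rmode g p x (m + j - 1) v.
Proof. by rewrite rmode_nu addrC addrA addNr add0r. Qed.

Lemma nu_vac m : 0 <= m -> L m vac0 = 0.
Proof. exact: (mode_creation g_linl g_sym _).2. Qed.

Lemma tau_vac m : 0 <= m -> G m vac0 = 0.
Proof. exact: (mode_creation g_linl g_sym _).2. Qed.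

(** [L 1] is the operator L_0. *)
Lemma nu1_word w : L 1 (fmono w) = ((wt2 w)%:R / 2) *: fmono w.
Proof.
elim: w => [|[[p k] x] w ih]; first by rewrite nu_vac // /wt2 big_nil mul0r scale0r.
rewrite -fcreateM -(rmode_neg g) nu_rmode ih (linZ (linR _ _ _)).
rewrite (_ : 1 + Negz k - 1 = Negz k); last lia.
rewrite -scalerBl wt2_cons natrD; congr (_ *: _).
rewrite /lwt /lodd /= NegzE mulrNz.
have two : (2 : K) != 0 by rewrite pnatr_eq0.
have e1 : (k.*2.+1)%:R = 2 * k%:R + 1 :> K by rewrite -addn1 natrD -mul2n natrM.
have e2 : (k.+1.*2)%:R = 2 * k%:R + 2 :> K by rewrite doubleS -addn2 natrD -mul2n natrM.
have e3 : k.+1%:~R = k%:R + 1 :> K by rewrite -addn1 PoszD rmorphD.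
by case: p; rewrite ?e1 ?e2 e3 /= ?mulr1 ?mul0r ?mulr0n; field.
Qed.

Lemma nu1_wmul v : L 1 v = wmul (fun k => k%:R / 2) v.
Proof.
move: v; apply: fmono_ext_eq => [||w]; [exact: linM|exact: lin_wmul|].
by rewrite nu1_word wmulM.
Qed.

(** Every term of the normally ordered products in L_0 contains an annihilation
operator. *)
Lemma nu1_annihilated v : (forall p x j, 0 <= j -> rmode g p x j v = 0) -> L 1 v = 0.
Proof.
move=> h; have [z hv] := wle_ex v.
suff H l l' : wfield g [:: l; l'] 1 v = 0.
  by rewrite nuE !big1 ?scaler0 ?addr0 // => i _; exact: H.
have hA := wfld_lfield g_linl g_sym l; have hB := wfld_wfield g_linl g_sym [:: l'].
rewrite wfield_cons.
rewrite (@nprodE _ _ _ _ _ _ _ _ _ _ (z + lwt l + wt2 [:: l']).+1 hA hB hv); try lia.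
rewrite big1 // => i _; rewrite wfield1 // !(lfield_pos_vac _ _ h) //.
by rewrite (lin0 (linW _ _)) (lin0 (linL _ _)) scaler0 addr0.
Qed.

Lemma wmul_comp (c c' : nat -> K) v : wmul c (wmul c' v) = wmul (fun k => c' k * c k) v.
Proof.
move: v; apply: fmono_ext_eq => [||w].
- by apply: lin_comp; exact: lin_wmul.
- exact: lin_wmul.
by rewrite !wmulM (linZ (@lin_wmul _ _ c)) wmulM scalerA.
Qed.

Definition vproj : fock T -> fock T := wmul (fun k => (k == 0%N)%:R).

Lemma vproj_vac v : exists a : K, vproj v = a *: vac0.
Proof.
have [s ->] := fockE v; rewrite /vproj fcls_sum (lin_sum (@lin_wmul _ _ _)).
elim: s => [|q s [a ih]]; first by exists 0; rewrite big_nil scale0r.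
rewrite big_cons ih (linZ (@lin_wmul _ _ _)) wmulM wt2_eq0.
case: eqP => [->|_]; first by exists (q.1 + a); rewrite scale1r scalerDl.
by exists a; rewrite scale0r scaler0 add0r.
Qed.

(** Such a vector has L_0-eigenvalue 0, and the empty word is the only one of
weight 0. *)
Lemma annihilated_vac v : (forall p x j, 0 <= j -> rmode g p x j v = 0) ->
  exists a : K, v = a *: vac0.
Proof.
move=> h; have [a E] := vproj_vac v; exists a; rewrite -E.
pose inv k : K := if k == 0%N then 0 else 2 / k%:R.
have : wmul inv (L 1 v) = v - vproj v.
  rewrite nu1_wmul wmul_comp; move: v {h E}; apply: fmono_ext_eq => [||w].
  - exact: lin_wmul.
  - by apply: lin_sub; [exact: lin_id|exact: lin_wmul].
  rewrite /vproj !wmulM /inv; case: eqP => [_|/eqP h].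
    by rewrite mulr0 scale0r scale1r subrr.
  rewrite scale0r subr0 (_ : _ * _ = 1) ?scale1r //.
  by field; rewrite !pnatr_eq0 h.
rewrite (nu1_annihilated h) (lin0 (@lin_wmul _ _ _)) => /esym/eqP.
by rewrite subr_eq0 => /eqP.
Qed.

Lemma commuting_scalar (X : fock T -> fock T) (b : bool) : lin X ->
  (forall p x j v, rmode g p x j (X v) = (-1) ^+ (p && b) *: X (rmode g p x j v)) ->
  exists a : K, X vac0 = a *: vac0.
Proof.
move=> hX h; apply: annihilated_vac => p x j j0.
by rewrite h rmode_vac // (lin0 hX) scaler0.
Qed.

(** The value of such an operator on the vacuum is a multiple of the vacuum, so it
vanishes when its weight is not 0. *)
Lemma commuting_homog_eq0 (X : fock T -> fock T) (b : bool) (d : int) : lin X ->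
  (forall p x j v, rmode g p x j (X v) = (-1) ^+ (p && b) *: X (rmode g p x j v)) ->
  spanw (fun z => z == d) (X vac0) -> d != 0 -> forall v, X v = 0.
Proof.
move=> hX h hd d0; apply: (commuting_eq0 hX _ h).
have [a ha] := commuting_scalar hX h.
have -> : X vac0 = vproj (X vac0).
  by rewrite ha /vproj (linZ (@lin_wmul _ _ _)) wmulM /wt2 big_nil eqxx scale1r.
apply: wmul_0; apply: spannedS hd => w /eqP hw.
by move: d0; rewrite -hw; case: (wt2 w).
Qed.

Lemma nu_spanw m d v : spanw (fun z => z == d) v ->
  spanw (fun z => z == d + 4 - 2 * (m + 1)) (L m v).
Proof.
have hn : spanw (fun z => z == 4) (fock_nu e).
  by apply: spanwD; apply: spanwZ; apply: spanned_sum => i; apply: spanned_mono;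
    rewrite !wt2_cons /wt2 big_nil.
move=> hv; apply: spannedS (mode_spanw g_linl g_sym (S := fun z => z == 4)
  (S' := fun z => z == d) m hn hv) => w.
by move=> /asboolP[z [z' [/eqP-> /eqP-> ->]]]; rewrite [4 + d]addrC.
Qed.

Lemma tau_spanw m d v : spanw (fun z => z == d) v ->
  spanw (fun z => z == d + 3 - 2 * (m + 1)) (G m v).
Proof.
have hn : spanw (fun z => z == 3) (fock_tau e).
  by apply: spanned_sum => i; apply: spanned_mono; rewrite !wt2_cons /wt2 big_nil.
move=> hv; apply: spannedS (mode_spanw g_linl g_sym (S := fun z => z == 3)
  (S' := fun z => z == d) m hn hv) => w.
by move=> /asboolP[z [z' [/eqP-> /eqP-> ->]]]; rewrite [3 + d]addrC.
Qed.

Lemma vac_spanw : spanw (fun z => z == 0) vac0.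
Proof. by apply: spanned_mono; rewrite /wt2 big_nil. Qed.

(** * The brackets of the structure vectors *)

(** The failures GG and GL of two of the superconformal relations (without the
central term) commute with the generators by [rmode_tau] and [rmode_nu]. *)
Definition GG r s v := G r (G s v) + G s (G r v) - 2 *: L (r + s) v.

Lemma lin_GG r s : lin (GG r s).
Proof.
apply: lin_sub; last exact/lin_scale/linM.
by apply: lin_add; apply: lin_comp; exact: linM.
Qed.

Lemma tauB x j m v : rmode g false x j (G m v) =
  j%:~R *: rmode g true x (m + j - 1) v + G m (rmode g false x j v).
Proof. by rewrite rmode_tau expr0 scale1r addr0. Qed.

Lemma tauF x j m v : rmode g true x j (G m v) =
  rmode g false x (m + j) v - G m (rmode g true x j v).
Proof. by rewrite rmode_tau expr1 scale1r scaleN1r addrK. Qed.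

Lemma nuB x j m v : rmode g false x j (L m v) =
  j%:~R *: rmode g false x (m + j - 1) v + L m (rmode g false x j v).
Proof. by rewrite rmode_nu mul0r mul0r addr0. Qed.

Lemma nuF x j m v : rmode g true x j (L m v) =
  (j%:~R + m%:~R / 2) *: rmode g true x (m + j - 1) v + L m (rmode g true x j v).
Proof. by rewrite rmode_nu mul1r. Qed.

Lemma GG_rmode r s p x j v : rmode g p x j (GG r s v) = GG r s (rmode g p x j v).
Proof.
have two : (2 : K) != 0 by rewrite pnatr_eq0.
rewrite /GG (linB (linR _ _ _)) (linD (linR _ _ _)) (linZ (linR _ _ _)).
case: p; [rewrite nuF !tauF !tauB|rewrite nuB !tauB].
  rewrite !(linB (linM _ _)).
  rewrite (_ : s + (r + j) - 1 = r + s + j - 1); last by ring.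
  rewrite (_ : r + (s + j) - 1 = r + s + j - 1); last by ring.
  by lmod K (fock T); rewrite ?rmorphD /=; field.
rewrite !(linD (linM _ _), linZ (linM _ _)) !tauF.
rewrite (_ : s + (r + j - 1) = r + s + j - 1); last by ring.
rewrite (_ : r + (s + j - 1) = r + s + j - 1); last by ring.
by lmod K (fock T); ring.
Qed.

Definition GL r m v := G r (L m v) - L m (G r v) - (r%:~R - m%:~R / 2) *: G (r + m - 1) v.

Lemma lin_GL r m : lin (GL r m).
Proof.
apply: lin_sub; last exact/lin_scale/linM.
by apply: lin_sub; apply: lin_comp; exact: linM.
Qed.

Lemma GL_rmode r m p x j v :
  rmode g p x j (GL r m v) = (-1) ^+ p *: GL r m (rmode g p x j v).
Proof.
have two : (2 : K) != 0 by rewrite pnatr_eq0.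
rewrite /GL !(linB (linR _ _ _)) (linZ (linR _ _ _)).
case: p; [rewrite !tauF !nuF !tauF|rewrite !tauB !nuB !tauB].
  rewrite !(linD (linM _ _), linZ (linM _ _), linB (linM _ _)) nuB.
  rewrite (_ : m + (r + j) - 1 = r + m - 1 + j); last by ring.
  rewrite (_ : r + (m + j - 1) = r + m - 1 + j); last by ring.
  by lmod K (fock T); rewrite ?rmorphD ?rmorphB /=; field.
rewrite !(linD (linM _ _), linZ (linM _ _)) nuF.
rewrite (_ : m + (r + j - 1) - 1 = r + m - 1 + j - 1); last by ring.
rewrite (_ : r + (m + j - 1) - 1 = r + m - 1 + j - 1); last by ring.
by lmod K (fock T); rewrite ?rmorphD ?rmorphB /=; field.
Qed.

Lemma GL_eq0 r m v : GL r m v = 0.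
Proof.
apply: (commuting_homog_eq0 (b := true) (d := 9 - 2 * (r + m + 2) - 2) (lin_GL r m)) => //.
- by move=> p x j u; rewrite GL_rmode andbT.
- have h1 := tau_spanw r (nu_spanw m vac_spanw).
  have h2 := nu_spanw m (tau_spanw r vac_spanw).
  have h3 := tau_spanw (r + m - 1) vac_spanw.
  apply: spanwD; first apply: spanwD.
  + by apply: spanw_ext h1 => z; congr (_ == _); ring.
  + by rewrite -scaleN1r; apply: spanwZ; apply: spanw_ext h2 => z; congr (_ == _); ring.
  + by rewrite -scaleN1r; do 2!apply: spanwZ; apply: spanw_ext h3 => z; congr (_ == _); ring.
- lia.
Qed.

Lemma GG_eq0 r s v : r + s != 1 -> GG r s v = 0.
Proof.
move=> rs.
apply: (commuting_homog_eq0 (b := false) (d := 2 - 2 * (r + s)) (lin_GG r s)) => //.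
- by move=> p x j u; rewrite GG_rmode andbF expr0 scale1r.
- have h1 := tau_spanw r (tau_spanw s vac_spanw).
  have h2 := tau_spanw s (tau_spanw r vac_spanw).
  have h3 := nu_spanw (r + s) vac_spanw.
  apply: spanwD; first apply: spanwD.
  + by apply: spanw_ext h1 => z; congr (_ == _); ring.
  + by apply: spanw_ext h2 => z; congr (_ == _); ring.
  + by rewrite -scaleN1r; do 2!apply: spanwZ; apply: spanw_ext h3 => z; congr (_ == _); ring.
- by move: rs; lia.
Qed.

Lemma GG_scalar r s : exists a : K, forall v, GG r s v = a *: v.
Proof.
have h p x j v : rmode g p x j (GG r s v) = (-1) ^+ (p && false) *: GG r s (rmode g p x j v).
  by rewrite GG_rmode andbF expr0 scale1r.
have [a ha] := commuting_scalar (lin_GG r s) h; exists a => v.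
apply/eqP; rewrite -subr_eq0; apply/eqP.
apply: (commuting_eq0 (X := fun v => GG r s v - a *: v) (b := false)).
- by apply: lin_sub; [exact: lin_GG|exact/lin_scale/lin_id].
- by rewrite ha subrr.
- by move=> p x j u; rewrite (linB (linR _ _ _)) (linZ (linR _ _ _)) h andbF expr0 !scale1r.
Qed.

(** [L 0] is the operator L_(-1); it acts on the generators as d/dz by
[nu_rmode]. *)
Lemma nu_translates : is_vertex_algebra (NS_data g e) /\
  (forall a, fock_mode g a (-2) vac0 = L 0 a) /\
  (forall a m v, L 0 (fock_mode g a m v) - fock_mode g a m (L 0 v) =
     (- m%:~R) *: fock_mode g a (m - 1) v).
Proof.
have h p x j v : L 0 (rmode g p x j v) - rmode g p x j (L 0 v) =
    (- j%:~R) *: rmode g p x (j - 1) v.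
  rewrite nu_rmode mulr0 mul0r addr0 add0r addrC addrA addNr add0r scaleNr; congr (- (_ *: _)).
have h0 : L 0 vac0 = 0 by rewrite nu_vac.
split; first exact: (fock_vertex_algebra g_linl g_sym (linM _ 0) h h0).
split=> [a|a m v]; first exact: (D_trans g_linl g_sym (linM _ 0) h h0).
exact: (D_mode g_linl g_sym (linM _ 0) h).
Qed.

Lemma nu_tau r m v : L m (G r v) = G r (L m v) - (r%:~R - m%:~R / 2) *: G (r + m - 1) v.
Proof.
have /eqP := GL_eq0 r m v; rewrite /GL subr_eq0 => /eqP <-.
by rewrite opprB addrC subrK.
Qed.

Lemma GG_sym r s v : GG r s v = GG s r v.
Proof. by rewrite /GG [r + s]addrC [G r _ + _]addrC. Qed.

Lemma GG_translate r s v : L 0 (GG r s v) =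
  GG r s (L 0 v) - r%:~R *: GG (r - 1) s v - s%:~R *: GG r (s - 1) v.
Proof.
have [_ [_ D]] := nu_translates.
have D' a m u : L 0 (fock_mode g a m u) =
    fock_mode g a m (L 0 u) - m%:~R *: fock_mode g a (m - 1) u.
  by rewrite -scaleNr -D addrC subrK.
rewrite /GG (linB (linM _ _)) (linD (linM _ _)) (linZ (linM _ _)).
rewrite !D' !(linB (linM _ _)) !(linZ (linM _ _)).
rewrite (_ : r - 1 + s = r + s - 1); last by ring.
rewrite (_ : r + (s - 1) = r + s - 1); last by ring.
by lmod K (fock T); rewrite ?rmorphD /=; ring.
Qed.

Lemma tau2_tau : G 2 (fock_tau e) = n%:R *: vac0.
Proof.
rewrite {2}/fock_tau (lin_sum (linM _ _)).
rewrite (eq_bigr (fun=> vac0)) => [|i _].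
  by rewrite sumr_const card_ord scaler_nat.
rewrite -!fcreateM -!(rmode_neg g) (_ : Negz 0 = -1) //.
have tB x j m v : G m (rmode g false x j v) =
    rmode g false x j (G m v) - j%:~R *: rmode g true x (m + j - 1) v.
  by rewrite tauB addrC addrA addNr add0r.
have tF x j m v : G m (rmode g true x j v) =
    rmode g false x (m + j) v - rmode g true x j (G m v).
  by rewrite tauF opprB addrC subrK.
rewrite tB tF rmode_vac // tau_vac // (lin0 (linR _ _ _)) subrr (lin0 (linR _ _ _)) sub0r.
rewrite rmode_bracket // (_ : 2 - 1 - 1 = 0 :> int) // rmode_vac // (lin0 (linR _ _ _)).
by rewrite scaler0 addr0 e_orth eqxx /cbr /= mulr1 scale1r scaleN1r opprK.
Qed.

(** The central term: translation covariance determines it from its value on the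
lowest modes. *)
Lemma GG_central r v : GG r (1 - r) v = (n%:R * (r%:~R * (r%:~R - 1)) / 2) *: v.
Proof.
have [f hf] := choice (fun r => GG_scalar r (1 - r)).
rewrite hf; congr (_ *: _).
have inj (a b : K) : a *: vac0 = b *: vac0 -> a = b.
  move=> /eqP; rewrite -subr_eq0 -scalerBl scaler_eq0 (negPf (vac_neq0 (T := T))) orbF.
  by rewrite subr_eq0 => /eqP.
have two : (2 : K) != 0 by rewrite pnatr_eq0.
(* the bracket with L_(-1) relates consecutive values of f *)
have rec s : s%:~R * f (s - 1) + (2 - s)%:~R * f s = 0.
  apply: inj; have := GG_translate s (2 - s) vac0.
  have h u : GG s (2 - s) u = 0 by apply: GG_eq0; lia.
  rewrite !h (lin0 (linM _ _)) sub0r.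
  rewrite (_ : 2 - s - 1 = 1 - s); last by ring.
  rewrite {1}(_ : 2 - s = 1 - (s - 1)); last by ring.
  rewrite !hf scale0r => /eqP; rewrite eq_sym -opprD oppr_eq0 => /eqP <-.
  by rewrite scalerDl !scalerA.
have fsym s : f (1 - s) = f s.
  by apply: inj; rewrite -!hf GG_sym (_ : 1 - (1 - s) = s) //; ring.
have f2 : f 2 = n%:R.
  apply: inj; rewrite -hf /GG (_ : 1 - 2 = -1) // (mode_creation g_linl g_sym _).1.
  by rewrite tau2_tau tau_vac // nu_vac // (lin0 (linM _ _)) scaler0 subr0 addr0.
have fnat (k : nat) : f k%:Z = n%:R * (k%:R * (k%:R - 1)) / 2.
  elim: k => [|[|[|k]] ih].
  - have := rec 0; rewrite mul0r add0r subr0 => /eqP.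
    by rewrite mulf_eq0 (negPf two) /= => /eqP ->; rewrite mul0r mulr0 mul0r.
  - have := rec 1; rewrite ih subrr mul0r mulr0 mul0r mulr0 add0r mul1r => ->.
    by ring.
  - by rewrite f2; field.
  - have := rec k.+3%:Z; rewrite (_ : k.+3%:Z - 1 = k.+2%:Z) ?ih; last lia.
    rewrite (_ : 2 - k.+3%:Z = - k.+1%:Z); last lia.
    have k1 : k.+1%:R != 0 :> K by rewrite pnatr_eq0.
    rewrite rmorphN /= => /eqP; rewrite mulNr subr_eq0 => /eqP h.
    apply: (mulfI k1); rewrite -[LHS]h.
    have e3 : k.+3%:R = k%:R + 3 :> K by rewrite -addn3 natrD.
    have e2' : k.+2%:R = k%:R + 2 :> K by rewrite -addn2 natrD.
    have e1 : k.+1%:R = k%:R + 1 :> K by rewrite -addn1 natrD.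
    by rewrite -[k.+3%:~R]/(k.+3%:R) e3 e2' e1; field.
case: r => k; first exact: fnat.
rewrite -fsym (_ : 1 - Negz k = k.+2%:Z) ?fnat; last lia.
rewrite NegzE rmorphN /=.
have e2' : k.+2%:R = k%:R + 2 :> K by rewrite -addn2 natrD.
have e1 : k.+1%:~R = k%:R + 1 :> K by rewrite -addn1 PoszD rmorphD.
by rewrite e2' e1; field.
Qed.

Lemma tau_tau r s v : G r (G s v) + G s (G r v) = 2 *: L (r + s) v +
  (if r + s == 1 then (n%:R * (r%:~R * (r%:~R - 1)) / 2) *: v else 0).
Proof.
have -> : G r (G s v) + G s (G r v) = 2 *: L (r + s) v + GG r s v.
  by rewrite /GG [RHS]addrC subrK.
congr (_ + _); case: eqP => [rs|/eqP rs]; last exact: GG_eq0.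
by rewrite -GG_central; congr GG; rewrite -rs addrC addrA addNr add0r.
Qed.

(** The Virasoro relations follow from those with tau, since L_n is half an
anticommutator of modes of tau up to a scalar. *)
Lemma nu_nu a b v : L a (L b v) - L b (L a v) = (a - b)%:~R *: L (a + b - 1) v +
  (if a + b == 2 then
     (n%:R * (a%:~R * (b%:~R * (b%:~R - 1))) / 8) *: v else 0).
Proof.
have two : (2 : K) != 0 by rewrite pnatr_eq0.
have Lb u : L b u = 2^-1 *: (G 0 (G b u) + G b (G 0 u)).
  have h0 : n%:R * (0%:~R * (0%:~R - 1)) / 2 = 0 :> K by rewrite mulr0z !(mul0r, mulr0).
  by rewrite tau_tau h0 scale0r if_same addr0 add0r scalerA mulVf ?scale1r.
have t1 := tau_tau (a - 1) b v; have t2 := tau_tau 0 (b + a - 1) v.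
rewrite (Lb v) (Lb (L a v)) (linZ (linM _ _)) (linD (linM _ _)) !nu_tau.
rewrite !(linB (linM _ _)) !(linZ (linM _ _)).
rewrite (_ : 0 + a - 1 = a - 1); last by ring.
have E1 : G (a - 1) (G b v) = 2 *: L (a - 1 + b) v +
  (if a - 1 + b == 1 then (n%:R * ((a - 1)%:~R * ((a - 1)%:~R - 1)) / 2) *: v else 0)
  - G b (G (a - 1) v) by rewrite -t1 addrK.
have E2 : G 0 (G (b + a - 1) v) = 2 *: L (0 + (b + a - 1)) v +
  (if 0 + (b + a - 1) == 1 then (n%:R * (0%:~R * (0%:~R - 1)) / 2) *: v else 0)
  - G (b + a - 1) (G 0 v) by rewrite -t2 addrK.
rewrite E1 E2 (_ : 0 + (b + a - 1) = a + b - 1); last by ring.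
rewrite (_ : a - 1 + b = a + b - 1); last by ring.
rewrite (_ : (a + b - 1 == 1) = (a + b == 2)); last by lia.
case: eqP => ab.
  have aE : a%:~R = 2 - b%:~R :> K.
    by rewrite (_ : a = 2 - b) ?rmorphB //; move: ab; lia.
  by lmod K (fock T); rewrite ?rmorphD ?rmorphN /= ?aE ?mulr0z; field.
by lmod K (fock T); rewrite ?rmorphD ?rmorphB /= ?mulr0z; field.
Qed.

Lemma nu1_diagonalizable : diagonalizable_op (L 1).
Proof.
move=> v; have [s ->] := fockE v.
exists (size s), (fun i => (nth (0, [::]) s i).1 *: fmono (nth (0, [::]) s i).2),
  (fun i => (wt2 (nth (0, [::]) s i).2)%:R / 2); split=> [i|].
  by rewrite (linZ (linM _ _)) nu1_word !scalerA mulrC.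
rewrite fcls_sum (big_nth (0, [::])) big_mkord.
by [].
Qed.

Theorem fock_N1SCVA : is_N1SCVA (NS_data g e) (3 / 2 * n%:R).
Proof.
have two : (2 : K) != 0 by rewrite pnatr_eq0.
have [va [tr _]] := nu_translates.
split; first split.
- exact: va.
- suff: spanned (fun w => wodd w == false) (fock_nu e) by [].
  by apply: spannedD; apply: spannedZ; apply: spanned_sum => i; exact: spanned_mono.
- move=> a b v; rewrite /vir /= nu_nu.
  rewrite (_ : a + 1 + (b + 1) - 1 = a + b + 1); last by ring.
  rewrite (_ : a + 1 - (b + 1) = a - b); last by ring.
  rewrite (_ : (a + 1 + (b + 1) == 2) = (a + b == 0)); last by lia.
  congr (_ + _); case: eqP => // ab; congr (_ *: _).
  rewrite (_ : b = - a); last by move: ab; lia.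
  by rewrite rmorphB rmorphXn !rmorphD rmorphN /=; field.
- by move=> v; rewrite /vir /trans /= tr.
- exact: nu1_diagonalizable.
- suff: spanned (fun w => wodd w == true) (fock_tau e) by [].
  by apply: spanned_sum => i; exact: spanned_mono.
- move=> r s v; rewrite /smode /vir /half_of /= tau_tau.
  rewrite (_ : r + s - 1 + 1 = r + s); last by ring.
  congr (_ + _); case: eqP => // _; congr (_ *: _); by field.
move=> r m v; rewrite /smode /vir /half_of /= nu_tau opprB addrC subrK.
rewrite (_ : r + (m + 1) - 1 = r + m); last by ring.
congr (_ *: _); rewrite rmorphD /=; by field.
Qed.

End Superconformal.

(** * Functoriality in the inner product space *)

Section FockMapIso.
Context {K : numFieldType} {T T' : lmodType K}.
Variables (g : T -> T -> K) (g' : T' -> T' -> K) (h : {linear T -> T'}).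
Hypothesis g_linl : forall (a : K) x y z, g (a *: x + y) z = a * g x z + g y z.
Hypothesis g_sym : forall x y, g x y = g y x.
Hypothesis g'_linl : forall (a : K) x y z, g' (a *: x + y) z = a * g' x z + g' y z.
Hypothesis g'_sym : forall x y, g' x y = g' y x.
Hypothesis h_isom : forall x y, g' (h x) (h y) = g x y.
Implicit Types (l : letter T) (w : fword T) (u v : fock T) (x y : T) (p : bool).

Definition lmap l : letter T' := (l.1, h l.2).

Lemma lin_fock_map : lin (fock_map h).
Proof. exact: fock_map_linear. Qed.

Lemma fock_mapM w : fock_map h (fmono w) = fmono (map lmap w).
Proof.
apply: fock_extM; have [ml sw] := @fmono_super_multilinear K T'.
split=> [u p k a x y w'|u l l' w']; rewrite !map_cat /=; last exact: sw.
by rewrite linearP; exact: ml.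
Qed.

Lemma wt2_lmap w : wt2 (map lmap w) = wt2 w.
Proof. by elim: w => [|l w ih]; [rewrite /wt2 !big_nil|rewrite /= !wt2_cons ih]. Qed.

Lemma fock_map_spanned (P : pred (fword T')) (Q : pred (fword T)) v :
  (forall w, Q w -> P (map lmap w)) -> spanned Q v -> spanned P (fock_map h v).
Proof.
move=> PQ [s [-> hs]]; exists [seq (q.1, map lmap q.2) | q <- s]; split.
  rewrite !fcls_sum big_map (lin_sum lin_fock_map); apply: eq_bigr => q _.
  by rewrite (linZ lin_fock_map) fock_mapM.
by rewrite all_map; apply: sub_all hs => q; exact: PQ.
Qed.

Lemma fock_map_create l v : fock_map h (fcreate l v) = fcreate (lmap l) (fock_map h v).
Proof.
move: v; apply: fmono_ext_eq => [||w].
- by apply: lin_comp; [exact: lin_fock_map|exact: lin_create].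
- by apply: lin_comp; [exact: lin_create|exact: lin_fock_map].
by rewrite fcreateM !fock_mapM fcreateM.
Qed.

Lemma fock_map_contract l v :
  fock_map h (fcontract g l v) = fcontract g' (lmap l) (fock_map h v).
Proof.
have lc := lin_contract g_linl g_sym; have lc' := lin_contract g'_linl g'_sym.
move: v; apply: fmono_ext_eq => [||w].
- by apply: lin_comp; [exact: lin_fock_map|exact: lc].
- by apply: lin_comp; [exact: lc'|exact: lin_fock_map].
rewrite fock_mapM !contractM //; elim: w => [|l' w ih].
  by rewrite (lin0 lin_fock_map).
rewrite [map _ _]/= !dcon_cons (linD lin_fock_map) !(linZ lin_fock_map) fock_mapM.
by rewrite fock_map_create ih /lpair /= h_isom.
Qed.

Lemma fock_map_rmode p x n v :
  fock_map h (rmode g p x n v) = rmode g' p (h x) n (fock_map h v).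
Proof.
case: n => n; last by rewrite !rmode_neg fock_map_create.
rewrite /rmode; case: p => /=; first exact: fock_map_contract.
case: n => [|n]; first exact: (lin0 lin_fock_map).
by rewrite (linZ lin_fock_map) fock_map_contract.
Qed.

Lemma fock_map_lfield l n v :
  fock_map h (lfield g l n v) = lfield g' (lmap l) n (fock_map h v).
Proof.
case: l => [[p k] x]; rewrite lfieldE (linZ lin_fock_map) fock_map_rmode.
by rewrite [lmap _]/= lfieldE.
Qed.

Lemma fock_map_wfield w n v :
  fock_map h (wfield g w n v) = wfield g' (map lmap w) n (fock_map h v).
Proof.
elim: w n v => [|l w ih] n v.
  by rewrite /=; case: eqP => // _; exact: (lin0 lin_fock_map).
have hA := wfld_lfield g_linl g_sym l; have hB := wfld_wfield g_linl g_sym w.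
have hA' := wfld_lfield g'_linl g'_sym (lmap l).
have hB' := wfld_wfield g'_linl g'_sym (map lmap w).
have [z hv] := wle_ex v.
have hv' : wle z%:Z (fock_map h v).
  by apply: fock_map_spanned hv => w'; rewrite wt2_lmap.
pose M := (z + lwt l + wt2 w + absz n)%N.
rewrite [map _ _]/= !wfield_cons (@nprodE _ _ _ _ _ _ _ _ _ _ M hA hB hv);
  try by rewrite /M; lia.
rewrite (@nprodE _ _ _ _ _ _ _ _ _ _ M hA' hB' hv');
  try by rewrite /M ?wt2_lmap /lwt /lodd /=; case: ifP; lia.
rewrite (lin_sum lin_fock_map) !wodd_wt2 wt2_lmap; apply: eq_bigr => i _.
rewrite (linD lin_fock_map) (linZ lin_fock_map).
by rewrite fock_map_lfield !ih fock_map_lfield.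
Qed.

Lemma fock_map_mode a n v :
  fock_map h (fock_mode g a n v) = fock_mode g' (fock_map h a) n (fock_map h v).
Proof.
have lm := lin_model g_linl g_sym n v; have lm' := lin_model g'_linl g'_sym n (fock_map h v).
move: a; apply: fmono_ext_eq => [||w].
- by apply: lin_comp; [exact: lin_fock_map|exact: lm].
- by apply: (lin_comp lm'); exact: lin_fock_map.
by rewrite fock_mapM !fock_mode_mono // fock_map_wfield.
Qed.

Section Frames.
Variables (n : nat) (e : 'I_n -> T) (e' : 'I_n -> T') (O : 'M[K]_n).
Hypothesis e'E : forall a, e' a = \sum_b O a b *: h (e b).
Hypothesis O_orth : O^T *m O = 1%:M.

(** The change of basis enters only through O^T O, by bilinearity.  The structure
vectors are built from sums of this form. *)
Lemma casimir_frame p k q k' :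
  \sum_a fmono [:: (p, k, e' a); (q, k', e' a)] =
  \sum_b fmono [:: (p, k, h (e b)); (q, k', h (e b))] :> fock T'.
Proof.
have [ml _] := @fmono_super_multilinear K T'.
pose F (x y : T') : fock T' := fmono [:: (p, k, x); (q, k', y)].
have F1 (y : T') : lin (F^~ y) by move=> a x x'; exact: (ml [::]).
have F2 (x : T') : lin (F x) by move=> a y y'; exact: (ml [:: _]).
transitivity (\sum_b \sum_c \sum_a (O a b * O a c) *: F (h (e b)) (h (e c))).
  under eq_bigr => a _.
    rewrite -/(F (e' a) (e' a)) {1}e'E (lin_sum (F1 _)).
    under eq_bigr => b _ do
      rewrite (linZ (F1 _)) e'E (lin_sum (F2 _)) scaler_sumr.
    over.
  rewrite exchange_big; apply: eq_bigr => b _ /=.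
  rewrite exchange_big; apply: eq_bigr => c _ /=; apply: eq_bigr => a _.
  by rewrite (linZ (F2 _)) scalerA.
apply: eq_bigr => b _; rewrite (bigD1 b) //= -scaler_suml.
have E c : \sum_a O a b * O a c = (b == c)%:R.
  have := congr1 (fun A : 'M[K]_n => A b c) O_orth; rewrite !mxE => <-.
  by apply: eq_bigr => a _; rewrite mxE.
rewrite E eqxx scale1r big1 ?addr0 // => c cb.
by rewrite -scaler_suml E eq_sym (negPf cb) scale0r.
Qed.

Lemma fock_map_casimir p k q k' :
  fock_map h (\sum_a fmono [:: (p, k, e a); (q, k', e a)]) =
  \sum_a fmono [:: (p, k, e' a); (q, k', e' a)].
Proof.
rewrite casimir_frame (lin_sum lin_fock_map).
by apply: eq_bigr => b _; rewrite fock_mapM.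
Qed.

Lemma fock_map_nu : fock_map h (fock_nu e) = fock_nu e'.
Proof.
by rewrite /fock_nu (linD lin_fock_map) !(linZ lin_fock_map) !fock_map_casimir.
Qed.

Lemma fock_map_tau : fock_map h (fock_tau e) = fock_tau e'.
Proof. exact: fock_map_casimir. Qed.

End Frames.

End FockMapIso.

Section FockMapFunctor.
Context {K : numFieldType} {T T' : lmodType K}.

Lemma fock_mapK (h : {linear T -> T'}) (k : {linear T' -> T}) :
  cancel h k -> cancel (fock_map h) (fock_map k).
Proof.
move=> hk; apply: (fmono_ext_eq (h := id)) => [||w].
- by apply: lin_comp; exact: lin_fock_map.
- exact: lin_id.
rewrite !fock_mapM -map_comp; congr fmono.
by elim: w => [//|[l x] w ih] /=; rewrite ih /lmap /= hk.
Qed.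

Lemma fock_map_gr (h : {linear T -> T'}) p v : fock_gr p v -> fock_gr p (fock_map h v).
Proof.
have H w : (wodd w == p) -> (wodd (map (lmap h) w) == p).
  by rewrite !wodd_wt2 wt2_lmap.
exact: (fock_map_spanned (P := fun w => wodd w == p) (Q := fun w => wodd w == p) H).
Qed.

Lemma fock_map_le (h : {linear T -> T'}) N v : fock_le N v -> fock_le N (fock_map h v).
Proof.
have H w : (wt2 w <= N)%N -> (wt2 (map (lmap h) w) <= N)%N by rewrite wt2_lmap.
exact: (fock_map_spanned (P := fun w => (wt2 w <= N)%N)
  (Q := fun w => (wt2 w <= N)%N) H).
Qed.

End FockMapFunctor.

Lemma fock_map_iso (K : numFieldType) (T T' : lmodType K) (g : T -> T -> K) (g' : T' -> T' -> K)
    (h : {linear T -> T'}) (k : {linear T' -> T})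
    (n : nat) (e : 'I_n -> T) (e' : 'I_n -> T') (O : 'M[K]_n) :
  (forall (a : K) x y z, g (a *: x + y) z = a * g x z + g y z) ->
  (forall x y, g x y = g y x) ->
  (forall (a : K) x y z, g' (a *: x + y) z = a * g' x z + g' y z) ->
  (forall x y, g' x y = g' y x) ->
  (forall x y, g' (h x) (h y) = g x y) -> cancel h k -> cancel k h ->
  (forall a, e' a = \sum_b O a b *: h (e b)) -> O^T *m O = 1%:M ->
  scva_iso (NS_data g e) (NS_data g' e') (fock_map h).
Proof.
move=> g1 g2 g1' g2' hg hk kh eO OO; split.
- exact: lin_fock_map.
- by exists (fock_map k); [exact: fock_mapK hk|exact: fock_mapK kh].
- move=> p v; split; first exact: fock_map_gr.
  by move=> /(fock_map_gr k); rewrite (fock_mapK hk).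
- exact: fock_mapM.
- by move=> a m b; exact: fock_map_mode.
- exact: fock_map_nu eO OO.
- exact: fock_map_tau eO OO.
Qed.

(** * Smooth functions on open sets *)

Section NearDifferentiable.
Context {R : realType} {V W : normedModType R}.

Lemma near_eq_differentiable (f h : V -> W) (x : V) :
  (\near x, f x = h x) -> differentiable f x -> differentiable h x.
Proof.
move=> fh df; pose k := h - f.
have kx : k x = 0 by rewrite /k !fctE (nbhs_singleton fh) subrr.
have ko : k \o shift x = cst (k x) + (\0 : {linear V -> W}) +o_ 0 id.
  apply/eqaddoP => _ /posnumP[e].
  have : \forall y \near (0 : V), f (y + x) = h (y + x).
    by move: fh; rewrite (near_shift 0 x) subr0.
  apply: filterS => y fhy; rewrite !fctE /= kx /k !fctE fhy subrr addr0 subr0 normr0.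
  by rewrite mulr_ge0.
have c0 : continuous (\0 : {linear V -> W}) by move=> y; exact: cst_continuous.
have dk : differentiable k x.
  by apply/diff_locallyP; rewrite (diff_unique c0 ko).
by rewrite (_ : h = f + k); [exact: differentiableD|rewrite /k addrC subrK].
Qed.

End NearDifferentiable.

Section SmoothOn.
Context {R : realType} {n : nat}.

Lemma open_near_eq (T : Type) (U : set 'rV[R]_n) (f h : 'rV[R]_n -> T) x :
  open U -> U x -> (forall y, U y -> f y = h y) -> \near x, f x = h x.
Proof.
by move=> oU Ux fh; near=> y; apply: fh; near: y; exact: open_nbhs_nbhs.
Unshelve. all: by end_near. Qed.

Lemma smooth_upto_ext (W : normedModType R) k (U : set 'rV[R]_n) (f h : 'rV[R]_n -> W) :
  open U -> (forall y, U y -> f y = h y) -> smooth_upto k U f -> smooth_upto k U h.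
Proof.
move=> oU; elim: k f h => [|k ih] f h fh /=.
  move=> cf x Ux; have nfh := open_near_eq oU Ux fh.
  rewrite /prop_for /continuous_at -(fh _ Ux); apply: cvg_trans (cf x Ux).
  exact: near_eq_cvg nfh.
move=> [df Df]; split=> [x Ux|v].
  by apply: near_eq_differentiable (df x Ux); exact: open_near_eq fh.
by apply: ih (Df v) => x Ux; apply: near_eq_derive; exact: open_near_eq fh.
Qed.

Lemma smooth_on_ext (W : normedModType R) (U : set 'rV[R]_n) (f h : 'rV[R]_n -> W) :
  open U -> (forall y, U y -> f y = h y) -> smooth_on U f -> smooth_on U h.
Proof. by move=> oU fh sf k; apply: smooth_upto_ext (sf k). Qed.

Lemma smooth_uptoW (W : normedModType R) k (U : set 'rV[R]_n) (f : 'rV[R]_n -> W) :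
  smooth_upto k.+1 U f -> smooth_upto k U f.
Proof.
elim: k f => [|k ih] f /=.
  by move=> [df _] x Ux; apply: differentiable_continuous; exact: df.
by move=> [df Df]; split=> // v; apply: ih; exact: Df.
Qed.

Lemma smooth_upto_cst (W : normedModType R) k (U : set 'rV[R]_n) (a : W) :
  smooth_upto k U (cst a).
Proof.
elim: k a => [|k ih] a /=; first by move=> x _; exact: cst_continuous.
split=> [x _|v]; first exact: differentiable_cst.
rewrite (_ : (fun x => _) = cst 0); first exact: ih.
by apply/funext => x; rewrite derive_cst.
Qed.

Variable U : set 'rV[R]_n.
Hypothesis oU : open U.
Implicit Types f h : 'rV[R]_n -> R^o.

Lemma smooth_uptoD (W : normedModType R) k (f h : 'rV[R]_n -> W) :
  smooth_upto k U f -> smooth_upto k U h -> smooth_upto k U (f \+ h).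
Proof.
elim: k f h => [|k ih] f h /=.
  by move=> cf ch x Ux; apply: continuousD; [exact: cf|exact: ch].
move=> [df Df] [dh Dh]; split=> [x Ux|v].
  by apply: differentiableD; [exact: df|exact: dh].
apply: smooth_upto_ext (ih _ _ (Df v) (Dh v)) => // x Ux /=.
by rewrite deriveD //; apply: diff_derivable; [exact: df|exact: dh].
Qed.

Lemma smooth_uptoM k f h :
  smooth_upto k U f -> smooth_upto k U h -> smooth_upto k U (f \* h : _ -> R^o).
Proof.
elim: k f h => [|k ih] f h.
  by move=> cf ch x Ux; apply: continuousM; [exact: cf|exact: ch].
move=> sf sh; have [df Df] := sf; have [dh Dh] := sh; split=> [x Ux|v].
  by apply: differentiableM; [exact: df|exact: dh].
apply: smooth_upto_ext (smooth_uptoD (ih _ _ (smooth_uptoW sf) (Dh v))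
  (ih _ _ (smooth_uptoW sh) (Df v))) => // x Ux /=.
by rewrite deriveM //; apply: diff_derivable; [exact: df|exact: dh].
Qed.

Definition rsqrt (t : R) : R^o := (Num.sqrt t)^-1.

Lemma differentiable_rsqrt (t : R) : 0 < t -> differentiable (rsqrt : R^o -> R^o) t.
Proof.
move=> t0; apply: differentiableV; last by rewrite gt_eqF // sqrtr_gt0.
by apply/derivable1_diffP; apply: ex_derive; exact: is_derive1_sqrt.
Qed.

Lemma derive_rsqrt (t : R) : 0 < t ->
  'D_1 (rsqrt : R^o -> R^o) t = - 2^-1 * (rsqrt t * (rsqrt t * rsqrt t)).
Proof.
move=> t0; have s0 : Num.sqrt t != 0 by rewrite gt_eqF // sqrtr_gt0.
have ds := is_derive1_sqrt t0.
rewrite /rsqrt deriveV // derive_val /=.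
by rewrite /GRing.scale /=; field.
Qed.

(** By induction on the order of differentiability, since the derivative of
t^(-1/2) is -1/2 times the cube of t^(-1/2) itself. *)
Lemma smooth_upto_rsqrt k f : (forall x, U x -> 0 < f x) ->
  smooth_upto k U f -> smooth_upto k U (fun x => rsqrt (f x)).
Proof.
move=> f0; elim: k => [|k ih].
  move=> cf x Ux; apply: (continuous_comp (cf x Ux)).
  by apply: differentiable_continuous; apply: differentiable_rsqrt; exact: f0.
move=> sf; have [df Df] := sf; have sr := ih (smooth_uptoW sf).
have dr x : U x -> differentiable (rsqrt : R^o -> R^o) (f x).
  by move=> Ux; apply: differentiable_rsqrt; exact: f0.
split=> [x Ux|v].
  by apply: (differentiable_comp (df x Ux) (dr x Ux)).
have s3 := smooth_uptoM (smooth_uptoM (smooth_upto_cst k U (- 2^-1 : R^o))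
  (smooth_uptoM sr (smooth_uptoM sr sr))) (Df v).
apply: smooth_upto_ext s3 => // x Ux /=.
have dc : differentiable (rsqrt \o f) x := differentiable_comp (df x Ux) (dr x Ux).
rewrite [RHS](deriveE _ dc) (diff_comp (df x Ux) (dr x Ux)) /=.
rewrite -(deriveE v (df x Ux)).
rewrite [X in 'd _ _ X](_ : _ = 'D_v f x *: (1 : R^o)); last by rewrite [RHS]mulr1.
rewrite linearZ /= -(deriveE (1 : R^o) (dr x Ux)) derive_rsqrt ?f0 //.
by rewrite [RHS]mulrC.
Qed.

Lemma diff_coord m (y w : 'rV[R]_m) b :
  'd (fun N : 'rV[R]_m => N 0 b : R^o) y w = w 0 b.
Proof.
have @f : {linear 'rV[R]_m -> R^o}.
  by exists (fun N : 'rV[R]_m => N 0 b); do 2![eexists]; do ?[constructor];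
     rewrite ?mxE// => ? *; rewrite ?mxE//; move=> ?; rewrite !mxE.
rewrite (_ : (fun _ => _) = f) // diff_lin //; exact: coord_continuous.
Qed.

Lemma derive_coord m (h : 'rV[R]_n -> 'rV[R]_m) b x v : differentiable h x ->
  'D_v (fun x => h x 0 b : R^o) x = ('D_v h x) 0 b.
Proof.
move=> dhx.
have dc : differentiable (fun N : 'rV[R]_m => N 0 b : R^o) (h x).
  exact: differentiable_coord.
rewrite [LHS](deriveE _ (differentiable_comp dhx dc)) (diff_comp dhx dc) /=.
by rewrite -(deriveE v dhx) diff_coord.
Qed.

(** The chain rule, in coordinates of the intermediate space. *)
Lemma smooth_upto_comp m k (V : set 'rV[R]_m) (f : 'rV[R]_m -> R^o)
    (h : 'rV[R]_n -> 'rV[R]_m) : (forall x, U x -> V (h x)) ->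
  (forall k b, smooth_upto k U (fun x => h x 0 b : R^o)) -> smooth_upto 1 U h ->
  smooth_upto k V f -> smooth_upto k U (f \o h).
Proof.
move=> UV sh [dh Dh]; elim: k f => [|k ih] f.
  move=> cf x Ux; apply: continuous_comp; last exact/cf/UV.
  by apply: differentiable_continuous; exact: dh.
move=> [df Df]; split=> [x Ux|v].
  by apply: differentiable_comp; [exact: dh|exact/df/UV].
pose t b : 'rV[R]_n -> R^o :=
  (fun x => 'D_v (fun x => h x 0 b : R^o) x) \* ((fun y => 'D_(delta_mx 0 b) f y) \o h).
have st : smooth_upto k U (fun x => \sum_b t b x).
  elim: (index_enum _) => [|b r ihr].
    rewrite (_ : (fun x => _) = cst 0); first exact: smooth_upto_cst.
    by apply/funext => x; rewrite big_nil.
  rewrite (_ : (fun x => _) = t b \+ (fun x => \sum_(b <- r) t b x)); last first.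
    by apply/funext => x; rewrite big_cons.
  apply: smooth_uptoD ihr; apply: smooth_uptoM; last exact/ih/Df.
  by have [_ /(_ v)] := sh k.+1 b.
apply: smooth_upto_ext st => // x Ux.
have dhx := dh x Ux; have dfx := df _ (UV _ Ux).
rewrite [RHS](deriveE _ (differentiable_comp dhx dfx)) (diff_comp dhx dfx) /=.
rewrite -(deriveE v dhx) [X in 'd _ _ X]row_sum_delta linear_sum.
apply: eq_bigr => b _; rewrite linearZ /= -(deriveE _ dfx) /t /=; congr (_ *: _).
by rewrite (derive_coord _ _ dhx) (deriveE v dhx).
Qed.

Lemma smooth_upto_coord m k (h : 'rV[R]_n -> 'rV[R]_m) b :
  smooth_upto k U h -> smooth_upto k U (fun x => h x 0 b : R^o).
Proof.
elim: k h => [|k ih] h.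
  move=> ch x Ux.
  apply: (@continuous_comp _ _ _ h (fun N : 'rV[R]_m => N 0 b : R^o) x (ch x Ux)).
  exact: coord_continuous.
move=> [dh Dh]; split=> [x Ux|v].
  apply: (differentiable_comp (g := fun N : 'rV[R]_m => N 0 b : R^o) (dh x Ux)).
  exact: differentiable_coord.
apply: smooth_upto_ext (ih _ (Dh v)) => // x Ux.
by rewrite derive_coord //; exact: dh.
Qed.

End SmoothOn.

(** * Orthonormalization *)

(** Gram-Schmidt, for a matrix of functions from any class closed under the
operations it uses. *)
Section GramSchmidt.
Context {R : realType} {X : Type}.
Variables (U : set X) (A : (X -> R) -> Prop).
Hypothesis A_cst : forall a : R, A (fun=> a).
Hypothesis A_add : forall f h, A f -> A h -> A (fun x => f x + h x).
Hypothesis A_mul : forall f h, A f -> A h -> A (fun x => f x * h x).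
Hypothesis A_rsqrt : forall f, A f -> (forall x, U x -> 0 < f x) ->
  A (fun x => rsqrt (f x)).

Definition mclass m n (F : X -> 'M[R]_(m, n)) : Prop := forall a b, A (fun x => F x a b).

Lemma A_sum (I : Type) (r : seq I) (F : I -> X -> R) :
  (forall i, A (F i)) -> A (fun x => \sum_(i <- r) F i x).
Proof.
move=> hF; elim: r => [|i r ih].
  by rewrite (_ : (fun x => _) = fun=> 0) //; apply/funext => x; rewrite big_nil.
rewrite (_ : (fun x => _) = fun x => F i x + \sum_(i <- r) F i x); first exact: A_add.
by apply/funext => x; rewrite big_cons.
Qed.

Lemma mclass_mul m n p (F : X -> 'M[R]_(m, n)) (H : X -> 'M[R]_(n, p)) :
  mclass F -> mclass H -> mclass (fun x => F x *m H x).
Proof.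
move=> hF hH a b.
rewrite (_ : (fun x => _) = fun x => \sum_c F x a c * H x c b).
  by apply: A_sum => c; exact: A_mul.
by apply/funext => x; rewrite mxE.
Qed.

Lemma mclass_tr m n (F : X -> 'M[R]_(m, n)) : mclass F -> mclass (fun x => (F x)^T).
Proof.
move=> hF a b; rewrite (_ : (fun x => _) = fun x => F x b a) //.
by apply/funext => x; rewrite mxE.
Qed.

Lemma mclass_scale m n f (F : X -> 'M[R]_(m, n)) :
  A f -> mclass F -> mclass (fun x => f x *: F x).
Proof.
move=> hf hF a b; rewrite (_ : (fun x => _) = fun x => f x * F x a b); first exact: A_mul.
by apply/funext => x; rewrite mxE.
Qed.

Lemma mclass_add m n (F H : X -> 'M[R]_(m, n)) :
  mclass F -> mclass H -> mclass (fun x => F x + H x).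
Proof.
move=> hF hH a b; rewrite (_ : (fun x => _) = fun x => F x a b + H x a b); first exact: A_add.
by apply/funext => x; rewrite mxE.
Qed.

(** Block elimination: the first basis vector is normalized, the others are made
orthogonal to it, and their Gram matrix is the Schur complement, which is again
symmetric and positive. *)
Lemma gram_schmidt n (G : X -> 'M[R]_n) : mclass G ->
  (forall x, U x -> (G x)^T = G x) ->
  (forall x, U x -> forall v : 'rV[R]_n, v != 0 -> 0 < (v *m G x *m v^T) 0 0) ->
  exists C : X -> 'M[R]_n, mclass C /\
    forall x, U x -> C x *m G x *m (C x)^T = 1%:M.
Proof.
elim: n G => [|n ih] G hG Gsym Gpos.
  by exists (fun=> 1%:M); split=> [[]//|x _]; apply/matrixP => -[].
pose a x : R := @ulsubmx _ 1 n 1 n (G x) 0 0.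
pose b x : 'rV[R]_n := @ursubmx _ 1 n 1 n (G x).
pose D x : 'M[R]_n := @drsubmx _ 1 n 1 n (G x).
pose r x : R := rsqrt (a x).
have GE x : U x -> G x = block_mx (a x)%:M (b x) (b x)^T (D x) :> 'M[R]_(1 + n).
  move=> Ux; rewrite -[LHS](@submxK _ 1 n 1 n); congr block_mx.
    by apply/matrixP => i j; rewrite !ord1 [RHS]mxE eqxx mulr1n.
  by rewrite -{1}(Gsym x Ux) trmx_ursub.
pose G' x : 'M[R]_(1 + n) := block_mx (a x)%:M (b x) (b x)^T (D x).
have Gpos' x (v : 'rV[R]_(1 + n)) : U x -> v != 0 -> 0 < (v *m G' x *m v^T) 0 0.
  by move=> Ux v0; rewrite /G' -(GE x Ux); exact: Gpos.
have Gsym' x : U x -> (G' x)^T = G' x by move=> Ux; rewrite /G' -(GE x Ux); exact: Gsym.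
have a0 x : U x -> 0 < a x.
  move=> Ux; have := Gpos' x (row_mx 1%:M 0) Ux.
  rewrite mul_row_block tr_row_mx mul_row_col !trmx0 !mulmx0 !mul0mx !addr0.
  rewrite trmx1 mul1mx mulmx1 mxE eqxx mulr1n; apply.
  by apply/eqP => /(congr1 (@lsubmx _ 1 1 n)); rewrite row_mxKl linear0 => /matrixP/(_ 0 0);
    rewrite !mxE => /eqP; rewrite oner_eq0.
have ra x : U x -> r x * r x * a x = 1.
  move=> Ux; rewrite /r /rsqrt -expr2 exprVn sqr_sqrtr ?ltW ?a0 //.
  by rewrite mulVf // gt_eqF ?a0.
have ha : A a.
  rewrite (_ : a = fun x => G x (@lshift 1 n 0) (@lshift 1 n 0)); first exact: hG.
  by apply/funext => x; rewrite /a !mxE.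
have hr : A r by exact: A_rsqrt.
have hb : mclass b.
  move=> i j; rewrite (_ : (fun x => _) = fun x => G x (@lshift 1 n i) (@rshift 1 n j)).
    exact: hG.
  by apply/funext => x; rewrite /b !mxE.
have hD : mclass D.
  move=> i j; rewrite (_ : (fun x => _) = fun x => G x (@rshift 1 n i) (@rshift 1 n j)).
    exact: hG.
  by apply/funext => x; rewrite /D !mxE.
have hbT := mclass_tr hb.
pose S x := D x - (r x * r x) *: ((b x)^T *m b x).
have hS : mclass S.
  rewrite (_ : S = fun x => D x + (-1 * (r x * r x)) *: ((b x)^T *m b x)).
    apply: mclass_add => //; apply: mclass_scale; last exact: mclass_mul.
    by apply: A_mul => //; exact: A_mul.
  by apply/funext => x; rewrite mulN1r scaleNr.
have Ssym x : U x -> (S x)^T = S x.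
  move=> Ux; rewrite /S linearB /= linearZ /= trmx_mul trmxK; congr (_ - _).
  by have := Gsym' x Ux; rewrite tr_block_mx => /eq_block_mx[].
have Spos x : U x -> forall v : 'rV[R]_n, v != 0 -> 0 < (v *m S x *m v^T) 0 0.
  move=> Ux v v0.
  pose u : 'M[R]_1 := - (r x * r x) *: (v *m (b x)^T).
  have := Gpos' x (row_mx u v) Ux.
  rewrite mul_row_block tr_row_mx mul_row_col.
  rewrite (_ : u *m (a x)%:M + v *m (b x)^T = 0); last first.
    rewrite mul_mx_scalar /u scalerA mulrN [a x * _]mulrC ra // scaleN1r addNr //.
  rewrite (_ : u *m b x + v *m D x = v *m S x); last first.
    by rewrite /u -scalemxAl -mulmxA scaleNr addrC /S mulmxBr scalemxAr.
  rewrite mul0mx add0r; apply; apply/eqP => /(congr1 (@rsubmx _ 1 1 n)).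
  by rewrite row_mxKr linear0; exact/eqP.
have [C' [hC' C'E]] := ih S hS Ssym Spos.
pose w x : 'cV[R]_n := - (r x * r x) *: (C' x *m (b x)^T).
pose C x : 'M[R]_(1 + n) := block_mx (r x)%:M 0 (w x) (C' x).
have hC : mclass C.
  have hw : mclass w.
    rewrite (_ : w = fun x => (-1 * (r x * r x)) *: (C' x *m (b x)^T)).
      apply: mclass_scale; last exact: mclass_mul.
      by apply: A_mul => //; exact: A_mul.
    by apply/funext => x; rewrite mulN1r.
  move=> i j; case: (@split_ordP 1 n i) => i' ->; case: (@split_ordP 1 n j) => j' ->.
  - rewrite (_ : (fun x => _) = r) //; apply/funext => x.
    by rewrite block_mxEul !ord1 mxE eqxx mulr1n.
  - rewrite (_ : (fun x => _) = fun=> 0) //; apply/funext => x.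
    by rewrite block_mxEur mxE.
  - rewrite (_ : (fun x => _) = fun x => w x i' j') //; apply/funext => x.
    by rewrite block_mxEdl.
  - rewrite (_ : (fun x => _) = fun x => C' x i' j') //; apply/funext => x.
    by rewrite block_mxEdr.
exists C; split=> [|x Ux]; first exact: hC.
rewrite GE //; suff : C x *m G' x *m (C x)^T = 1%:M by [].
rewrite mulmx_block tr_block_mx mulmx_block !trmx0 !mul0mx !mulmx0 !addr0.
rewrite (_ : w x *m (a x)%:M + C' x *m (b x)^T = 0); last first.
  by rewrite mul_mx_scalar /w scalerA mulrN [a x * _]mulrC ra // scaleN1r addNr.
rewrite (_ : w x *m b x + C' x *m D x = C' x *m S x); last first.
  by rewrite /w -scalemxAl -mulmxA scaleNr addrC /S mulmxBr scalemxAr.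
rewrite !mul0mx !add0r C'E // tr_scalar_mx -!scalar_mxM mulrAC ra //.
rewrite (_ : (r x * a x)%:M *m (w x)^T + (r x)%:M *m b x *m (C' x)^T = 0).
  by rewrite -scalar_mx_block.
rewrite /w !mul_scalar_mx linearZ /= trmx_mul trmxK -scalemxAl scalerA -scalerDl.
rewrite (_ : r x * a x * - (r x * r x) + r x = 0) ?scale0r //.
by rewrite -[X in _ + X]mul1r -(ra x Ux); ring.
Qed.

End GramSchmidt.

(** * Smooth functions and tangent vectors on a manifold *)

Section ManifoldSmooth.
Context {R : realType} {n : nat} {M : manifold R n}.
Implicit Types (i j k : chart M) (U : set M).

Lemma chart_image_open i U : open U -> open (cmap i @` (U `&` cdom i)).
Proof.
move=> oU; rewrite openE => _ [x [Ux dx] <-].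
have [cx ex] := cmapK dx.
have nU : \forall y \near cmap i x, U (cinv i y).
  apply: (cinv_cont cx); apply: open_nbhs_nbhs; split; last by rewrite ex.
  exact: oU.
have nc : \forall y \near cmap i x, ccod i y.
  by apply: open_nbhs_nbhs; split=> //; exact: ccod_open.
near=> y.
have cy : ccod i y by near: y.
have [dy ey] := cinvK cy.
by exists (cinv i y) => //; split=> //; near: y.
Unshelve. all: by end_near. Qed.

Lemma msmooth_ext U (f h : M -> R) : open U -> (forall x, U x -> f x = h x) ->
  msmooth U f -> msmooth U h.
Proof.
move=> oU fh sf i; apply: smooth_on_ext (sf i); first exact: chart_image_open.
by move=> _ [x [Ux dx] <-] /=; rewrite (cmapK dx).2; exact: fh.
Qed.

Lemma msmoothS U U' (f : M -> R) : U' `<=` U -> msmooth U f -> msmooth U' f.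
Proof.
by move=> sU sf i; apply: smooth_onS (sf i); apply: image_subset; exact: setSI.
Qed.

Lemma msmooth_cst U (a : R) : msmooth U (fun=> a).
Proof. by move=> i k; exact: (smooth_upto_cst _ _ (a : R^o)). Qed.

Lemma msmoothD U (f h : M -> R) : open U ->
  msmooth U f -> msmooth U h -> msmooth U (fun x => f x + h x).
Proof.
by move=> oU sf sh i k; exact: (smooth_uptoD (chart_image_open oU) (sf i k) (sh i k)).
Qed.

Lemma msmoothM U (f h : M -> R) : open U ->
  msmooth U f -> msmooth U h -> msmooth U (fun x => f x * h x).
Proof.
by move=> oU sf sh i k; exact: (smooth_uptoM (chart_image_open oU) (sf i k) (sh i k)).
Qed.

Lemma msmooth_rsqrt U (f : M -> R) : open U -> msmooth U f ->
  (forall x, U x -> 0 < f x) -> msmooth U (fun x => rsqrt (f x)).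
Proof.
move=> oU sf f0 i k; apply: (smooth_upto_rsqrt (chart_image_open oU) _ (sf i k)).
by move=> _ [x [Ux dx] <-] /=; rewrite (cmapK dx).2; exact: f0.
Qed.

(** Smoothness is tested in charts, so U may be cut down to a chart domain. *)
Lemma msmooth_local U (f : M -> R) : (forall i, msmooth (U `&` cdom i) f) -> msmooth U f.
Proof.
move=> h i; have := h i i; rewrite (_ : U `&` cdom i `&` cdom i = U `&` cdom i) //.
by rewrite -setIA setIid.
Qed.

Definition jac i j (x : M) : 'M[R]_n := jacobian (cmap j \o cinv i) (cmap i x).

Lemma ctrans_diff i j x : cdom i x -> cdom j x ->
  differentiable (cmap j \o cinv i) (cmap i x).
Proof. by move=> dx dx'; have [h _] := @ctrans_smooth _ _ M i j 1%N; apply: h; exists x. Qed.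

Lemma tmoveE i j x v : cdom i x -> cdom j x -> tmove i j x v = v *m jac i j x.
Proof. by move=> dx dx'; rewrite /tmove deriveEjacobian //; exact: ctrans_diff. Qed.

Lemma mulmx_rV_inj m p (A B : 'M[R]_(m, p)) : (forall v : 'rV_m, v *m A = v *m B) -> A = B.
Proof. by move=> h; apply/row_matrixP => a; rewrite !rowE. Qed.

Lemma jac_comp i j k x : cdom i x -> cdom j x -> cdom k x ->
  jac i j x *m jac j k x = jac i k x.
Proof.
move=> di dj dk; apply: mulmx_rV_inj => v.
rewrite mulmxA -[X in X *m _](tmoveE v di dj) -[LHS](tmoveE _ dj dk).
rewrite -[RHS](tmoveE v di dk) /tmove.
have ej : (cmap j \o cinv i) (cmap i x) = cmap j x by rewrite /= (cmapK di).2.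
have d1 := ctrans_diff di dj; have d2 := ctrans_diff dj dk.
rewrite -ej in d2 *.
rewrite (deriveE _ d1) (deriveE _ d2).
rewrite -[LHS]/(('d (cmap k \o cinv j) ((cmap j \o cinv i) (cmap i x)) \o
  'd (cmap j \o cinv i) (cmap i x)) v) -(diff_comp d1 d2).
rewrite -(deriveE _ (differentiable_comp d1 d2)); apply: near_eq_derive.
apply: (@open_near_eq _ _ _ (cmap i @` (cdom j `&` cdom i))).
- by apply: chart_image_open; exact: cdom_open.
- by exists x.
by move=> _ [y [dj' di'] <-] /=; rewrite (cmapK di').2 (cmapK dj').2.
Qed.

Lemma jac_id i x : cdom i x -> jac i i x = 1%:M.
Proof.
move=> di; apply: mulmx_rV_inj => v; rewrite -tmoveE // mulmx1 /tmove.
rewrite -[RHS](derive_id (cmap i x) v); apply: near_eq_derive.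
apply: (@open_near_eq _ _ _ (cmap i @` (setT `&` cdom i))).
- by apply: chart_image_open; exact: openT.
- by exists x.
by move=> _ [y [_ di'] <-] /=; rewrite (cmapK di').2.
Qed.

Lemma pchartP (x : M) : cdom (pchart x) x.
Proof. exact: (projT2 (cid (cdom_cover x))). Qed.

Lemma jac_smooth i j a b : msmooth (cdom i `&` cdom j) (fun x => jac i j x a b).
Proof.
have oij : open (cdom i `&` cdom j) by apply: openI; exact: cdom_open.
pose F := cmap j \o cinv i.
pose V := cmap i @` (cdom i `&` cdom j).
have oV : open V.
  rewrite (_ : V = cmap i @` (cdom j `&` cdom i)); last by rewrite /V setIC.
  by apply: chart_image_open; exact: cdom_open.
have sF : smooth_on V F by exact: ctrans_smooth.
have sD (d : nat) : smooth_upto d V (fun y => ('D_(delta_mx 0 a) F y) 0 b : R^o).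
  by apply: smooth_upto_coord => //; have [_] := sF d.+1; apply.
move=> k; pose W := cmap k @` (cdom i `&` cdom j `&` cdom k).
have oW : open W by exact: chart_image_open.
have sW : W `<=` cmap k @` (cdom k `&` cdom i).
  by move=> _ [x [[di dj] dk] <-]; exists x.
have sH := smooth_onS sW (@ctrans_smooth _ _ M k i).
move=> d.
have H : smooth_upto d W ((fun y => ('D_(delta_mx 0 a) F y) 0 b : R^o) \o (cmap i \o cinv k)).
  apply: (smooth_upto_comp oW (V := V)) => //.
  - by move=> _ [x [[di dj] dk] <-] /=; exists x; rewrite // (cmapK dk).2.
  - by move=> d' c; apply: smooth_upto_coord.
apply: smooth_upto_ext H => // _ [x [[di dj] dk] <-] /=.
rewrite (cmapK dk).2 -[LHS]/(tmove i j x (delta_mx 0 a) 0 b) tmoveE //.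
by rewrite -rowE mxE.
Qed.

End ManifoldSmooth.

Section Frames.
Context {R : realType} {n : nat} {M : manifold R n} (g : riemannian_metric M).
Implicit Types (i j : chart M) (U : set M) (e : local_frame g).

Definition msmooth_mx U p q (F : M -> 'M[R]_(p, q)) : Prop :=
  mclass (msmooth U) F.

Lemma msmooth_mx_mul U p q r (F : M -> 'M[R]_(p, q)) (H : M -> 'M[R]_(q, r)) :
  open U -> msmooth_mx U F -> msmooth_mx U H -> msmooth_mx U (fun x => F x *m H x).
Proof.
move=> oU; apply: mclass_mul; first exact: msmooth_cst.
- by move=> *; exact: msmoothD.
- by move=> *; exact: msmoothM.
Qed.

Lemma msmooth_mx_ext U p q (F H : M -> 'M[R]_(p, q)) : open U ->
  (forall x, U x -> F x = H x) -> msmooth_mx U F -> msmooth_mx U H.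
Proof. by move=> oU FH sF a b; apply: msmooth_ext (sF a b) => // x Ux; rewrite FH. Qed.

Lemma msmooth_mxS U U' p q (F : M -> 'M[R]_(p, q)) : U' `<=` U ->
  msmooth_mx U F -> msmooth_mx U' F.
Proof. by move=> sU sF a b; exact: msmoothS (sF a b). Qed.

(** The rows of [cpart i x] are the coordinate vector fields of the chart i. *)
Definition cpart i (x : M) : 'M[R]_n := jac i (pchart x) x.

Lemma gram_chart_smooth i :
  msmooth_mx (cdom i) (fun x => cpart i x *m gram g x *m (cpart i x)^T).
Proof.
move=> a b; apply: msmooth_ext (gram_smooth g i a b); first exact: cdom_open.
move=> x di; rewrite /tpartial !tmoveE //; try exact: pchartP.
rewrite -/(cpart i x) trmx_mul trmx_delta !mulmxA -colE -!mulmxA -rowE.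
by rewrite [LHS]mxE [LHS]mxE.
Qed.

Lemma lframe_chart_smooth e i :
  msmooth_mx (ldom e `&` cdom i) (fun x => lframe e x *m jac (pchart x) i x).
Proof.
have oU : open (ldom e `&` cdom i) by apply: openI; [exact: ldom_open|exact: cdom_open].
move=> a b; apply: msmooth_ext (lframe_smooth e i a b) => // x [_ di].
by rewrite /tcoord tmoveE //; [rewrite -row_mul mxE|exact: pchartP].
Qed.

Lemma gram_change (L Q P G L' : 'M[R]_n) : Q *m P = 1%:M ->
  L *m Q *m (P *m G *m P^T) *m (L' *m Q)^T = L *m G *m L'^T.
Proof.
move=> QP; rewrite trmx_mul !mulmxA -(mulmxA L) QP mulmx1 -!mulmxA; do 2!congr (_ *m _).
by rewrite mulmxA -trmx_mul QP trmx1 mul1mx.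
Qed.

Definition frame_change e e' (x : M) : 'M[R]_n := lframe e x *m gram g x *m (lframe e' x)^T.

(** In the coordinates of any chart the frames and the metric are smooth, and the
Jacobians of the coordinate change at x cancel. *)
Lemma frame_change_smooth e e' : msmooth_mx (ldom e `&` ldom e') (frame_change e e').
Proof.
move=> a b; apply: msmooth_local => i; move: a b.
have oU : open (ldom e `&` ldom e' `&` cdom i).
  by apply: openI; [apply: openI; exact: ldom_open|exact: cdom_open].
have s1 : msmooth_mx (ldom e `&` ldom e' `&` cdom i)
    (fun x => lframe e x *m jac (pchart x) i x).
  by apply: msmooth_mxS (@lframe_chart_smooth _ i) => x [[]].
have s2 : msmooth_mx (ldom e `&` ldom e' `&` cdom i)
    (fun x => (lframe e' x *m jac (pchart x) i x)^T).
  by apply: mclass_tr; apply: msmooth_mxS (@lframe_chart_smooth _ i) => x [[]].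
have s3 : msmooth_mx (ldom e `&` ldom e' `&` cdom i)
    (fun x => cpart i x *m gram g x *m (cpart i x)^T).
  by apply: msmooth_mxS (@gram_chart_smooth i) => x [].
apply: msmooth_mx_ext (msmooth_mx_mul oU (msmooth_mx_mul oU s1 s3) s2) => // x [[_ _] di].
have E : jac (pchart x) i x *m jac i (pchart x) x = 1%:M.
  by rewrite jac_comp ?jac_id //; exact: pchartP.
exact: gram_change E.
Qed.

Lemma exists_orthonormal_frame (x : M) : exists A, orthonormal_frame g x A.
Proof.
have [] := @gram_schmidt R M (fun y => y = x) (fun=> True) _ _ _ _ n (gram g) => //.
- by move=> y _; exact: gram_sym.
- by move=> y _ v v0; exact: gram_pos.
by move=> C [_ /(_ x erefl) h]; exists (C x).
Qed.

Lemma some_frameP (x : M) : orthonormal_frame g x (some_frame g x).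
Proof. by have [A hA] := exists_orthonormal_frame x; exact: xgetPex (ex_intro _ A hA). Qed.

(** Orthonormalizing the coordinate vector fields of a chart. *)
Lemma exists_local_frame (x : M) : exists e : local_frame g, ldom e x.
Proof.
pose i := pchart x; have oi : open (cdom i) := cdom_open i.
pose G y := cpart i y *m gram g y *m (cpart i y)^T.
have inv y : cdom i y -> cpart i y *m jac (pchart y) i y = 1%:M.
  by move=> di; rewrite /cpart jac_comp ?jac_id //; exact: pchartP.
have Gsym y : cdom i y -> (G y)^T = G y.
  by move=> _; rewrite /G !trmx_mul trmxK gram_sym mulmxA.
have Gpos y : cdom i y -> forall v : 'rV[R]_n, v != 0 -> 0 < (v *m G y *m v^T) 0 0.
  move=> di v v0; rewrite /G !mulmxA.
  have := @gram_pos _ _ _ g y (v *m cpart i y); rewrite trmx_mul !mulmxA; apply.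
  by apply: contraNN v0 => /eqP h; rewrite -[v]mulmx1 -(inv y di) mulmxA h mul0mx.
have [C [sC CE]] := @gram_schmidt R M (cdom i) (msmooth (cdom i)) (msmooth_cst _)
  (fun _ _ => msmoothD oi) (fun _ _ => msmoothM oi) (fun _ => msmooth_rsqrt oi) n G
  (@gram_chart_smooth i) Gsym Gpos.
have orth y : cdom i y -> orthonormal_frame g y (C y *m cpart i y).
  by move=> di; rewrite /orthonormal_frame trmx_mul -(CE y di) /G !mulmxA.
have smth j a b : msmooth (cdom i `&` cdom j)
    (fun y => (tcoord j (row a (C y *m cpart i y) : tspace y)) 0 b).
  have oij : open (cdom i `&` cdom j) by apply: openI => //; exact: cdom_open.
  have s1 : msmooth_mx (cdom i `&` cdom j) (fun y => C y *m jac i j y).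
    apply: msmooth_mx_mul => //; first by apply: msmooth_mxS sC => y [].
    by move=> ? ?; exact: jac_smooth.
  apply: msmooth_ext (s1 a b) => // y [di dj].
  rewrite /tcoord tmoveE //; last exact: pchartP.
  have E : cpart i y *m jac (pchart y) j y = jac i j y.
    by apply: jac_comp => //; exact: pchartP.
  by rewrite -row_mul [RHS]mxE -mulmxA E.
exists (LocalFrame oi orth smth); exact: pchartP.
Qed.

End Frames.

(** * Inner product spaces with orthonormal bases *)

Definition mform (K : numFieldType) (n : nat) (G : 'M[K]_n) (u v : 'rV[K]_n) : K :=
  (u *m G *m v^T) 0 0.

Section Forms.
Context {K : numFieldType} {n : nat}.
Implicit Types G A B : 'M[K]_n.

Lemma mform_linl G (a : K) x y z :
  mform G (a *: x + y) z = a * mform G x z + mform G y z.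
Proof. by rewrite /mform !mulmxDl -!scalemxAl !mxE. Qed.

Lemma mform_sym G x y : G^T = G -> mform G x y = mform G y x.
Proof.
move=> Gs; have -> : mform G x y = (x *m G *m y^T)^T 0 0 by rewrite mxE.
by rewrite !trmx_mul trmxK Gs mulmxA.
Qed.

Lemma mform_row G A i j : mform G (row i A) (row j A) = (A *m G *m A^T) i j.
Proof.
rewrite /mform -row_mul [LHS]mxE [RHS]mxE; apply: eq_bigr => k _.
by rewrite [row _ _ _ _]mxE [_^T k 0]mxE [row _ _ _ _]mxE [_^T k j]mxE.
Qed.

Lemma mform_span G A x : G *m A^T *m A = 1%:M ->
  x = \sum_i mform G x (row i A) *: row i A.
Proof.
move=> h; rewrite -[LHS]mulmx1 -h !mulmxA [LHS]mulmx_sum_row.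
apply: eq_bigr => i _; congr (_ *: _).
by rewrite /mform [LHS]mxE [RHS]mxE; apply: eq_bigr => k _; rewrite !mxE.
Qed.

Lemma orth_inv G A : A *m G *m A^T = 1%:M -> G *m A^T *m A = 1%:M.
Proof. by rewrite -mulmxA => /mulmx1C. Qed.

Lemma form_N1SCVA G A : G^T = G -> A *m G *m A^T = 1%:M ->
  is_N1SCVA (NS_data (mform G) (fun a => row a A)) (3 / 2 * n%:R).
Proof.
move=> Gs AG; apply: fock_N1SCVA.
- by move=> *; exact: mform_linl.
- by move=> *; exact: mform_sym.
- by move=> i j; rewrite mform_row AG mxE.
- by move=> x; apply: mform_span; exact: orth_inv.
Qed.

(** The frames A and A' enter only through the structure vectors; A B and A' are
both orthonormal bases of the second space, related by the matrix O. *)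
Lemma form_iso G A G' A' B B' : G^T = G -> G'^T = G' ->
  A *m G *m A^T = 1%:M -> A' *m G' *m A'^T = 1%:M ->
  B *m B' = 1%:M -> B *m G' *m B^T = G ->
  scva_iso (NS_data (mform G) (fun a => row a A))
    (NS_data (mform G') (fun a => row a A')) (fock_map (mulmxr B)).
Proof.
move=> Gs Gs' AG AG' BB' BG; have B'B := mulmx1C BB'.
have GAA := orth_inv AG.
pose O := A' *m B' *m G *m A^T.
have OAB : O *m (A *m B) = A'.
  rewrite /O mulmxA -(mulmxA (A' *m B')) -(mulmxA (A' *m B')) GAA mulmx1.
  by rewrite -mulmxA B'B mulmx1.
apply: (fock_map_iso (k := mulmxr B') (O := O)).
- by move=> *; exact: mform_linl.
- by move=> *; exact: mform_sym.
- by move=> *; exact: mform_linl.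
- by move=> *; exact: mform_sym.
- by move=> x y /=; rewrite /mform -BG trmx_mul !mulmxA; exact: erefl.
- by move=> x /=; rewrite -mulmxA BB' mulmx1.
- by move=> x /=; rewrite -mulmxA B'B mulmx1.
- move=> a; rewrite -{1}OAB row_mul mulmx_sum_row; apply: eq_bigr => b _.
  by rewrite mxE row_mul.
apply: mulmx1C; rewrite /O !trmx_mul trmxK Gs.
have AAG : A^T *m A *m G = 1%:M.
  by apply: mulmx1C; rewrite mulmxA.
rewrite !mulmxA -(mulmxA (A' *m B' *m G)) -(mulmxA (A' *m B' *m G)) AAG mulmx1.
rewrite -BG !mulmxA -(mulmxA A') B'B mulmx1 -(mulmxA _ B^T) -trmx_mul B'B trmx1 mulmx1.
exact: AG'.
Qed.

End Forms.

Lemma fock_map_comp (K : numFieldType) (T T' T'' : lmodType K) (h : {linear T -> T'})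
    (k : {linear T' -> T''}) (f : {linear T -> T''}) :
  (forall x, k (h x) = f x) -> forall v, fock_map k (fock_map h v) = fock_map f v.
Proof.
move=> khf; apply: fmono_ext_eq => [||w].
- by apply: lin_comp; exact: lin_fock_map.
- exact: lin_fock_map.
rewrite !fock_mapM -map_comp; congr fmono.
by elim: w => [//|[l x] w ih] /=; rewrite ih /lmap /= khf.
Qed.

(** * Smooth maps into vector spaces *)

Section VectorSmooth.
Context {R : realType} {n : nat} {M : manifold R n}.
Implicit Types (U : set M).
Local Notation C := R[i].

Lemma mcsmooth_cst U (a : C) : mcsmooth U (fun=> a).
Proof. by split; exact: msmooth_cst. Qed.

Lemma mcsmoothD U (f h : M -> C) : open U ->
  mcsmooth U f -> mcsmooth U h -> mcsmooth U (fun x => f x + h x).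
Proof.
move=> oU [f1 f2] [h1 h2]; split.
  apply: msmooth_ext (msmoothD oU f1 h1) => // x _.
  by case: (f x) (h x) => [? ?] [].
apply: msmooth_ext (msmoothD oU f2 h2) => // x _.
by case: (f x) (h x) => [? ?] [].
Qed.

Lemma mcsmoothM U (f h : M -> C) : open U ->
  mcsmooth U f -> mcsmooth U h -> mcsmooth U (fun x => f x * h x).
Proof.
move=> oU [f1 f2] [h1 h2]; split.
  apply: msmooth_ext (msmoothD oU (msmoothM oU f1 h1)
    (msmoothM oU (msmooth_cst U (-1)) (msmoothM oU f2 h2))) => // x _.
  by case: (f x) (h x) => [a b] [c d] /=; rewrite mulN1r.
apply: msmooth_ext (msmoothD oU (msmoothM oU f1 h2) (msmoothM oU f2 h1)) => // x _.
by case: (f x) (h x) => [a b] [c d] /=; rewrite addrC.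
Qed.

Lemma mcsmooth_sum U (I : Type) (r : seq I) (f : I -> M -> C) : open U ->
  (forall i, mcsmooth U (f i)) -> mcsmooth U (fun x => \sum_(i <- r) f i x).
Proof.
move=> oU hf; elim: r => [|i r ih].
  rewrite (_ : (fun x => _) = fun=> 0); first exact: mcsmooth_cst.
  by apply/funext => x; rewrite big_nil.
rewrite (_ : (fun x => _) = fun x => f i x + \sum_(i <- r) f i x).
  exact: mcsmoothD.
by apply/funext => x; rewrite big_cons.
Qed.

Lemma mcsmooth_real U (f : M -> R) : msmooth U f -> mcsmooth U (fun x => (f x)%:C%C).
Proof. by move=> sf; split=> //; exact: msmooth_cst. Qed.

Lemma vsmooth_ext (V : lmodType C) U (h h' : M -> V) :
  vsmooth U h -> (forall x, U x -> h x = h' x) -> vsmooth U h'.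
Proof.
move=> sh hh x0 Ux0; have [S [oS Sx0 [m [f [v [hf hE]]]]]] := sh x0 Ux0.
exists S; split=> //; exists m, f, v; split=> // x Sx Ux.
by rewrite -hh // hE.
Qed.

Lemma vsmooth_cst (V : lmodType C) U (v : V) : vsmooth U (fun=> v).
Proof.
move=> x0 _; exists setT; split=> //; first exact: openT.
exists 1%N, (fun _ => fun=> 1), (fun=> v); split=> [i|x _ _]; first exact: mcsmooth_cst.
by rewrite big_ord1 scale1r.
Qed.

Lemma vsmooth_scale (V : lmodType C) U (f : M -> C) (h : M -> V) : open U ->
  mcsmooth U f -> vsmooth U h -> vsmooth U (fun x => f x *: h x).
Proof.
move=> oU sf sh x0 Ux0; have [S [oS Sx0 [m [f' [v [hf hE]]]]]] := sh x0 Ux0.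
exists S; split=> //; exists m, (fun i x => f x * f' i x), v; split=> [i|x Sx Ux].
  apply: mcsmoothM => //; first exact: openI.
  by apply: mcsmoothS sf => x [].
by rewrite hE // scaler_sumr; apply: eq_bigr => i _; rewrite scalerA.
Qed.

Lemma vsmooth_sum (V : lmodType C) U (I : Type) (r : seq I) (h : I -> M -> V) :
  (forall i, vsmooth U (h i)) -> vsmooth U (fun x => \sum_(i <- r) h i x).
Proof.
move=> hs; elim: r => [|i r ih].
  have H := @vsmooth_cst V U 0.
by apply: (vsmooth_ext H) => x _; rewrite big_nil.
have H := vsmooth_lin 1 (hs i) ih.
by apply: (vsmooth_ext H) => x _; rewrite big_cons scale1r.
Qed.

Lemma vsmooth_map (V V' : lmodType C) U (f : V -> V') (h : M -> V) : lin f ->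
  vsmooth U h -> vsmooth U (fun x => f (h x)).
Proof.
move=> hf sh x0 Ux0; have [S [oS Sx0 [m [f' [v [sf hE]]]]]] := sh x0 Ux0.
exists S; split=> //; exists m, f', (fun i => f (v i)); split=> // x Sx Ux.
by rewrite hE // (lin_sum hf); apply: eq_bigr => i _; rewrite (linZ hf).
Qed.

Lemma vsmooth_local (V : lmodType C) U (h : M -> V) :
  (forall x0, U x0 -> exists S, [/\ open S, S x0 & vsmooth (S `&` U) h]) -> vsmooth U h.
Proof.
move=> H x0 Ux0; have [S [oS Sx0 sh]] := H x0 Ux0.
have [S' [oS' Sx0' [m [f [v [sf hE]]]]]] := sh x0 (conj Sx0 Ux0).
exists (S' `&` S); split=> //; first exact: openI.
by exists m, f, v; rewrite -setIA; split=> // x [S'x Sx] Ux; exact: hE.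
Qed.

Lemma vsmooth_bilin (V : lmodType C) U (B : V -> V -> V) (h h' : M -> V) : open U ->
  (forall v, lin (fun u => B u v)) -> (forall u, lin (B u)) ->
  vsmooth U h -> vsmooth U h' -> vsmooth U (fun x => B (h x) (h' x)).
Proof.
move=> oU B1 B2 sh sh'; apply: vsmooth_local => x0 Ux0.
have [S [oS Sx0 [m [f [v [sf hE]]]]]] := sh x0 Ux0.
exists S; split=> //.
have H : vsmooth (S `&` U) (fun x => \sum_i f i x *: B (v i) (h' x)).
  apply: vsmooth_sum => i; apply: vsmooth_scale => //; first exact: openI.
  apply: vsmooth_map => // y0 [Sy0 Uy0].
  have [S' [oS' Sy0' [m' [f' [v' [sf' hE']]]]]] := sh' y0 Uy0.
  exists S'; split=> //; exists m', f', v'; split=> [j|x S'x [_ Ux]]; last exact: hE'.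
  by apply: mcsmoothS (sf' j) => x [S'x [_ Ux]].
apply: (vsmooth_ext H) => x [Sx Ux]; rewrite hE // (lin_sum (B1 _)).
by apply: eq_bigr => i _; rewrite (linZ (B1 _)).
Qed.

(** On each word the image is a finite combination of fixed words, with
coefficients polynomial in the entries of O x. *)
Lemma vsmooth_fock_map p (O : M -> 'M[C]_(p, p)) U : open U ->
  (forall a b, mcsmooth U (fun x => O x a b)) ->
  forall v : fock 'rV[C]_p, vsmooth U (fun x => fock_map (mulmxr (O x) : {linear 'rV[C]_p -> 'rV[C]_p}) v).
Proof.
move=> oU sO v; have [s ->] := fockE v.
have lf x := lin_fock_map (mulmxr (O x) : {linear 'rV[C]_p -> 'rV[C]_p}).
have sw w : vsmooth U (fun x => fock_map (mulmxr (O x) : {linear 'rV[C]_p -> 'rV[C]_p}) (fmono w)).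
  elim: w => [|[l y] w ih].
    have H := @vsmooth_cst _ U (@fmono C 'rV[C]_p [::]).
    by apply: (vsmooth_ext H) => x _; rewrite fock_mapM.
  have H : vsmooth U (fun x => \sum_b (y *m O x) 0 b *:
      fcreate (l, delta_mx 0 b) (fock_map (mulmxr (O x) : {linear 'rV[C]_p -> 'rV[C]_p}) (fmono w))).
    apply: vsmooth_sum => b; apply: vsmooth_scale => //.
      rewrite (_ : (fun x => _) = fun x => \sum_c y 0 c * O x c b).
        apply: mcsmooth_sum => // c; apply: mcsmoothM => //; exact: mcsmooth_cst.
      by apply/funext => x; rewrite mxE.
    by apply: vsmooth_map ih; exact: lin_create.
  apply: (vsmooth_ext H) => x _; rewrite -fcreateM fock_map_create.
  rewrite /lmap /= [X in _ = fcreate (l, X) _]row_sum_delta.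
  have lc u : lin (fun z : 'rV[C]_p => fcreate (l, z) u).
    by case: (l) => p' k a z z'; exact: fcreate_vec.
  by rewrite (lin_sum (lc _)); apply: eq_bigr => b _; rewrite (linZ (lc _)).
have H : vsmooth U (fun x => \sum_(q <- s)
    q.1 *: fock_map (mulmxr (O x) : {linear 'rV[C]_p -> 'rV[C]_p}) (fmono q.2)).
  apply: vsmooth_sum => q; apply: vsmooth_scale => //; exact: mcsmooth_cst.
apply: (vsmooth_ext H) => x _; rewrite [in RHS]fcls_sum (lin_sum (lf x)).
by apply: eq_bigr => q _; rewrite (linZ (lf x)).
Qed.

End VectorSmooth.

(** * The bundle *)

Section Fibers.
Context {R : realType} {n : nat} {M : manifold R n} (g : riemannian_metric M).
Local Notation C := R[i].
Local Notation cx := complexify.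

Lemma complexifyM (A B : 'M[R]_n) : cx (A *m B) = cx A *m cx B.
Proof. exact: map_mxM. Qed.

Lemma complexifyT (A : 'M[R]_n) : cx A^T = (cx A)^T.
Proof. by rewrite /complexify map_trmx. Qed.

Lemma complexify1 : cx (1%:M : 'M[R]_n) = 1%:M.
Proof. exact: map_mx1. Qed.

Lemma model_dataE : NS_model_data R n = NS_data (mform 1%:M) (fun a => row a 1%:M).
Proof.
rewrite /NS_model_data (_ : @std_form R n = mform 1%:M); last first.
  by apply/funext => u; apply/funext => v; rewrite /std_form /mform mulmx1.
by rewrite (_ : (fun a => delta_mx 0 a) = fun a => row a 1%:M) //; apply/funext => a; rewrite row1.
Qed.

Lemma fiber_dataE x : NS_fiber_data g x =
  NS_data (mform (cx (gram g x))) (fun a => row a (cx (some_frame g x))).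
Proof. by []. Qed.

Lemma cgram_sym x : (cx (gram g x))^T = cx (gram g x).
Proof. by rewrite -complexifyT gram_sym. Qed.

Lemma cframe_orth x A : orthonormal_frame g x A -> cx A *m cx (gram g x) *m (cx A)^T = 1%:M.
Proof. by move=> h; rewrite -complexifyT -!complexifyM h complexify1. Qed.

Lemma mx1_orth : (1%:M : 'M[C]_n) *m 1%:M *m 1%:M^T = 1%:M.
Proof. by rewrite trmx1 !mulmx1. Qed.

Lemma model_N1SCVA : is_N1SCVA (NS_model_data R n) (3 / 2 * n%:R).
Proof. by rewrite model_dataE; apply: form_N1SCVA; [exact: trmx1|exact: mx1_orth]. Qed.

Lemma fiber_N1SCVA x : is_N1SCVA (NS_fiber_data g x) (3 / 2 * n%:R).
Proof.
rewrite fiber_dataE; apply: form_N1SCVA; first exact: cgram_sym.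
by apply: cframe_orth; exact: some_frameP.
Qed.

(** The matrix of an orthonormal frame is an isometry from the standard complex
inner product space to the complexified tangent space. *)
Lemma frame_iso (e : local_frame g) x : ldom e x ->
  scva_iso (NS_model_data R n) (NS_fiber_data g x) (triv (b := NS_bundle g) e x).
Proof.
move=> ex; have := cframe_orth (lframe_orth ex) => oe.
rewrite model_dataE fiber_dataE.
apply: (form_iso (B' := cx (gram g x) *m (cx (lframe e x))^T)).
- exact: trmx1.
- exact: cgram_sym.
- exact: mx1_orth.
- by apply: cframe_orth; exact: some_frameP.
- by rewrite mulmxA.
- exact: oe.
Qed.

Lemma frame_changeM (e e' : local_frame g) x : ldom e' x ->
  frame_change e e' x *m lframe e' x = lframe e x.
Proof.
move=> e'x; rewrite /frame_change -!mulmxA (mulmxA (gram g x)).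
by rewrite (orth_inv (lframe_orth e'x)) mulmx1.
Qed.

Lemma frame_change_orth (e e' : local_frame g) x : ldom e x -> ldom e' x ->
  frame_change e e' x *m (frame_change e e' x)^T = 1%:M.
Proof.
move=> ex e'x; rewrite {2}/frame_change !trmx_mul trmxK gram_sym !mulmxA frame_changeM //.
exact: lframe_orth.
Qed.

Definition transition (e e' : local_frame g) x : NS_model -> NS_model :=
  fock_map (mulmxr (cx (frame_change e e' x)) : {linear 'rV[C]_n -> 'rV[C]_n}).

(** Both frames are orthonormal for g, so that the matrix between them is
orthogonal, that is, an isometry of the model inner product space. *)
Lemma transition_aut (e e' : local_frame g) x : ldom e x -> ldom e' x ->
  scva_aut (NS_model_data R n) (transition e e' x).
Proof.
move=> ex e'x; rewrite /scva_aut model_dataE.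
have h : cx (frame_change e e' x) *m (cx (frame_change e e' x))^T = 1%:M.
  by rewrite -complexifyT -complexifyM frame_change_orth // complexify1.
apply: (form_iso (B' := (cx (frame_change e e' x))^T)) => //; try exact: trmx1.
- exact: mx1_orth.
- exact: mx1_orth.
- by rewrite mulmx1.
Qed.

Lemma transitionE (e e' : local_frame g) x v : ldom e' x ->
  triv (b := NS_bundle g) e x v = triv (b := NS_bundle g) e' x (transition e e' x v).
Proof.
move=> e'x; rewrite /transition /=; symmetry; apply: fock_map_comp => y /=.
by rewrite -mulmxA -complexifyM frame_changeM.
Qed.

Lemma transition_vsmooth (e e' : local_frame g) v :
  vsmooth (ldom e `&` ldom e') (fun x => transition e e' x v).
Proof.
apply: (vsmooth_fock_map (O := fun x => cx (frame_change e e' x))).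
  by apply: openI; exact: ldom_open.
move=> a b; rewrite (_ : (fun x => _) = fun x => ((frame_change e e' x a b)%:C)%C).
  by apply: mcsmooth_real; exact: frame_change_smooth.
by apply/funext => x; rewrite mxE.
Qed.

Lemma NS_is_bundle : is_bundle (NS_bundle g).
Proof.
split=> [e|x|e x ex|e e' v].
- exact: ldom_open.
- exact: exists_local_frame.
- exact: iso_bij (frame_iso ex).
exists (fun x => transition e e' x v); split; first exact: transition_vsmooth.
by move=> x _ e'x; exact: transitionE.
Qed.

Lemma NS_is_N1SCVA_bundle :
  is_N1SCVA_bundle (NS_model_data R n) (3 / 2 * n%:R) (E := NS_bundle g) (NS_fiber_data g).
Proof.
split.
- exact: NS_is_bundle.
- exact: model_N1SCVA.
- exact: fiber_N1SCVA.
- exact: frame_iso.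
- move=> e e' x ex e'x; exists (transition e e' x); first exact: transition_aut.
  by move=> v; exact: transitionE.
Qed.

End Fibers.

(** * Sections of the bundle *)

Lemma fock_map_wmul (K : numFieldType) (T T' : lmodType K) (h : {linear T -> T'})
    (c : nat -> K) v : fock_map h (wmul c v) = wmul c (fock_map h v).
Proof.
move: v; apply: fmono_ext_eq => [||w].
- exact: (lin_comp (lin_fock_map h) (@lin_wmul _ _ c)).
- exact: (lin_comp (@lin_wmul _ _ c) (lin_fock_map h)).
by rewrite wmulM (linZ (lin_fock_map h)) fock_mapM wmulM wt2_lmap.
Qed.

Lemma fock_le_wmul (K : fieldType) (T : lmodType K) (c : nat -> K) N (v : fock T) :
  fock_le N v -> fock_le N (wmul c v).
Proof.
move=> h; apply: (spanned_map (f := wmul c) (P := fun w => (wt2 w <= N)%N)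
  (Q := fun w => (wt2 w <= N)%N)) h; first exact: lin_wmul.
by move=> w hw; rewrite wmulM; apply: spannedZ; exact: spanned_mono.
Qed.

Lemma fock_le_mono (K : fieldType) (T : lmodType K) (w : fword T) N :
  (wt2 w <= N)%N -> fock_le N (fmono w).
Proof. exact: (@spanned_mono K T (fun w => (wt2 w <= N)%N)). Qed.

Section Sections.
Context {R : realType} {n : nat} {M : manifold R n} (g : riemannian_metric M).
Local Notation C := R[i].
Local Notation dx := (NS_fiber_data g).
Implicit Types (A B : NS_gamma g) (x : M) (p q : bool) (k m : int).

Lemma gamma_smooth A : smooth_section (E := NS_bundle g) (gamma_val A).
Proof. by case: A => A /= /asboolP[]. Qed.

Lemma gamma_bound A : exists N, forall x, fock_le N (gamma_val A x).
Proof. by case: A => A /= /asboolP[]. Qed.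

Definition mk_gamma (A : fibers_prod (NS_fiber (M := M))) (h : NS_section g A) : NS_gamma g :=
  NSGamma (asboolT h).

Lemma gamma_ext A B : (forall x, gamma_val A x = gamma_val B x) -> A = B.
Proof. by move=> h; apply: val_inj; apply: functional_extensionality_dep. Qed.

(** The structure vectors correspond to one and the same vector of the model in
every trivialization. *)
Lemma cst_section (A : fibers_prod (NS_fiber (M := M))) (v : @NS_model R n) N :
  (forall (e : local_frame g) x, ldom e x -> A x = triv (b := NS_bundle g) e x v) ->
  fock_le N v -> NS_section g A.
Proof.
move=> hA hv; split=> [e|].
  exists (fun=> v); split=> [|x ex]; last exact: hA.
  exact: (@vsmooth_cst R n M (@NS_model R n)).
by exists N => x; have [e ex] := exists_local_frame g x; rewrite (hA e) //; exact: fock_map_le.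
Qed.

Lemma vac_section : NS_section g (fun x => vac (dx x)).
Proof.
apply: (cst_section (v := vac (NS_model_data R n)) (N := 0)).
  by move=> e x /frame_iso/iso_vac.
by apply: fock_le_mono; rewrite /wt2 big_nil.
Qed.

Lemma nu_section : NS_section g (fun x => nu (dx x)).
Proof.
apply: (cst_section (v := nu (NS_model_data R n)) (N := 4)).
  by move=> e x /frame_iso/iso_nu.
pose P (w : fword 'rV[C]_n) := (wt2 w <= 4)%N.
by apply: (@spannedD _ _ P); apply: spannedZ; apply: spanned_sum => i;
  apply: fock_le_mono; rewrite !wt2_cons /wt2 big_nil.
Qed.

Lemma tau_section : NS_section g (fun x => tau (dx x)).
Proof.
apply: (cst_section (v := tau (NS_model_data R n)) (N := 3)).
  by move=> e x /frame_iso/iso_tau.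
by apply: (@spanned_sum _ _ (fun w => (wt2 w <= 3)%N)) => i;
  apply: fock_le_mono; rewrite !wt2_cons /wt2 big_nil.
Qed.

Lemma cmetric_linl x (a : C) u v w :
  cmetric g (x := x) (a *: u + v) w = a * cmetric g u w + cmetric g v w.
Proof. exact: mform_linl. Qed.

Lemma cmetric_sym x u v : cmetric g (x := x) u v = cmetric g v u.
Proof. by apply: mform_sym; exact: cgram_sym. Qed.

(** Trivializations intertwine the modes with those of the model, which are fixed
bilinear operations. *)
Lemma mode_section A k B :
  NS_section g (fun x => mode (dx x) (gamma_val A x) k (gamma_val B x)).
Proof.
split=> [e|].
  have [h [sh hE]] := gamma_smooth A e; have [h' [sh' hE']] := gamma_smooth B e.
  exists (fun x => mode (NS_model_data R n) (h x) k (h' x)); split=> [|x ex]; last first.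
    by rewrite hE // hE' // (iso_mode (frame_iso ex)).
  rewrite model_dataE.
  have l1 (a : C) u v w : mform 1%:M (a *: u + v) w =
      a * mform 1%:M u w + mform (1%:M : 'M[C]_n) v w by exact: mform_linl.
  have l2 u v : mform (1%:M : 'M[C]_n) u v = mform 1%:M v u by apply: mform_sym; exact: trmx1.
  apply: (vsmooth_bilin (B := fun u v => fock_mode (mform 1%:M) u k v)) => //.
  - exact: ldom_open.
  - by move=> v; exact: lin_model.
  - by move=> u; exact: lin_moder.
have [N hA] := gamma_bound A; have [N' hB] := gamma_bound B.
exists (absz (N%:Z + N'%:Z - 2 * (k + 1) : int)%R) => x.
have h := mode_wle (@cmetric_linl x) (@cmetric_sym x) k
  ((wle_le _ _).2 (hA x)) ((wle_le _ _).2 (hB x)).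
by apply: (wle_le _ _).1; apply: wleS h; lia.
Qed.

Lemma wmul_section (c : nat -> C) A : NS_section g (fun x => wmul c (gamma_val A x)).
Proof.
split=> [e|]; last first.
  by have [N hA] := gamma_bound A; exists N => x; exact: fock_le_wmul.
have [h [sh hE]] := gamma_smooth A e; exists (fun x => wmul c (h x)); split=> [|x ex].
  by apply: vsmooth_map sh; exact: lin_wmul.
by rewrite hE //= -fock_map_wmul.
Qed.

Definition gamma_wmul c A := mk_gamma (wmul_section c A).

Definition gamma_data : scva_data (NS_gamma g) := {|
  gr := fun p A => forall x, gr (dx x) p (gamma_val A x);
  vac := mk_gamma vac_section;
  mode := fun A k B => mk_gamma (mode_section A k B);
  nu := mk_gamma nu_section;
  tau := mk_gamma tau_section |}.

Lemma gamma_pointwise : pointwise_data gamma_data.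
Proof. by split. Qed.

End Sections.

Section SectionsN1SCVA.
Context {R : realType} {n : nat} {M : manifold R n} (g : riemannian_metric M).
Local Notation C := R[i].
Local Notation dx := (NS_fiber_data g).
Local Notation d := (gamma_data g).
Implicit Types (A B : NS_gamma g) (x : M) (p q : bool) (k m : int).

Let fib x := fiber_N1SCVA g x.
Let conf x := n1_conf (fib x).
Let va x := conf_va (conf x).

Lemma gamma_sum (I : Type) (r : seq I) (F : I -> NS_gamma g) x :
  gamma_val (\sum_(i <- r) F i) x = \sum_(i <- r) gamma_val (F i) x.
Proof. by elim: r => [|i r ih]; rewrite ?big_nil // !big_cons -ih. Qed.

Lemma wmul_sum_weights N x (v : NS_fiber x) : fock_le N v ->
  v = \sum_(i < N.+1) wmul (fun j : nat => (j == i)%:R) v.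
Proof.
move=> hv; apply: (@spanned_ind _ _ (fun w => (wt2 w <= N)%N) id
  (fun v => \sum_(i < N.+1) wmul (fun j : nat => (j == i)%:R) v) v _ _ _ hv).
- exact: lin_id.
- by apply: lin_bigsum => i; exact: lin_wmul.
move=> w wN; rewrite (bigD1 (Ordinal (wN : wt2 w < N.+1)%N)) //= wmulM eqxx scale1r.
rewrite big1 ?addr0 // => i; rewrite wmulM -val_eqE /= eq_sym => /negPf ->.
by rewrite scale0r.
Qed.

(** A section has finitely many components of given weight, as its weights are
bounded over M, and these are smooth by [wmul_section]. *)
Lemma gamma_diagonalizable : diagonalizable_op (vir d 0).
Proof.
move=> A; have [N hA] := gamma_bound A.
exists N.+1, (fun i : 'I_N.+1 => gamma_wmul (fun j : nat => (j == i)%:R) A),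
  (fun i : 'I_N.+1 => i%:R / 2).
split=> [i|]; apply: gamma_ext => x.
  have sp u : u = \sum_a cmetric g u (@cframe _ _ _ g x a) *: @cframe _ _ _ g x a.
    by apply: mform_span; apply/orth_inv/cframe_orth; exact: some_frameP.
  have E := nu1_wmul (@cmetric_linl _ _ _ g x) (@cmetric_sym _ _ _ g x) sp.
  transitivity (wmul (fun j => j%:R / 2) (wmul (fun j : nat => (j == i)%:R) (gamma_val A x))).
    exact: E.
  transitivity ((i%:R / 2) *: wmul (fun j : nat => (j == i)%:R) (gamma_val A x)); last by [].
  rewrite wmul_comp; move: (gamma_val A x).
  apply: fmono_ext_eq => [||w]; [exact: lin_wmul|exact/lin_scale/lin_wmul|].
  rewrite !wmulM scalerA; congr (_ *: _).
  by case: eqP => [->|_]; rewrite ?mul1r ?mulr1 ?mul0r ?mulr0.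
rewrite gamma_sum; exact: wmul_sum_weights.
Qed.

(** Identities are inherited from the fibers.  The axioms asserting the existence
of a bound need one that is the same for all fibers: it comes from the bounds on
the weights of the two sections. *)
Lemma gamma_vertex_algebra : is_vertex_algebra d.
Proof.
split.
- by move=> p x; exact: va_gr0 (va x) p.
- by move=> p k A B hA hB x; exact: va_grP (va x) _ _ _ _ (hA x) (hB x).
- move=> A; exists (gamma_wmul (fun j : nat => (odd j == false)%:R) A),
    (gamma_wmul (fun j : nat => (odd j == true)%:R) A).
  split=> [x|x|]; try exact: pproj_gr.
  by apply: gamma_ext => x; exact: pproj_sum.
- by move=> A h0 h1; apply: gamma_ext => x; exact: va_gr_direct (va x) _ (h0 x) (h1 x).
- by move=> k A B m D; apply: gamma_ext => x; exact: va_linl (va x) _ _ _ _ _.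
- by move=> k A m B D; apply: gamma_ext => x; exact: va_linr (va x) _ _ _ _ _.
- by move=> p q A m B hA hB x; exact: va_gr_mode (va x) _ _ _ _ _ (hA x) (hB x).
- move=> A B; have [N hA] := gamma_bound A; have [N' hB] := gamma_bound B.
  exists (N + N')%N%:Z => m hm; apply: gamma_ext => x.
  have h := mode_wle (@cmetric_linl _ _ _ g x) (@cmetric_sym _ _ _ g x) m
    ((wle_le _ _).2 (hA x)) ((wle_le _ _).2 (hB x)).
  by apply: (wle_lt0 _ h); lia.
- by move=> x; exact: va_gr_vac (va x).
- by move=> A m B; apply: gamma_ext => x; exact: va_trans (va x) _ _ _.
- move=> m A; apply: gamma_ext => x; rewrite [LHS](va_vac (va x)).
  by case: (m == -1).
- move=> A; split=> [|m hm]; apply: gamma_ext => x.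
    exact: (va_creation (va x) _).1.
  exact: (va_creation (va x) _).2.
move=> p q A B hA hB; have [N bA] := gamma_bound A; have [N' bB] := gamma_bound B.
exists (N + N')%N => m k D; apply: gamma_ext => x; rewrite gamma_sum.
exact: (mode_local (@cmetric_linl _ _ _ g x) (@cmetric_sym _ _ _ g x)
  (spanned_gr_le (hA x) (bA x)) (spanned_gr_le (hB x) (bB x)) (leqnn _)).
Qed.

Lemma gamma_N1SCVA : is_N1SCVA d (3 / 2 * n%:R).
Proof.
split; first split.
- exact: gamma_vertex_algebra.
- by move=> x; exact: conf_gr (conf x).
- move=> m k A; apply: gamma_ext => x; have := conf_vir (conf x) m k (gamma_val A x).
  by case: (m + k == 0).
- by move=> A; apply: gamma_ext => x; exact: conf_trans (conf x) _.
- exact: gamma_diagonalizable.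
- by move=> x; exact: n1_gr (fib x).
- move=> r s A; apply: gamma_ext => x; have := n1_GG (fib x) r s (gamma_val A x).
  by case: (r + s == 1).
- by move=> r m A; apply: gamma_ext => x; exact: n1_GL (fib x) _ _ _.
Qed.

End SectionsN1SCVA.

Theorem theorem4p1 (R : realType) (n : nat) (M : manifold R n)
    (g : riemannian_metric M) :
  is_N1SCVA_bundle (NS_model_data R n) (3 / 2 * n%:R : R[i])
    (E := NS_bundle g) (NS_fiber_data g) /\
  exists d : scva_data (NS_gamma g),
    pointwise_data d /\ is_N1SCVA d (3 / 2 * n%:R : R[i]).
Proof.
split; first exact: NS_is_N1SCVA_bundle.
by exists (gamma_data g); split; [exact: gamma_pointwise|exact: gamma_N1SCVA].
Qed.
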